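(* Let $M$ be a compact 4-manifold with an almost complex structure $J$, and let $\omega_1$ and $\omega_2$ be almost-Kähler forms on $(M,J)$ which are cohomologous, $[\omega_1]=[\omega_2]\in H^2(M;\mathbb R)$, and satisfy $\omega_1^2=\omega_2^2$. Then $\omega_1=\omega_2$. In other words, on a compact almost-Kähler 4-manifold $(M,\omega,J)$, solutions $\omega'$ of the equation $\omega'^2=e^F\omega^2$ among almost-Kähler forms on $(M,J)$ are unique in their cohomology class.
   Context: An almost-Kähler form on $(M,J)$ is a symplectic form $\omega$ compatible with the (not necessarily integrable) almost complex structure $J$, meaning that $g(\cdot,\cdot)=\omega(\cdot,J\cdot)$ is a Riemannian metric (symmetric and positive definite); $(M,\omega,J)$ is then called an almost-Kähler manifold. $\omega^2=\omega\wedge\omega$, and $F$ is a smooth real function. *)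

(* Defs.v *)
From HB Require Import structures.
From mathcomp Require Import all_boot all_order all_algebra.
From mathcomp Require Import all_classical all_reals all_analysis.
Set Implicit Arguments.
Unset Strict Implicit.
Unset Printing Implicit Defensive.
Import Order.TTheory GRing.Theory Num.Theory.
Import numFieldNormedType.Exports.
Local Open Scope classical_set_scope.
Local Open Scope ring_scope.

(* Vectors of R^n are row vectors and linear maps act on them from the right,
   so that the differential of f at x is
   v |-> v *m 'J f x. *)

(* U is meant to be open.  In finite dimension, the Frechet derivative is C^k
   as an operator-valued map iff x |-> 'd f x v is C^k for every v. *)
Fixpoint Ck (R : realType) (V W : normedModType R) (k : nat) (U : set V)
    (f : V -> W) : Prop :=
  if k is k'.+1 then
    (forall x, U x -> differentiable f x) /\
    (forall v, Ck k' U (fun x => 'd f x v))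
  else forall x, U x -> {for x, continuous f}.

Definition smooth_on (R : realType) (V W : normedModType R) (U : set V)
  (f : V -> W) : Prop := forall k, Ck k U f.

(* Smooth n-manifolds without boundary.  The atlas need not be maximal: any
   atlas determines the smooth structure.  The inverse chart_inv c is only
   meaningful on the image of chart_map c. *)
Record manifold (R : realType) (n : nat) := Manifold {
  point :> topologicalType;
  chart : Type;
  chart_dom : chart -> set point;
  chart_map : chart -> point -> 'rV[R]_n;
  chart_inv : chart -> 'rV[R]_n -> point;
  manifold_hausdorff : hausdorff_space point;
  manifold_second_countable : @second_countable point;
  chart_cover : forall p, exists c, chart_dom c p;
  chart_dom_open : forall c, open (chart_dom c);
  chart_img_open : forall c, open (chart_map c @` chart_dom c);
  chart_mapK : forall c p, chart_dom c p -> chart_inv c (chart_map c p) = p;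
  chart_map_continuous :
    forall c p, chart_dom c p -> {for p, continuous (chart_map c)};
  chart_inv_continuous :
    forall c x, (chart_map c @` chart_dom c) x ->
      {for x, continuous (chart_inv c)};
  chart_transition_smooth : forall c c',
    smooth_on (chart_map c @` (chart_dom c `&` chart_dom c'))
              (chart_map c' \o chart_inv c)
}.

Section Tensors.
Context {R : realType} {n : nat} {M : manifold R n}.

Definition chart_img (c : chart M) : set 'rV[R]_n :=
  chart_map c @` chart_dom c.

Definition overlap (c c' : chart M) : set 'rV[R]_n :=
  chart_map c @` (chart_dom c `&` chart_dom c').

Definition transition (c c' : chart M) : 'rV[R]_n -> 'rV[R]_n :=
  chart_map c' \o chart_inv c.

Definition smooth_function (f : M -> R) : Prop :=
  forall c : chart M, smooth_on (chart_img c) (f \o chart_inv c : _ -> R^o).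

(* Tensor fields are given by their components in every chart, as functions of
   the coordinates, subject to the transformation law of tensors.  Forms are
   extended by 0 outside the image of each chart, so that equality of forms is
   Leibniz equality. *)

(* In the chart c, the form at x is v |-> v *m alpha c x. *)
Record form1 := Form1 {
  form1_comp :> chart M -> 'rV[R]_n -> 'cV[R]_n;
  form1_smooth : forall c, smooth_on (chart_img c) (form1_comp c);
  form1_transform : forall c c' x, overlap c c' x ->
    form1_comp c x =
    'J (transition c c') x *m form1_comp c' (transition c c' x);
  form1_out : forall c x, ~ chart_img c x -> form1_comp c x = 0
}.

(* In the chart c, the form at x is (u, v) |-> u *m omega c x *m v^T. *)
Record form2 := Form2 {
  form2_comp :> chart M -> 'rV[R]_n -> 'M[R]_n;
  form2_smooth : forall c, smooth_on (chart_img c) (form2_comp c);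
  form2_alt : forall c x, (form2_comp c x)^T = - form2_comp c x;
  form2_transform : forall c c' x, overlap c c' x ->
    form2_comp c x = 'J (transition c c') x
      *m form2_comp c' (transition c c' x) *m ('J (transition c c') x)^T;
  form2_out : forall c x, ~ chart_img c x -> form2_comp c x = 0
}.

Definition form2_eval (w : form2) (c : chart M) (x u v : 'rV[R]_n) : R :=
  (u *m w c x *m v^T) 0 0.

(* In the chart c, the endomorphism at x is v |-> v *m J c x. *)
Record almost_complex := AlmostComplex {
  ac_comp :> chart M -> 'rV[R]_n -> 'M[R]_n;
  ac_smooth : forall c, smooth_on (chart_img c) (ac_comp c);
  ac_square : forall c x, chart_img c x ->
    ac_comp c x *m ac_comp c x = - 1%:M;
  ac_transform : forall c c' x, overlap c c' x ->
    ac_comp c x *m 'J (transition c c') x =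
    'J (transition c c') x *m ac_comp c' (transition c c' x)
}.

Definition partial (i : 'I_n) (f : 'rV[R]_n -> R) (x : 'rV[R]_n) : R :=
  'D_(delta_mx 0 i) (f : _ -> R^o) x.

Definition d1 (a : form1) (c : chart M) (x : 'rV[R]_n) : 'M[R]_n :=
  \matrix_(i, j) (partial i (fun y => a c y j 0) x
                  - partial j (fun y => a c y i 0) x).

Definition d2 (w : form2) (c : chart M) (x : 'rV[R]_n) (i j k : 'I_n) : R :=
  partial i (fun y => w c y j k) x + partial j (fun y => w c y k i) x
  + partial k (fun y => w c y i j) x.

Definition closed_form (w : form2) : Prop :=
  forall c x, chart_img c x -> forall i j k, d2 w c x i j k = 0.

(* The class of w in H^2(M; R) = closed 2-forms / exact 2-forms, as a coset. *)
Definition deRham_class (w : form2) : set form2 :=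
  [set w' : form2 | closed_form w' /\
    exists a : form1, forall c x, chart_img c x -> w' c x - w c x = d1 a c x].

(* The components of a 4-form in the charts. *)
Definition form4_comp :=
  chart M -> 'rV[R]_n -> 'I_n -> 'I_n -> 'I_n -> 'I_n -> R.

(* Sum over the (2, 2)-shuffles of (i, j, k, l). *)
Definition wedge (w w' : form2) : form4_comp := fun c x i j k l =>
  w c x i j * w' c x k l - w c x i k * w' c x j l + w c x i l * w' c x j k
  + w c x j k * w' c x i l - w c x j l * w' c x i k + w c x k l * w' c x i j.

Definition scale4 (f : M -> R) (s : form4_comp) : form4_comp :=
  fun c x i j k l => f (chart_inv c x) * s c x i j k l.

Definition symplectic (w : form2) : Prop :=
  closed_form w /\
  forall c x, chart_img c x ->
    forall u, (forall v, form2_eval w c x u v = 0) -> u = 0.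

(* w is compatible with J: g(u, v) = w(u, J v) is a Riemannian metric. *)
Definition compatible (J : almost_complex) (w : form2) : Prop :=
  forall c x, chart_img c x ->
    let g u v := form2_eval w c x u (v *m J c x) in
    (forall u v, g u v = g v u) /\ (forall u, u != 0 -> 0 < g u u).

Definition almost_kahler (J : almost_complex) (w : form2) : Prop :=
  symplectic w /\ compatible J w.

End Tensors.

Arguments form1 {R n} M.
Arguments form2 {R n} M.
Arguments almost_complex {R n} M.

(* Main.v *)
(* Let B = w2 - w1 = da and W = w1 + w2.  Both are J-invariant, W tames J, and
   w1 ^ w1 = w2 ^ w2 says that B ^ W = 0; by the Hodge index theorem for
   (1, 1)-forms at a point, B ^ B is then a nonpositive multiple of W ^ W, which
   vanishes only where B does.  As B ^ B = d(a ^ B) integrates to 0 over M,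
   oriented by W ^ W, it follows that B = 0.

   The integral over M is replaced by a sum over a partition of unity P_i
   subordinate to coordinate boxes: in the i-th box, the integral of P_i (B ^ B)
   is minus that of dP_i ^ a ^ B.  Multiplying by the sum of the P_j, which is 1,
   and moving the (i, j) term to the j-th chart, where the sum of the dP_i is 0,
   shows that these integrals add up to 0.

   On R^4, the integral of continuous functions with compact support is iterated
   from antiderivatives on the line.  Linear changes of variables follow from
   the uniqueness of Haar measure and an LU decomposition, and the general ones
   from a smoothing kernel. *)

Require Import Defs.
From HB Require Import structures.
From mathcomp Require Import all_boot all_order all_algebra all_fingroup.
From mathcomp Require Import all_classical all_reals all_analysis.
From mathcomp Require Import ring lra.
Set Implicit Arguments.
Unset Strict Implicit.
Unset Printing Implicit Defensive.
Import Order.TTheory GRing.Theory Num.Theory.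
Import numFieldNormedType.Exports.
Local Open Scope classical_set_scope.
Local Open Scope ring_scope.

(** * Positive functionals on compactly supported functions *)

(** Neither the manifold nor its atlas is assumed oriented. A 4-form transforms with the Jacobian
    determinant, whereas the change of variables for an integral produces its absolute value. The
    mismatch is absorbed by a sign attached to each box, that of the component of [W] ^ [W] there:
    an integral multiplied by this sign does not depend on the chart.

    Integration is handled as a functional on continuous functions with compact support. A bound on
    functions supported in a fixed ball, together with compactness of balls, justifies every passage
    to the limit (differentiation under the integral, blow-up of the kernel, difference quotients).
    Strict positivity turns a zero integral of a nonnegative function into vanishing at every point,
    with no null sets to discard.

    The cutoffs are differentiated only once, so C^1 functions built from squares of positive parts
    replace the usual exponential bumps. Since [B] is both exact and closed, d(f a ^ B) = df ^ a ^ B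
    + f B ^ B, and this is the only identity between forms to be integrated. *)

Section Radon.
Context {R : realType}.
Implicit Types (X Y : normedModType R).

Definition supp_in Y (N : R) (f : Y -> R) := forall y, N < `|y| -> f y = 0.

Definition Cc Y (f : Y -> R) := continuous f /\ exists N, supp_in N f.

(* The third clause, strict positivity, says that the measure has full support. *)
Definition radon Y (I : (Y -> R) -> R) : Prop :=
  [/\ forall a f g, Cc f -> Cc g ->
        I (fun y => a * f y + g y) = a * I f + I g,
      forall f, Cc f -> (forall y, 0 <= f y) -> 0 <= I f,
      forall f, Cc f -> (forall y, 0 <= f y) -> I f = 0 -> forall y, f y = 0 &
      forall N, exists2 C, 0 <= C & forall f e, continuous f -> supp_in N f ->
        (forall y, `|f y| <= e) -> `|I f| <= C * e].

Definition proper Y := forall N : R, compact [set y : Y | `|y| <= N].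

Lemma supp_inW Y (N N' : R) (f : Y -> R) : N <= N' -> supp_in N f -> supp_in N' f.
Proof. by move=> NN' sf y /(le_lt_trans NN'); exact: sf. Qed.

Lemma Cc_lin Y (a : R) (f g : Y -> R) :
  Cc f -> Cc g -> Cc (fun y => a * f y + g y).
Proof.
move=> [cf [N sf]] [cg [N' sg]]; split.
  move=> y; apply: cvgD; last exact: cg.
  by apply: cvgM; [exact: cvg_cst|exact: cf].
exists (Num.max N N') => y; rewrite gt_max => /andP[Ny N'y].
by rewrite sf// sg// mulr0 addr0.
Qed.

Lemma Cc0 Y : Cc (fun _ : Y => 0 : R).
Proof. by split; [exact: cst_continuous|exists 0]. Qed.

Lemma CcZ Y (a : R) (f : Y -> R) : Cc f -> Cc (fun y => a * f y).
Proof.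
move=> cf; have := Cc_lin a cf (@Cc0 Y); congr Cc.
by apply/funext => y; rewrite addr0.
Qed.

Lemma CcB Y (f g : Y -> R) : Cc f -> Cc g -> Cc (fun y => f y - g y).
Proof.
move=> cf cg; have := Cc_lin (-1) cg cf; congr Cc.
by apply/funext => y; rewrite mulN1r addrC.
Qed.

Lemma CcD Y (f g : Y -> R) : Cc f -> Cc g -> Cc (fun y => f y + g y).
Proof.
move=> cf cg; have := Cc_lin 1 cf cg; congr Cc.
by apply/funext => y; rewrite mul1r.
Qed.

Lemma Cc_sum Y (J : Type) (r : seq J) (f : J -> Y -> R) :
  (forall j, Cc (f j)) -> Cc (fun y => \sum_(j <- r) f j y).
Proof.
move=> cf; elim: r => [|j r IH].
  by have := @Cc0 Y; congr Cc; apply/funext => y; rewrite big_nil.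
by have := CcD (cf j) IH; congr Cc; apply/funext => y; rewrite big_cons.
Qed.

Lemma continuous_addr (T : topologicalType) Y (f g : T -> Y) :
  continuous f -> continuous g -> continuous (fun t => f t + g t).
Proof. by move=> cf cg t; apply: cvgD; [exact: cf|exact: cg]. Qed.

Lemma continuous_subr (T : topologicalType) Y (f g : T -> Y) :
  continuous f -> continuous g -> continuous (fun t => f t - g t).
Proof. by move=> cf cg t; apply: cvgB; [exact: cf|exact: cg]. Qed.

Lemma continuous_mulr (T : topologicalType) (f g : T -> R) :
  continuous f -> continuous g -> continuous (fun t => f t * g t).
Proof. by move=> cf cg t; apply: cvgM; [exact: cf|exact: cg]. Qed.

Lemma continuous_compr (T U V : topologicalType) (f : T -> U) (g : U -> V) :
  continuous f -> continuous g -> continuous (fun t => g (f t)).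
Proof. by move=> cf cg t; apply: continuous_comp; [exact: cf|exact: cg]. Qed.

Section Linear.
Variables (Y : normedModType R) (I : (Y -> R) -> R).
Hypothesis I_int : radon I.

Lemma radonZ a f : Cc f -> I (fun y => a * f y) = a * I f.
Proof.
have [lin _ _ _] := I_int.
have I0 : I (fun=> 0) = 0.
  have := lin 1 _ _ (@Cc0 Y) (@Cc0 Y); rewrite mul1r mul1r addr0.
  by move/eqP; rewrite -subr_eq0 opprD addNKr oppr_eq0 => /eqP.
move=> cf; have := lin a _ _ cf (@Cc0 Y).
by rewrite I0 addr0 => <-; congr I; apply/funext => y; rewrite addr0.
Qed.

Lemma radon0 : I (fun=> 0) = 0.
Proof.
rewrite -[RHS](mul0r (I (fun=> 0))) -(radonZ _ (@Cc0 Y)).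
by congr I; apply/funext => y; rewrite mul0r.
Qed.

Lemma radonD f g : Cc f -> Cc g -> I (fun y => f y + g y) = I f + I g.
Proof.
move=> cf cg; have [lin _ _ _] := I_int; have := lin 1 _ _ cf cg.
by rewrite mul1r => <-; congr I; apply/funext => y; rewrite mul1r.
Qed.

Lemma radonB f g : Cc f -> Cc g -> I (fun y => f y - g y) = I f - I g.
Proof.
move=> cf cg; have [lin _ _ _] := I_int; have := lin (-1) _ _ cg cf.
rewrite mulN1r addrC => <-.
by congr I; apply/funext => y; rewrite mulN1r addrC.
Qed.

Lemma radon_sum (J : Type) (r : seq J) (f : J -> Y -> R) :
  (forall j, Cc (f j)) ->
  I (fun y => \sum_(j <- r) f j y) = \sum_(j <- r) I (f j).
Proof.
move=> cf; elim: r => [|j r IH].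
  by rewrite big_nil -[RHS]radon0; congr I; apply/funext => y; rewrite big_nil.
rewrite big_cons -IH -radonD //; last exact: Cc_sum.
by congr I; apply/funext => y; rewrite big_cons.
Qed.

(** The limit theorem behind all later arguments. Closeness is asked only near each point;
    compactness of the ball of radius [N] makes it uniform there, both functions vanish outside, and
    the last clause of [radon] concludes. *)
Lemma radon_cvg (T : Type) (F : set_system T) (FF : Filter F)
    (f : T -> Y -> R) (f0 : Y -> R) (N : R) : proper Y ->
  (\forall t \near F, continuous (f t) /\ supp_in N (f t)) ->
  continuous f0 -> supp_in N f0 ->
  (forall (z : Y) (e : R), 0 < e ->
    \forall z' \near z & t \near F, `|f t z' - f0 z'| <= e) ->
  I (f t) @[t --> F] --> I f0.
Proof.
move=> pY ft cf0 sf0 ff0.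
have [lin _ _ /(_ N)[C C0 bnd]] := I_int.
apply/cvgrPdist_le => e e0.
(* The bound [C] may be 0, hence the added 1. *)
have d0 : 0 < e / (C + 1) by rewrite divr_gt0// ltr_wpDl.
have /compact_near_coveringP := pY N.
move=> /(_ T F (fun t z => `|f t z - f0 z| <= e / (C + 1)) FF) cov.
have {}cov := cov (fun z _ => ff0 z _ d0).
near=> t.
have [ct st] : continuous (f t) /\ supp_in N (f t) by near: t.
rewrite distrC -radonB; [|by split => //; exists N..].
apply: le_trans (bnd _ (e / (C + 1)) _ _ _) _.
- by move=> y; apply: cvgB; [exact: ct|exact: cf0].
- by move=> y Ny; rewrite st// sf0// subrr.
- move=> y; have [yN|Ny] := leP `|y| N.
    by move: y yN; near: t.
  by rewrite st// sf0// subrr normr0 ltW.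
- rewrite mulrC mulrAC ler_pdivrMr ?ltr_wpDl// ler_wpM2l ?(ltW e0)//.
  by rewrite lerDl.
Unshelve. all: by end_near. Qed.

End Linear.

(** Parametrizing the segment by [t] covers [a < b], [b < a] and [a = b] at once, which suits
    increments of unknown sign. *)
Lemma MVT_is_derive (f df : R -> R) (a b : R) :
  (forall t, t \in `[0, 1] -> is_derive (a + t * (b - a)) 1 f (df (a + t * (b - a)))) ->
  exists2 t, t \in `[0, 1] & f b - f a = df (a + t * (b - a)) * (b - a).
Proof.
have gen (c d : R) : c <= d -> (forall x, x \in `[c, d] -> is_derive x 1 f (df x)) ->
    exists2 x, x \in `[c, d] & f d - f c = df x * (d - c).
  move=> cd fd; have fd' x : x \in `]c, d[ -> is_derive x 1 f (df x).
    by move=> xcd; exact: fd (subset_itv_oo_cc xcd).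
  have := MVT_segment cd fd'; apply.
  apply: derivable_within_continuous => x xcd.
  by have [] := fd _ xcd.
move=> fd; have [ab|ab] := eqVneq a b.
  by exists 0; rewrite ?bound_itvE ?ler01// ab !subrr mulr0.
have ba0 : b - a != 0 by rewrite subr_eq0 eq_sym.
have ab0 : a - b != 0 by rewrite subr_eq0.
have [lab|lba] := leP a b.
  have ba : 0 < b - a by rewrite lt_neqAle eq_sym ba0 subr_ge0.
  have par x : x \in `[a, b] -> (x - a) / (b - a) \in `[0, 1].
    rewrite !in_itv/= => /andP[ax xb].
    by rewrite ler_pdivrMr// mul1r lerD2r xb andbT divr_ge0 ?subr_ge0// ltW.
  have parE x : a + (x - a) / (b - a) * (b - a) = x by field.
  have fab x : x \in `[a, b] -> is_derive x 1 f (df x).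
    by move=> xab; have := fd _ (par _ xab); rewrite parE.
  have [x xab E] := gen _ _ lab fab.
  by exists ((x - a) / (b - a)); [exact: par|rewrite parE].
have ba : 0 < a - b by rewrite subr_gt0.
have par x : x \in `[b, a] -> (a - x) / (a - b) \in `[0, 1].
  rewrite !in_itv/= => /andP[ax xb].
  by rewrite ler_pdivrMr// mul1r lerB// divr_ge0 ?subr_ge0// ltW.
have parE x : a + (a - x) / (a - b) * (b - a) = x.
  by field.
have fba x : x \in `[b, a] -> is_derive x 1 f (df x).
  by move=> xab; have := fd _ (par _ xab); rewrite parE.
have [x xab E] := gen _ _ (ltW lba) fba.
exists ((a - x) / (a - b)); first exact: par.
by rewrite parE -opprB E -mulrN opprB.
Qed.

Lemma MVT_global (f df : R -> R) (a b : R) :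
  (forall x : R, is_derive x 1 f (df x)) ->
  exists2 t, t \in `[0, 1] & f b - f a = df (a + t * (b - a)) * (b - a).
Proof. by move=> fd; have := MVT_is_derive (fun t (_ : t \in `[0, 1]) => fd (a + t * (b - a))). Qed.

End Radon.

(** * Integration on the line *)

Section Line.
Context {R : realType}.

(** Vanishing outside [[- N, N]], the function is integrable on the whole line, so its Lebesgue
    integral from minus infinity is an antiderivative by the fundamental theorem of calculus. *)
Lemma ex_antiderivative (N : R) (f : R -> R) :
  continuous f -> supp_in N f -> exists A : R -> R, forall x : R, is_derive x 1 A (f x).
Proof.
move=> cf sf; pose mu := @lebesgue_measure R.
have fN : mu.-integrable `[- N, N] (EFin \o f).
  apply: continuous_compact_integrable; first exact: segment_compact.
  by apply: continuous_subspaceT => x; exact: cf.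
have f_int : mu.-integrable setT (EFin \o f).
  rewrite (_ : EFin \o f = (EFin \o f) \_ `[- N, N]).
    exact: (integrable_mkcond _ _).1 fN.
  apply/funext => x; rewrite patchE; case: ifPn => //= xN.
  rewrite sf// ltNge; apply/negP => xN'; move/negP: xN; apply.
  by rewrite inE/= in_itv/= -ler_norml.
exists (fun x => \int[mu]_(t in [set` Interval -oo%O (BRight x)]) f t)%R => x.
have xx1 : x < x + 1 by rewrite ltrDl.
have fi : mu.-integrable [set` Interval -oo%O (BRight (x + 1))] (EFin \o f).
  exact: integrableS f_int.
have /= := continuous_FTC1 xx1 fi; rewrite ltNyr => /(_ isT (cf x))[dA A'].
by apply: DeriveDef; [exact: dA|rewrite -derive1E].
Qed.

(* The increment of an antiderivative across the support of [f]; the default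
   value 0 of [xget] is never taken on [Cc]. *)
Definition integral1 (f : R -> R) : R :=
  xget 0 [set v | exists A N, [/\ forall x : R, is_derive x 1 A (f x),
    0 <= N, forall x, N <= `|x| -> f x = 0 & v = A N - A (- N)]].

Lemma is_derive_const (A : R -> R) a b : a <= b ->
  (forall x : R, x \in `[a, b] -> is_derive x 1 A 0) -> A a = A b.
Proof.
move=> ab dA.
have dA' t : t \in `[0, 1] -> is_derive (a + t * (b - a)) 1 A (cst 0 (a + t * (b - a))).
  rewrite in_itv/= => /andP[t0 t1]; apply: dA; rewrite in_itv/=.
  have := subr_ge0 a b; rewrite ab => ba; apply/andP; split; nra.
have [t _] := MVT_is_derive dA'.
by rewrite mul0r => /eqP; rewrite subr_eq0 => /eqP.
Qed.

Lemma antiderivative_outside (A f : R -> R) N M : 0 <= N -> N <= M ->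
  (forall x : R, is_derive x 1 A (f x)) -> (forall x, N <= `|x| -> f x = 0) ->
  A M = A N /\ A (- M) = A (- N).
Proof.
move=> N0 NM dA sf.
have dA0 (x : R) : N <= `|x| -> is_derive x 1 A 0.
  by move=> Nx; rewrite -(sf x Nx); exact: dA.
split.
  have dAM (x : R) : x \in `[N, M] -> is_derive x 1 A 0.
    by rewrite in_itv/= => /andP[Nx _]; apply: dA0; rewrite (le_trans Nx)// ler_norm.
  by rewrite (is_derive_const NM dAM).
have dAM (x : R) : x \in `[- M, - N] -> is_derive x 1 A 0.
  rewrite in_itv/= => /andP[_ xN]; apply: dA0.
  by rewrite -normrN (le_trans _ (ler_norm _))// lerNr.
by have NM' : - M <= - N; [rewrite lerN2|rewrite (is_derive_const NM' dAM)].
Qed.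

(** Well-definedness of [integral1]: an antiderivative is constant on either side of the support, so
    two radii can be enlarged to a common one, on which two antiderivatives differ by a constant. *)
Lemma integral1E (A f : R -> R) N : (forall x : R, is_derive x 1 A (f x)) -> 0 <= N ->
  (forall x, N <= `|x| -> f x = 0) -> integral1 f = A N - A (- N).
Proof.
move=> dA N0 sf; rewrite /integral1; case: xgetP => [v -> [B [M [dB M0 sf' ->]]]|]; last first.
  by move=> /(_ (A N - A (- N)))[]; exists A, N.
pose K := Num.max M N.
have MK : M <= K by rewrite le_max lexx.
have NK : N <= K by rewrite le_max lexx orbT.
have [<- <-] := antiderivative_outside M0 MK dB sf'.
have [<- <-] := antiderivative_outside N0 NK dA sf.
have dAB (x : R) : x \in `[- K, K] -> is_derive x 1 (B - A) 0.
  by move=> _; have := is_deriveB (dB x) (dA x); rewrite subrr.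
have KK : - K <= K by rewrite ge0_cp// le_max M0.
have := is_derive_const KK dAB; rewrite !fctE => E.
by lra.
Qed.

(** Any large [M] is allowed, so that several functions can be evaluated at the same endpoints. The
    strict [|N| < M] reconciles [supp_in], where [f] vanishes for [N < |x|], with the weak
    inequality inside [integral1]. *)
Lemma integral1_antiderivative (N : R) (f : R -> R) : continuous f -> supp_in N f ->
  exists A : R -> R, (forall x : R, is_derive x 1 A (f x)) /\
   forall M, `|N| < M -> integral1 f = A M - A (- M).
Proof.
move=> cf sf; have [A dA] := ex_antiderivative cf sf; exists A; split=> // M NM.
apply: integral1E => //; first exact: le_trans (ltW NM).
by move=> x Mx; apply: sf; apply: le_lt_trans (ler_norm _) (lt_le_trans NM Mx).
Qed.

(** The factor is the length of the segment of radius [|N| + 1]. Positivity and the sup-norm bound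
    of [integral1] both follow from this formula. *)
Lemma integral1_MVT (N : R) (f : R -> R) : continuous f -> supp_in N f ->
  exists t, integral1 f = f t * (2 * (`|N| + 1)).
Proof.
move=> cf sf; have [A [dA EA]] := integral1_antiderivative cf sf.
have NM : `|N| < `|N| + 1 by rewrite ltrDl.
rewrite (EA _ NM).
have dA' t : t \in `[0, 1] ->
    is_derive (- (`|N| + 1) + t * (`|N| + 1 - - (`|N| + 1))) 1 A
      (f (- (`|N| + 1) + t * (`|N| + 1 - - (`|N| + 1)))).
  by move=> _; exact: dA.
have [t _ ->] := MVT_is_derive dA'.
by eexists; congr (f _ * _); ring.
Qed.

Lemma integral1_ge0 (f : R -> R) : Cc f -> (forall y, 0 <= f y) -> 0 <= integral1 f.
Proof.
move=> [cf [N sf]] f0; have [t ->] := integral1_MVT cf sf.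
by rewrite mulr_ge0.
Qed.

Lemma antiderivative_homo (A f : R -> R) a b :
  (forall x : R, is_derive x 1 A (f x)) -> (forall y, 0 <= f y) -> a <= b -> A a <= A b.
Proof.
move=> dA f0 ab; rewrite -subr_ge0.
have [t _ ->] := MVT_is_derive (fun t (_ : t \in `[0, 1]) => dA (a + t * (b - a))).
by rewrite mulr_ge0// subr_ge0.
Qed.

Lemma radon_integral1 : radon integral1.
Proof.
split.
- move=> a f g [cf [N sf]] [cg [N' sg]].
  have [A [dA EA]] := integral1_antiderivative cf sf; have [B [dB EB]] := integral1_antiderivative cg sg.
  pose M := Num.max `|N| `|N'| + 1.
  have NM : `|N| < M by rewrite /M ltr_pwDr// le_max lexx.
  have N'M : `|N'| < M by rewrite /M ltr_pwDr// le_max lexx orbT.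
  have M0 : 0 <= M by apply: le_trans (ltW NM).
  have dAB (x : R) : is_derive x 1 (a *: A + B) (a * f x + g x).
    have dA' := dA x; have dB' := dB x.
    by have := is_deriveD (is_deriveZ a dA') dB'.
  rewrite (integral1E dAB M0) => [|x Mx].
    by rewrite (EA _ NM) (EB _ N'M) !fctE /= /GRing.scale/=; ring.
  have Nx := le_lt_trans (ler_norm _) (lt_le_trans NM Mx).
  have N'x := le_lt_trans (ler_norm _) (lt_le_trans N'M Mx).
  by rewrite sf// sg// mulr0 addr0.
- exact: integral1_ge0.
- move=> f [cf [N sf]] f0 + y.
  have [A [dA EA]] := integral1_antiderivative cf sf.
  pose M := Num.max `|N| `|y| + 1.
  have NM : `|N| < M by rewrite /M ltr_pwDr// le_max lexx.
  have yM : `|y| < M by rewrite /M ltr_pwDr// le_max lexx orbT.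
  rewrite (EA _ NM) => A0.
  (* An antiderivative of a nonnegative function is monotone; with equal values at [- M] and [M] it
     is constant in between, and its derivative at [y] is therefore 0. *)
  have Ac : \forall x \near y, A x = cst (A M) x.
    near=> x; apply/eqP; rewrite /cst/= eq_le.
    have : `|x| < M.
      near: x; apply: (@cvgr_lt _ _ _ _ (fun x : R => `|x|) `|y|) => //.
      exact: cvg_norm.
    rewrite ltr_norml => /andP[Mx xM].
    rewrite (antiderivative_homo dA f0 (ltW xM)) /=.
    move/eqP: A0; rewrite subr_eq0 => /eqP ->.
    exact: (antiderivative_homo dA f0 (ltW Mx)).
  have [_ <-] := dA y.
  by rewrite (near_eq_derive _ Ac) ?derive_cst// oner_neq0.
- move=> N; exists (2 * (`|N| + 1)) => [|f e cf sf fe].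
    by rewrite mulr_ge0// addr_ge0.
  have [t ->] := integral1_MVT cf sf.
  by rewrite normrM mulrC ger0_norm ?ler_wpM2l// mulr_ge0// addr_ge0.
Unshelve. all: by end_near. Qed.

(** The antiderivative is transported as [a^-1 * A (a * x + b)]. A negative [a] exchanges the two
    endpoints, which accounts for the absolute value. *)
Lemma integral1_affine (a b : R) (f : R -> R) : a != 0 -> Cc f ->
  `|a| * integral1 (fun x => f (a * x + b)) = integral1 f.
Proof.
move=> a0 [cf [N sf]].
have [A [dA EA]] := integral1_antiderivative cf sf.
(* With this radius the images of both endpoints have absolute value at least [|N| + 1], hence lie
   outside the support of [f]. *)
pose M := (`|N| + `|b| + 1) / `|a|.
have M0 : 0 <= M by rewrite divr_ge0// !addr_ge0.
have aM : `|a| * M = `|N| + `|b| + 1 by rewrite mulrC divfK// normr_eq0.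
have dB (x : R) : is_derive x 1 (fun x => a^-1 * A (a * x + b)) (f (a * x + b)).
  have d0 : is_derive x 1 (fun x : R => a * x + b) a.
    have := is_deriveD (is_deriveZ a (is_derive_id x 1)) (is_derive_cst b x 1).
    by rewrite addr0 [_ *: _]mulr1.
  have := is_deriveZ a^-1 (@is_derive1_comp _ A (fun x : R => a * x + b) x _ _ (dA (a * x + b)) d0).
  by rewrite [_ *: _]mulrC mulfK.
rewrite (integral1E dB M0) => [|x Mx]; last first.
  apply: sf; apply: le_lt_trans (ler_norm _) _.
  have : `|a| * M <= `|a * x| by rewrite normrM ler_wpM2l.
  have := ler_normB (a * x + b) b; rewrite addrK aM; lra.
pose c := `|N| + 1.
have c0 : 0 <= c by rewrite addr_ge0.
have sf' x : c <= `|x| -> f x = 0.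
  by move=> cx; apply: sf; rewrite (le_lt_trans (ler_norm _))// (lt_le_trans _ cx)// ltrDl.
have Nc : `|N| < c by rewrite ltrDl.
have cMb : c <= `|a| * M - b by rewrite aM /c; have := ler_norm b; lra.
have cMb' : c <= `|a| * M + b by rewrite aM /c; have := ler_norm (- b); rewrite normrN; lra.
have [A1 A2] := antiderivative_outside c0 cMb dA sf'.
have [A3 A4] := antiderivative_outside c0 cMb' dA sf'.
rewrite (EA _ Nc); case: (ltrgt0P a) a0 cMb A1 A2 A3 A4 => // [a0 _|a0 _] cMb A1 A2 A3 A4.
  rewrite -mulrBr mulrA divff ?gt_eqF// mul1r A3.
  by rewrite (_ : a * - M + b = - (a * M - b)) ?A2//; ring.
rewrite -mulrBr mulrA mulNr divff ?lt_eqF// mulN1r opprB.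
rewrite (_ : a * - M + b = - a * M + b) ?A3; last by ring.
by rewrite (_ : a * M + b = - (- a * M - b)) ?A2//; ring.
Qed.

End Line.

(** * Products and Fubini *)

Section Products.
Context {R : realType}.
Implicit Types (X Y Z : normedModType R).

(** The growth condition says that preimages of bounded sets are bounded; the added 1 leaves room
    for maps that do not fix the origin. *)
Lemma Cc_comp X Y (phi : X -> Y) (K : R) (f : Y -> R) : continuous phi ->
  (forall x, `|x| <= K * (`|phi x| + 1)) -> Cc f -> Cc (f \o phi).
Proof.
move=> cphi phiK [cf [N sf]]; split.
  by move=> x; apply: continuous_comp; [exact: cphi|exact: cf].
exists (`|K| * (`|N| + 1)) => x Nx /=; apply: sf; rewrite ltNge; apply/negP => xN.
move: Nx; apply/negP; rewrite -leNgt (le_trans (phiK x))//.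
rewrite (@le_trans _ _ (`|K| * (`|phi x| + 1)))//.
  by rewrite ler_wpM2r ?ler_norm// addr_ge0.
by rewrite ler_wpM2l// lerD2r (le_trans xN)// ler_norm.
Qed.

Lemma Cc_comp1 X Y (phi : X -> Y) (f : Y -> R) : continuous phi ->
  (forall x, `|x| <= `|phi x|) -> Cc f -> Cc (f \o phi).
Proof.
move=> cphi phiK; apply: (@Cc_comp _ _ phi 1) => // x.
by rewrite mul1r (le_trans (phiK x))// lerDl.
Qed.

Lemma le_norm_pair1 X Y (x : X) (y : Y) : `|x| <= `|(x, y)|.
Proof. by rewrite prod_normE le_max lexx. Qed.

Lemma le_norm_pair2 X Y (x : X) (y : Y) : `|y| <= `|(x, y)|.
Proof. by rewrite prod_normE le_max lexx orbT. Qed.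

Lemma continuous_pair (T U V : topologicalType) (f : T -> U) (g : T -> V) :
  continuous f -> continuous g -> continuous (fun t => (f t, g t)).
Proof. by move=> cf cg t; apply: cvg_pair; [exact: cf|exact: cg]. Qed.

Lemma continuous_fst (T U V : topologicalType) (f : T -> U * V) :
  continuous f -> continuous (fun t => (f t).1).
Proof. by move=> cf t; apply: (cvg_comp _ _ (cf t)); exact: cvg_fst. Qed.

Lemma continuous_snd (T U V : topologicalType) (f : T -> U * V) :
  continuous f -> continuous (fun t => (f t).2).
Proof. by move=> cf t; apply: (cvg_comp _ _ (cf t)); exact: cvg_snd. Qed.

Lemma continuous_idfun (T : topologicalType) : continuous (fun t : T => t).
Proof. by move=> t. Qed.

Lemma proper_prod X Y : proper X -> proper Y -> proper (X * Y)%type.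
Proof.
move=> pX pY N; have := compact_setX (pX N) (pY N); congr compact.
by apply/seteqP; split => -[x y] /=; rewrite prod_normE ge_max /= => /andP.
Qed.

Definition radon_prod X Y (I : (X -> R) -> R) (I' : (Y -> R) -> R) :=
  fun F : X * Y -> R => I (fun x => I' (fun y => F (x, y))).

Lemma Cc_slice X Y (F : X * Y -> R) x : Cc F -> Cc (fun y => F (x, y)).
Proof.
apply: (@Cc_comp1 _ _ (fun y => (x, y))) => [|y]; last exact: le_norm_pair2.
by apply: continuous_pair => y; [exact: cvg_cst|exact: cvg_id].
Qed.

(** The slices of [F] all vanish outside one ball, so continuity in the parameter is an instance of
    [radon_cvg]. *)
Lemma Cc_partial X Y (I : (Y -> R) -> R) (F : X * Y -> R) :
  proper Y -> radon I -> Cc F -> Cc (fun x => I (fun y => F (x, y))).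
Proof.
move=> pY rI cF; have [cF' [N sF]] := cF; split; last first.
  exists N => x Nx; rewrite -[RHS](radon0 rI); congr I; apply/funext => y.
  by rewrite sF// (lt_le_trans Nx)// le_norm_pair1.
have sl x : continuous (fun y => F (x, y)) /\ supp_in N (fun y => F (x, y)).
  split; first by have [] := Cc_slice x cF.
  by move=> y Ny; rewrite sF// (lt_le_trans Ny)// le_norm_pair2.
move=> x0; apply: (@radon_cvg _ _ _ rI _ _ _ _ _ N) => //.
- by near=> x; exact: sl.
- by have [] := sl x0.
- by have [] := sl x0.
move=> z e e0.
have e2 : 0 < e / 2 by rewrite divr_gt0.
have c0 := cF' (x0, z); have [c1 _] := sl x0; have {}c1 := c1 z.
have /cvgrPdist_le/(_ _ e2) [[A B]/= [Ax Bz] AB] := c0.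
have /cvgrPdist_le/(_ _ e2) c1' := c1.
near=> z' x.
have h1 : `|F (x0, z) - F (x, z')| <= e / 2.
  by apply: AB; split => /=; [near: x|near: z'].
have h2 : `|F (x0, z) - F (x0, z')| <= e / 2 by near: z'.
rewrite (_ : _ - _ = (F (x0, z) - F (x0, z')) - (F (x0, z) - F (x, z'))); last by ring.
by rewrite (le_trans (ler_normB _ _))// [e]splitr lerD.
Unshelve. all: by end_near. Qed.

Lemma radon_radon_prod X Y (I : (X -> R) -> R) (I' : (Y -> R) -> R) :
  proper Y -> radon I -> radon I' -> radon (radon_prod I I').
Proof.
move=> pY rI rI'; have [l p s b] := rI; have [l' p' s' b'] := rI'; split.
- move=> a F G cF cG; have := Cc_partial pY rI' cG; have := Cc_partial pY rI' cF => hF hG.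
  rewrite /radon_prod -(l _ _ _ hF hG).
  by congr I; apply/funext => x; apply: l'; exact: Cc_slice.
- move=> F cF F0; apply: p => [|x]; first exact: (Cc_partial pY rI' cF).
  by apply: p' => [|y//]; exact: Cc_slice.
- move=> F cF F0 IF [x y].
  apply: (s' (fun y => F (x, y))) => //; first exact: Cc_slice.
  apply: (s _ _ _ IF) => [|{}x]; first exact: (Cc_partial pY rI' cF).
  by apply: p' => [|{}y//]; exact: Cc_slice.
- move=> N; have [C C0 bN] := b N; have [C' C'0 b'N] := b' N.
  exists (C * C') => [|F e cF sF Fe]; first exact: mulr_ge0.
  have CF : Cc F by split => //; exists N.
  rewrite -mulrA; apply: bN => [|x Nx|x].
  + by have [] := Cc_partial pY rI' CF.
  + rewrite -[RHS](radon0 rI'); congr I'; apply/funext => y.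
    by rewrite sF// (lt_le_trans Nx)// le_norm_pair1.
  + apply: b'N => // [|y Ny]; first by have [] := Cc_slice x CF.
    by rewrite sF// (lt_le_trans Ny)// le_norm_pair2.
Qed.

Definition commute X Y (I : (X -> R) -> R) (I' : (Y -> R) -> R) :=
  forall F : X -> Y -> R, Cc (fun p : X * Y => F p.1 p.2) ->
    I (fun x => I' (fun y => F x y)) = I' (fun y => I (fun x => F x y)).

Lemma commute_sym X Y (I : (X -> R) -> R) (I' : (Y -> R) -> R) :
  commute I I' -> commute I' I.
Proof.
move=> II' F cF; rewrite -(II' (fun x y => F y x))//.
apply: (@Cc_comp1 _ _ (fun p : X * Y => (p.2, p.1)) _ _ _ cF) => [|[x y]].
  by apply: continuous_pair; [apply: continuous_snd|apply: continuous_fst]; exact: continuous_idfun.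
by rewrite /= !prod_normE maxC.
Qed.

(** [I2] is moved past [I'] under [I], then past [I]. This lifts Fubini from the line to products,
    one factor at a time. *)
Lemma commute_prod X Y Z (I : (X -> R) -> R) (I' : (Y -> R) -> R) (I2 : (Z -> R) -> R) :
  proper Y -> radon I' ->
  commute I I2 -> commute I' I2 -> commute (radon_prod I I') I2.
Proof.
move=> pY rI' c c' F cF; rewrite /radon_prod /=.
transitivity (I (fun x => I2 (fun z => I' (fun y => F (x, y) z)))).
  congr I; apply/funext => x; apply: (c' (fun y z => F (x, y) z)).
  apply: (@Cc_comp1 _ _ (fun p : Y * Z => ((x, p.1), p.2)) _ _ _ cF) => [|[y z]].
    apply: continuous_pair; last exact: continuous_snd (@continuous_idfun _).
    by apply: continuous_pair; [exact: cst_continuous|exact: continuous_fst (@continuous_idfun _)].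
  by rewrite /= !prod_normE/= le_max2// le_max lexx orbT.
apply: (c (fun x z => I' (fun y => F (x, y) z))).
apply: (@Cc_partial _ _ _ (fun q : (X * Z) * Y => F (q.1.1, q.2) q.1.2)) => //.
apply: (@Cc_comp1 _ _ (fun q : (X * Z) * Y => ((q.1.1, q.2), q.1.2)) _ _ _ cF) => [|[[x z] y]].
  have cid := @continuous_idfun ((X * Z) * Y)%type.
  apply: continuous_pair; last exact: continuous_snd (continuous_fst cid).
  by apply: continuous_pair; [exact: continuous_fst (continuous_fst cid)|exact: continuous_snd cid].
by rewrite /= !prod_normE/= -!maxA (maxC `|z|).
Qed.

End Products.

(** * Fubini's theorem for two integrals on the line *)

Section Fubini.
Context {R : realType}.

Lemma properR : proper R.
Proof.
move=> N; rewrite (_ : [set y : R | _] = `[- N, N]%classic); first exact: segment_compact.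
by apply/seteqP; split => y /=; rewrite in_itv/= ler_norml.
Qed.

Lemma is_derive_cvg (V W : normedModType R) (f : V -> W) (a v : V) (l : W) :
  h^-1 *: (f (h *: v + a) - f a) @[h --> 0^'] --> l -> is_derive a v f l.
Proof.
move=> fl; apply: DeriveDef; first by apply/cvg_ex; exists l.
exact: cvg_lim.
Qed.

(** Let [G t] be the integral over [y] of the integral of [F x y] over [x] from [- M] to [t].
    Differentiation under the integral sign shows that [G] is an antiderivative of the other partial
    integral; comparing its values at [M] and [- M] gives the exchange. *)
Lemma commute_integral1 : commute (@integral1 R) (@integral1 R).
Proof.
move=> F cF; have [cF' [N0 sF0]] := cF.
have rJ := @radon_integral1 R.
pose N := `|N0|; pose M := N + 1.
have sF : supp_in N (fun p : R * R => F p.1 p.2) by apply: supp_inW sF0; exact: ler_norm.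
have M0 : 0 <= M by rewrite addr_ge0// normr_ge0.
have F0l x y : N < `|x| -> F x y = 0.
  by move=> Nx; apply: (sF (x, y)); rewrite (lt_le_trans Nx)// le_norm_pair1.
have F0r x y : N < `|y| -> F x y = 0.
  by move=> Ny; apply: (sF (x, y)); rewrite (lt_le_trans Ny)// le_norm_pair2.
have cFs y : Cc (fun x => F x y).
  have := @Cc_comp1 _ _ _ (fun x : R => (x, y)) _ _ _ cF; apply; last by move=> x; exact: le_norm_pair1.
  by apply: continuous_pair; [exact: continuous_idfun|exact: cst_continuous].
have exA y : exists A : R -> R, (forall x : R, is_derive x 1 A (F x y)) /\
    integral1 (fun x => F x y) = A M - A (- M).
  have [cFy _] := cFs y; have [A [dA EA]] := integral1_antiderivative cFy (fun x => F0l x y).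
  by exists A; split => //; apply: EA; rewrite /M /N normr_id ltrDl.
have [A HA] := boolp.choice exA.
have dA y := (HA y).1; have EA y := (HA y).2.
(* The antiderivatives [A y] come from the axiom of choice, so their constants are unrelated for
   different [y]. Normalizing at [- M] restores continuity and compact support in [y]. *)
pose Th t y := A y t - A y (- M).
have dTh y (x : R) : is_derive x 1 (Th ^~ y) (F x y).
  have := is_deriveB (dA y x) (is_derive_cst (A y (- M)) x 1).
  by rewrite subr0.
have ThN y : Th (- M) y = 0 by rewrite /Th subrr.
have ThM y : Th M y = integral1 (fun x => F x y) by rewrite EA.
have sTh t : supp_in N (Th t).
  move=> y Ny; have [s _] := MVT_global (- M) (t) (dTh y).
  by rewrite F0r// mul0r ThN subr0.
have cTh t : continuous (Th t).
  move=> y0; apply/cvgrPdist_le => e e0.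
  have d0 : 0 < e / (`|t + M| + 1) by rewrite divr_gt0// ltr_wpDl.
  have d2 : 0 < e / (`|t + M| + 1) / 2 by rewrite divr_gt0.
  (* By compactness [F x y] is close to [F x y0] uniformly in [x]; the mean value theorem on the
     segment from [- M] to [t] multiplies this error by at most [|t + M|]. *)
  have /compact_near_coveringP := @properR N.
  move=> /(_ _ _ (fun y x => `|F x y0 - F x y| <= e / (`|t + M| + 1)) (nbhs_filter y0)) cov.
  have {}cov : \forall y \near y0, forall x, `|F x y0 - F x y| <= e / (`|t + M| + 1).
    near=> y => x; have [xN|Nx] := leP `|x| N; last first.
      by rewrite !F0l// subrr normr0 ltW.
    move: x xN; near: y; apply: cov => x _.
    have /cvgrPdist_le/(_ _ d2) [[U V]/= [Ux Vy] UV] := cF' (x, y0).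
    near=> x' y.
    have h1 : `|F x y0 - F x' y| <= e / (`|t + M| + 1) / 2.
      by apply: (UV (x', y)); split => /=; [near: x'|near: y].
    have h2 : `|F x y0 - F x' y0| <= e / (`|t + M| + 1) / 2.
      apply: (UV (x', y0)); split => /=; first by near: x'.
      exact: nbhs_singleton.
    rewrite (_ : _ - _ = (F x y0 - F x' y) - (F x y0 - F x' y0)); last by ring.
    by rewrite (le_trans (ler_normB _ _))// [leRHS]splitr lerD.
  near=> y.
  have dD (x : R) : is_derive x 1 (fun t => Th t y0 - Th t y) (F x y0 - F x y).
    exact: is_deriveB (dTh y0 x) (dTh y x).
  have [s _] := MVT_global (- M) (t) (dD).
  rewrite !ThN subrr subr0 => ->; rewrite normrM opprK.
  have : forall x, `|F x y0 - F x y| <= e / (`|t + M| + 1) by near: y.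
  move=> /(_ (- M + s * (t + M))) /(ler_wpM2r (normr_ge0 (t + M))) /le_trans; apply.
  by rewrite mulrAC ler_pdivrMr ?ltr_wpDl// ler_wpM2l ?(ltW e0)// lerDl.
have CTh t : Cc (Th t) by split => //; exists N.
pose G t := integral1 (Th t).
have dG (t : R) : is_derive t 1 G (integral1 (F t)).
  apply: is_derive_cvg.
  have cFt : Cc (F t) by exact: (@Cc_slice _ _ _ (fun p => F p.1 p.2) t cF).
  (* By the mean value theorem the quotient is [F (t + s * h) y] for some [s] in the unit interval,
     so it is close to [F t] near every point. *)
  have q_cvg : integral1 (fun y => h^-1 * (Th (h + t) y - Th t y)) @[h --> 0^'] --> integral1 (F t).
    apply: (@radon_cvg _ _ _ rJ _ _ _ _ _ N (@properR)).
    - near=> h; split.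
        by have [] := CcZ h^-1 (CcB (CTh (h + t)) (CTh t)).
      by move=> y Ny; rewrite !sTh// subrr mulr0.
    - by have [] := cFt.
    - by move=> y Ny; rewrite F0r.
    move=> z e e0.
    have e2 : 0 < e / 2 by rewrite divr_gt0.
    have /cvgrPdist_le/(_ _ e2) [[U V]/= [Ut Vz] UV] := cF' (t, z).
    have /nbhs_ballP[d /= d0 dU] := Ut.
    near=> z' h.
    have h0 : h != 0 by near: h; exact: nbhs_dnbhs_neq.
    have [s] := MVT_global (t) (h + t) (dTh z').
    rewrite in_itv/= addrK => /andP[s0 s1] ->; rewrite mulrC mulfK//.
    have h1 : `|F t z - F (t + s * h) z'| <= e / 2.
      apply: (UV (_, _)); split => /=; last by near: z'.
      apply: dU; rewrite /ball/= opprD addrA subrr sub0r normrN normrM (ger0_norm s0).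
      have hd : `|h| < d by near: h; apply: dnbhs0_lt.
      by apply: le_lt_trans hd; rewrite ler_piMl.
    have h2 : `|F t z - F t z'| <= e / 2.
      apply: (UV (t, z')); split => /=; last by near: z'.
      exact: nbhs_singleton.
    rewrite (_ : _ - _ = (F t z - F t z') - (F t z - F (t + s * h) z')); last by ring.
    by rewrite (le_trans (ler_normB _ _))// [leRHS]splitr lerD.
  apply: cvg_trans q_cvg; apply: near_eq_cvg; near=> h.
  rewrite /G [h *: 1]mulr1 -(radonB rJ (CTh _) (CTh _)).
  by rewrite [_ *: _](_ : _ = h^-1 * integral1 (fun y => Th (h + t) y - Th t y))// -(radonZ rJ)//; exact: CcB.
rewrite (integral1E dG M0).
  rewrite /G (_ : Th (- M) = fun=> 0); last by apply/funext => y.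
  by rewrite (radon0 rJ) subr0; congr integral1; apply/funext => y.
move=> x Mx; rewrite -[RHS](radon0 rJ); congr integral1; apply/funext => y.
by rewrite F0l// (lt_le_trans _ Mx)// ltrDl.
Unshelve. all: by end_near. Qed.

End Fubini.

(** * Integration on R^4 *)

Section Space.
Context {R : realType}.

Lemma coord_le_norm n (x : 'rV[R]_n) j : `|x 0 j| <= `|x|.
Proof.
rewrite [leRHS]/Num.norm /= mx_normrE; apply/bigmax_geP; right => /=.
by exists (0, j).
Qed.

Lemma row_norm_le n (x : 'rV[R]_n) e : 0 <= e -> (forall j, `|x 0 j| <= e) -> `|x| <= e.
Proof.
move=> e0 xe; rewrite [leLHS]/Num.norm /= mx_normrE; apply/bigmax_leP; split => // -[i j] _ /=.
by rewrite ord1.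
Qed.

Lemma cvg_row (T : Type) (F : set_system T) (FF : Filter F) n (f : T -> 'rV[R]_n) (l : 'rV[R]_n) :
  (forall j, f t 0 j @[t --> F] --> l 0 j) -> f t @[t --> F] --> l.
Proof.
move=> fl; apply/cvgrPdist_le => e e0.
have : \forall t \near F, forall j, `|l 0 j - f t 0 j| <= e.
  by apply: filter_forall => j; move/cvgrPdist_le: (fl j); exact.
apply: filterS => t lf; apply: row_norm_le (ltW e0) _ => j.
by rewrite !mxE.
Qed.

Lemma continuous_row (T : topologicalType) n (f : T -> 'rV[R]_n) :
  (forall j, continuous (fun t => f t 0 j)) -> continuous f.
Proof. by move=> cf t; apply: cvg_row => j; exact: cf. Qed.

Lemma proper_rV n : @proper R 'rV[R]_n.
Proof.
move=> N; apply: bounded_closed_compact.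
  exists N; split; first exact: num_real.
  by move=> M NM x /= xN; rewrite (le_trans xN)// ltW.
by apply: preimage_closed (@closed_le R N) => x _; exact: norm_continuous.
Qed.

Definition vec (p : R * R * R * R) : 'rV[R]_4 :=
  \row_i nth 0 [:: p.1.1.1; p.1.1.2; p.1.2; p.2] i.

Lemma continuous_vec : continuous vec.
Proof.
have cid := @continuous_idfun (R * R * R * R)%type.
apply: continuous_row => j.
have -> : (fun p => vec p 0 j) = (fun p => nth 0 [:: p.1.1.1; p.1.1.2; p.1.2; p.2] j).
  by apply/funext => p; rewrite mxE.
case: j => -[|[|[|[|//]]]] _ /=.
- exact: continuous_fst (continuous_fst (continuous_fst cid)).
- exact: continuous_snd (continuous_fst (continuous_fst cid)).
- exact: continuous_snd (continuous_fst cid).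
- exact: continuous_snd cid.
Qed.

Lemma vec_norm p : `|p| <= `|vec p|.
Proof.
rewrite !prod_normE !ge_max -!andbA.
have vE (j : 'I_4) : `|nth 0 [:: p.1.1.1; p.1.1.2; p.1.2; p.2] j| <= `|vec p|.
  by have := coord_le_norm (vec p) j; rewrite mxE.
have := vE 0; have := vE 1; have := vE 2%:R; have := vE 3%:R => /=.
by move=> -> -> -> ->.
Qed.

Definition I4 (f : 'rV[R]_4 -> R) : R :=
  radon_prod (radon_prod (radon_prod (@integral1 R) (@integral1 R)) (@integral1 R)) (@integral1 R) (f \o vec).

Lemma Cc_vec f : Cc f -> Cc (f \o vec).
Proof. by apply: Cc_comp1; [exact: continuous_vec|exact: vec_norm]. Qed.

Lemma radon_I2 : radon (radon_prod (@integral1 R) (@integral1 R)).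
Proof. by apply: radon_radon_prod; [exact: properR|exact: radon_integral1..]. Qed.

Lemma radon_I3 : radon (radon_prod (radon_prod (@integral1 R) (@integral1 R)) (@integral1 R)).
Proof. by apply: radon_radon_prod; [exact: properR|exact: radon_I2|exact: radon_integral1]. Qed.

Lemma vec_surj x : exists p, vec p = x.
Proof.
exists (x 0 0, x 0 1, x 0 2%:R, x 0 3%:R); apply/rowP => j; rewrite mxE.
by case: j => -[|[|[|[|//]]]] H /=; congr (x _ _); apply/val_inj.
Qed.

Lemma radon_I4 : radon I4.
Proof.
have : radon (radon_prod (radon_prod (radon_prod (@integral1 R) (@integral1 R)) (@integral1 R)) (@integral1 R)).
  by apply: radon_radon_prod; [exact: properR|exact: radon_I3|exact: radon_integral1].
move=> [l p s b]; split.
- by move=> a f g cf cg; rewrite /I4 -l//; exact: Cc_vec.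
- by move=> f cf f0; apply: p => [|x]; [exact: Cc_vec|exact: f0].
- move=> f cf f0 If x; have [q <-] := vec_surj x.
  by apply: (s _ _ _ If) => [|y]; [exact: Cc_vec|exact: f0].
- move=> N; have [C C0 bC] := b N; exists C => // f e cf sf fe.
  have [cv _] := Cc_vec (conj cf (ex_intro _ N sf)).
  apply: bC => // [q Nq|q]; last exact: fe.
  by apply: sf; exact: lt_le_trans Nq (vec_norm _).
Qed.

Lemma commute_I4 : commute I4 I4.
Proof.
pose K := radon_prod (radon_prod (radon_prod (@integral1 R) (@integral1 R)) (@integral1 R)) (@integral1 R).
(* It replaces the line by [K] on the left; used on both sides of a symmetry, it raises
   [commute_integral1] to the pair [K], [K]. *)
have step (X : normedModType R) (I : (X -> R) -> R) :
    commute (@integral1 R) I -> commute K I.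
  move=> JI; have p := @properR R; have r := @radon_integral1 R.
  by do 3!(apply: commute_prod => //).
have KK : commute K K.
  by apply: (step); apply: commute_sym; apply: (step); exact: commute_integral1.
move=> F cF; apply: (KK (fun p q => F (vec p) (vec q))).
apply: (@Cc_comp1 _ _ _ (fun p : (R * R * R * R) * (R * R * R * R) => (vec p.1, vec p.2)) _ _ _ cF).
  have cid := @continuous_idfun ((R * R * R * R) * (R * R * R * R))%type.
  by apply: continuous_pair => p; apply: continuous_comp;
    [exact: (continuous_fst cid)|exact: continuous_vec
    |exact: (continuous_snd cid)|exact: continuous_vec].
by move=> p; rewrite !(prod_normE p) prod_normE /= le_max2//; exact: vec_norm.
Qed.

End Space.

(** * Triangular affine changes of variables *)

Section LinearChange.
Context {R : realType}.
Implicit Types X : normedModType R.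
Local Notation integral1 := (@integral1 R).
Local Notation I4 := (@I4 R).

Definition affine_like X (phi : X -> R) :=
  continuous phi /\ exists K : R, forall x, `|phi x| <= K * (`|x| + 1).

(* The growth condition makes [f \o sigma] compactly supported when [f] is. *)
Definition shear X (I : (X -> R) -> R) (sigma : X -> X) (k : R) :=
  [/\ continuous sigma, exists K : R, forall x, `|x| <= K * (`|sigma x| + 1) &
   forall f, Cc f -> k * I (f \o sigma) = I f].

Lemma shear_integral1 (u b : R) : u != 0 -> shear integral1 (fun x => u * x + b) `|u|.
Proof.
move=> u0; split; last by move=> f cf; exact: integral1_affine.
  move=> x; apply: cvgD; last exact: cvg_cst.
  by apply: cvgM; [exact: cvg_cst|exact: cvg_id].
exists (`|u|^-1 * (1 + `|b|)) => x.
rewrite -mulrA ler_pdivlMl ?normr_gt0// -normrM.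
have := ler_normB (u * x + b) b; rewrite addrK => /le_trans; apply.
have := normr_ge0 b; have := normr_ge0 (u * x + b); nra.
Qed.

(** On the fibre over a point [x] the map is affine with slope [u], and the factor [|u|] is the same
    for all fibres. What remains is the change of variables [sigma] on the base. *)
Lemma shear_prod X (I : (X -> R) -> R) sigma k (s : X -> R) u :
  proper X -> radon I -> u != 0 -> shear I sigma k -> affine_like s ->
  shear (radon_prod I integral1) (fun p => (sigma p.1, u * p.2 + s p.1)) (k * `|u|).
Proof.
move=> pX rI u0 [cs [K sK] Is] [cs' [L sL]].
have cphi : continuous (fun p : X * R => (sigma p.1, u * p.2 + s p.1)).
  apply: continuous_pair => p.
    by apply: (continuous_comp (@cvg_fst _ _ _ _ _) (cs _)).
  apply: cvgD; last by apply: (continuous_comp (@cvg_fst _ _ _ _ _) (cs' _)).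
  by apply: cvgM; [exact: cvg_cst|exact: cvg_snd].
have phiK : exists K' : R, forall p : X * R,
    `|p| <= K' * (`|(sigma p.1, u * p.2 + s p.1)| + 1).
  exists (`|K| + `|u|^-1 * (1 + `|L| * (`|K| + 1))) => -[x t] /=.
  set y := `|(sigma x, _)|.
  have y0 : 0 <= y by exact: normr_ge0.
  have h1 : `|x| <= `|K| * (y + 1).
    apply: le_trans (sK x) _; apply: le_trans (ler_wpM2r _ (ler_norm _)) _.
      by rewrite addr_ge0.
    by rewrite ler_wpM2l// lerD2r; exact: le_norm_pair1.
  have h2 : `|s x| <= `|L| * (`|K| + 1) * (y + 1).
    apply: le_trans (sL x) _; apply: le_trans (ler_wpM2r _ (ler_norm _)) _.
      by rewrite addr_ge0.
    rewrite -mulrA ler_wpM2l//; have := normr_ge0 K; nra.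
  have h3 : `|t| <= `|u|^-1 * (1 + `|L| * (`|K| + 1)) * (y + 1).
    rewrite -mulrA ler_pdivlMl ?normr_gt0// -normrM.
    have := ler_normB (u * t + s x) (s x); rewrite addrK => /le_trans; apply.
    have : `|u * t + s x| <= y by exact: le_norm_pair2.
    lra.
  rewrite prod_normE ge_max /= mulrDl; apply/andP; split.
    by rewrite (le_trans h1)// lerDl !mulr_ge0// ?invr_ge0// ?addr_ge0// ?mulr_ge0// ?addr_ge0.
  by rewrite (le_trans h3)// lerDr mulr_ge0// addr_ge0.
split => //.
move=> F cF; have [K' phiK'] := phiK.
have cFphi := Cc_comp cphi phiK' cF.
have pR := @properR R; have rJ := @radon_integral1 R.
pose H x := integral1 (fun t => F (x, t)).
have cH : Cc H by exact: Cc_partial.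
have E x : `|u| * integral1 (fun t => F (sigma x, u * t + s x)) = H (sigma x).
  by apply: (integral1_affine (s x) u0); exact: Cc_slice.
rewrite /radon_prod -(Is H cH) -mulrA; congr (_ * _).
rewrite -(radonZ rI); last exact: (Cc_partial pR rJ cFphi).
by congr I; apply/funext => x; rewrite E.
Qed.

Lemma affine_like_lin (c : R) X (f g : X -> R) :
  affine_like f -> affine_like g -> affine_like (fun x => f x * c + g x).
Proof.
move=> [cf [K fK]] [cg [L gL]]; split.
  move=> x; apply: cvgD; last exact: cg.
  by apply: cvgM; [exact: cf|exact: cvg_cst].
exists (K * `|c| + L) => x.
rewrite (le_trans (ler_normD _ _))// mulrDl lerD// normrM mulrAC.
by rewrite ler_wpM2r.
Qed.

Lemma affine_like_cst (c : R) X : affine_like (fun _ : X => c).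
Proof.
split; first exact: cst_continuous.
by exists `|c| => x; rewrite ler_peMr// lerDr.
Qed.

Lemma affine_like_coord X (f : X -> R) :
  continuous f -> (forall x, `|f x| <= `|x|) -> affine_like f.
Proof. by move=> cf fx; split => //; exists 1 => x; rewrite mul1r (le_trans (fx x))// lerDl. Qed.

Lemma ord4P (j : 'I_4) : [\/ j = 0, j = 1, j = 2%:R | j = 3%:R].
Proof.
case: j => -[|[|[|[|//]]]] Hj; [constructor 1|constructor 2|constructor 3|constructor 4];
  exact/val_inj.
Qed.

Lemma big4 (T : nmodType) (F : 'I_4 -> T) :
  \sum_i F i = F 0 + F 1 + F 2%:R + F 3%:R.
Proof.
rewrite !big_ord_recl big_ord0 addr0 !addrA.
by congr (_ + _ + _ + _); congr F; apply/val_inj.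
Qed.

Lemma prod4 (F : 'I_4 -> R) : \prod_i F i = F 0 * F 1 * F 2%:R * F 3%:R.
Proof.
rewrite !big_ord_recl big_ord0 mulr1 !mulrA.
by congr (_ * _ * _ * _); congr F; apply/val_inj.
Qed.

Lemma vecE (p : R * R * R * R) : [/\ vec p 0 0 = p.1.1.1, vec p 0 1 = p.1.1.2,
  vec p 0 2%:R = p.1.2 & vec p 0 3%:R = p.2].
Proof. by split; rewrite mxE. Qed.

(** Vectors are rows, so for an upper triangular [U] the coordinate [j] of [x *m U + c] involves
    only the coordinates up to [j]: the map is an iterated shear over the first coordinate. *)
Lemma I4_upper (U : 'M[R]_4) (c : 'rV[R]_4) :
  (forall i j : 'I_4, (j < i)%N -> U i j = 0) -> (forall i, U i i != 0) ->
  forall f, Cc f -> (\prod_i `|U i i|) * I4 (fun x => f (x *m U + c)) = I4 f.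
Proof.
move=> Ulow Udiag; have pR := @properR R.
have p2 := proper_prod pR pR; have p3 := proper_prod p2 pR.
have rJ := @radon_integral1 R.
have s1 := shear_integral1 (c 0 0) (Udiag 0).
have n1 (X Y : normedModType R) (p : X * Y) : `|p.1| <= `|p| by case: p => x y; exact: le_norm_pair1.
have n2 (X Y : normedModType R) (p : X * Y) : `|p.2| <= `|p| by case: p => x y; exact: le_norm_pair2.
have a1 : affine_like (fun a : R => a * U 0 1 + c 0 1).
  apply: affine_like_lin; last exact: affine_like_cst.
  by apply: affine_like_coord => //; exact: continuous_idfun.
have s2 := shear_prod pR rJ (Udiag 1) s1 a1.
have cid2 := @continuous_idfun (R * R)%type.
have a2 : affine_like (fun p : R * R => p.1 * U 0 2%:R + (p.2 * U 1 2%:R + c 0 2%:R)).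
  apply: affine_like_lin; last (apply: affine_like_lin; last exact: affine_like_cst).
    by apply: affine_like_coord; [exact: continuous_fst cid2|exact: n1].
  by apply: affine_like_coord; [exact: continuous_snd cid2|exact: n2].
have s3 := shear_prod p2 radon_I2 (Udiag 2%:R) s2 a2.
have cid3 := @continuous_idfun (R * R * R)%type.
have a3 : affine_like (fun p : R * R * R => p.1.1 * U 0 3%:R +
    (p.1.2 * U 1 3%:R + (p.2 * U 2%:R 3%:R + c 0 3%:R))).
  apply: affine_like_lin; last (apply: affine_like_lin; last (apply: affine_like_lin; last exact: affine_like_cst)).
  - apply: affine_like_coord; first exact: continuous_fst (continuous_fst cid3).
    by move=> p; exact: le_trans (n1 _ _ _) (n1 _ _ _).
  - apply: affine_like_coord; first exact: continuous_snd (continuous_fst cid3).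
    by move=> p; exact: le_trans (n2 _ _ _) (n1 _ _ _).
  - by apply: affine_like_coord; [exact: continuous_snd cid3|exact: n2].
have [_ _ s4] := shear_prod p3 radon_I3 (Udiag 3%:R) s3 a3.
pose sg := fun p : R * R * R * R => (((U 0 0 * p.1.1.1 + c 0 0,
  U 1 1 * p.1.1.2 + (p.1.1.1 * U 0 1 + c 0 1)),
  U 2%:R 2%:R * p.1.2 + (p.1.1.1 * U 0 2%:R + (p.1.1.2 * U 1 2%:R + c 0 2%:R))),
  U 3%:R 3%:R * p.2 + (p.1.1.1 * U 0 3%:R +
    (p.1.1.2 * U 1 3%:R + (p.1.2 * U 2%:R 3%:R + c 0 3%:R)))).
have sgE p : vec p *m U + c = vec (sg p).
  apply/rowP => j; rewrite 2!mxE big4.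
  have [v0 v1 v2 v3] := vecE p; have [w0 w1 w2 w3] := vecE (sg p).
  have := Ulow 1 0 isT; have := Ulow 2%:R 0 isT; have := Ulow 3%:R 0 isT.
  have := Ulow 2%:R 1 isT; have := Ulow 3%:R 1 isT; have := Ulow 3%:R 2%:R isT.
  move=> e32 e31 e21 e30 e20 e10.
  rewrite v0 v1 v2 v3; case: (ord4P j) => ->.
  - by rewrite w0 e10 e20 e30 /=; ring.
  - by rewrite w1 e21 e31 /=; ring.
  - by rewrite w2 e32 /=; ring.
  - by rewrite w3 /=; ring.
move=> f cf; rewrite prod4 -[RHS](s4 _ (Cc_vec cf)); congr (_ * _).
rewrite /I4; congr radon_prod; apply/funext => p /=.
by rewrite sgE.
Qed.

End LinearChange.

Opaque I4.

(** * Linear maps scale the integral by a constant *)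

Section Haar.
Context {R : realType}.
Local Notation I4 := (@I4 R).

Lemma cvg_sumr (T : Type) (F : set_system T) {FF : Filter F} (J : Type)
    (r : seq J) (f : J -> T -> R) (l : J -> R) :
  (forall j, f j t @[t --> F] --> l j) ->
  (\sum_(j <- r) f j t) @[t --> F] --> \sum_(j <- r) l j.
Proof.
move=> fl; elim: r => [|j r IH].
  by rewrite big_nil; under eq_fun do rewrite big_nil; exact: cvg_cst.
by rewrite big_cons; under eq_fun do rewrite big_cons; exact: cvgD.
Qed.

Lemma continuous_sumr (T : topologicalType) (J : Type) (r : seq J) (f : J -> T -> R) :
  (forall j, continuous (f j)) -> continuous (fun t => \sum_(j <- r) f j t).
Proof. by move=> cf t; apply: cvg_sumr => j; exact: cf. Qed.

Lemma coord_cont n (j : 'I_n) : continuous (fun x : 'rV[R]_n => x 0 j).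
Proof. exact: (@coord_continuous R 1 n 0 j). Qed.

Lemma continuous_mulmx n m (A : 'M[R]_(n, m)) : continuous (fun x : 'rV[R]_n => x *m A).
Proof.
apply: continuous_row => j.
rewrite (_ : (fun t : 'rV_n => _) = fun t : 'rV_n => \sum_i t 0 i * A i j); last first.
  by apply/funext => t; rewrite mxE.
apply: continuous_sumr => i x.
by apply: (cvgM (@coord_cont n i x)); exact: cvg_cst.
Qed.

Lemma mulmx_bound n m (A : 'M[R]_(n, m)) : exists2 K : R, 0 <= K &
  forall x : 'rV[R]_n, `|x *m A| <= K * `|x|.
Proof.
have K0 : 0 <= \sum_j \sum_i `|A i j| by apply: sumr_ge0 => j _; apply: sumr_ge0.
exists (\sum_j \sum_i `|A i j|) => // x.
apply: row_norm_le => [|j]; first exact: mulr_ge0.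
rewrite mxE (le_trans (ler_norm_sum _ _ _))//.
apply: (@le_trans _ _ ((\sum_i `|A i j|) * `|x|)).
  rewrite mulr_suml; apply: ler_sum => i _.
  by rewrite normrM mulrC ler_wpM2l// coord_le_norm.
rewrite ler_wpM2r// (bigD1 j)//= lerDl; apply: sumr_ge0 => k _.
exact: sumr_ge0.
Qed.

Lemma Cc_mulmx n (A : 'M[R]_n) (c : 'rV[R]_n) f : A \in unitmx -> Cc f ->
  Cc (fun x => f (x *m A + c)).
Proof.
move=> uA; have [K K0 bK] := mulmx_bound (invmx A).
apply: (@Cc_comp _ _ _ (fun x => x *m A + c) (K * (1 + `|c|))) => [x|x].
  exact: (continuous_addr (@continuous_mulmx _ _ A) (@cst_continuous _ _ c)).
have := bK (x *m A); rewrite mulmxK// => /le_trans; apply.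
rewrite -mulrA ler_wpM2l//.
have := ler_normB (x *m A + c) c; rewrite addrK => /le_trans; apply.
have := normr_ge0 c; have := normr_ge0 (x *m A + c); nra.
Qed.

Lemma Cc_mulmx0 n (A : 'M[R]_n) (f : 'rV[R]_n -> R) : A \in unitmx -> Cc f -> Cc (fun x => f (x *m A)).
Proof. by move=> uA /(Cc_mulmx 0 uA); congr Cc; apply/funext => y; rewrite addr0. Qed.

Lemma I4_translate (c : 'rV[R]_4) f : Cc f -> I4 (fun x => f (x + c)) = I4 f.
Proof.
move=> cf; have U1 (i : 'I_4) : (1%:M : 'M[R]_4) i i = 1 by rewrite mxE eqxx.
have := @I4_upper R 1%:M c _ _ f cf; rewrite (eq_bigr (fun=> 1)) => [|i _]; last by rewrite U1 normr1.
rewrite big1_eq mul1r => <-.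
- by congr I4; apply/funext => x; rewrite mulmx1.
- by move=> i j ji; rewrite mxE -val_eqE /= gtn_eqF.
- by move=> i; rewrite U1 oner_neq0.
Qed.

(** One tent function serves twice: as the reference function that defines [modulus], and as the
    smoothing kernel in the nonlinear change of variables. *)
Definition bump n (x : 'rV[R]_n) : R := Num.max 0 (1 - `|x|).

Lemma Cc_bump n : Cc (@bump n).
Proof.
split; last by exists 1 => x x1; rewrite /bump max_l// subr_le0 ltW.
apply: (@max_fun_continuous _ _ R (fun=> 0) (fun x : 'rV[R]_n => 1 - `|x|)).
  exact: cst_continuous.
by apply: continuous_subr; [exact: cst_continuous|exact: norm_continuous].
Qed.

Lemma bump_ge0 n (x : 'rV[R]_n) : 0 <= bump x.
Proof. by rewrite /bump le_max lexx. Qed.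

Lemma bumpN n (x : 'rV[R]_n) : bump (- x) = bump x.
Proof. by rewrite /bump normrN. Qed.

Lemma I4_gt0 (f : 'rV[R]_4 -> R) x0 : Cc f -> (forall x, 0 <= f x) -> 0 < f x0 -> 0 < I4 f.
Proof.
move=> cf f0 fx0; have [_ p s _] := @radon_I4 R.
rewrite lt_neqAle eq_sym p// andbT; apply/eqP => If.
by have := s f cf f0 If x0 => e; rewrite e ltxx in fx0.
Qed.

Lemma I4_bump : 0 < I4 (@bump 4).
Proof.
apply: (@I4_gt0 _ 0); [exact: Cc_bump|exact: bump_ge0|].
by rewrite /bump normr0 subr0 max_r.
Qed.

(** The scaling factor of the integral under [A], read off from a single test function. It turns out
    to be the inverse of the absolute value of the determinant. *)
Definition modulus (A : 'M[R]_4) := I4 (fun x => bump (x *m A)) / I4 (@bump 4).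

Lemma Cc_mulr (X : normedModType R) (f g : X -> R) :
  Cc f -> continuous g -> Cc (fun x => f x * g x).
Proof.
move=> [cf [N sf]] cg; split; first by move=> x; apply: cvgM; [exact: cf|exact: cg].
by exists N => x Nx; rewrite sf// mul0r.
Qed.

Lemma Cc_tensor (X Y : normedModType R) (f : X -> R) (g : Y -> R) :
  Cc f -> Cc g -> Cc (fun p : X * Y => f p.1 * g p.2).
Proof.
move=> [cf [N sf]] [cg [N' sg]]; split.
  have cid := @continuous_idfun (X * Y)%type.
  apply: continuous_mulr; [exact: continuous_compr (continuous_fst cid) cf|].
  exact: continuous_compr (continuous_snd cid) cg.
exists (Num.max N N') => -[x y]; rewrite prod_normE /= lt_max !gt_max.
by move=> /orP[/andP[Nx _]|/andP[_ N'y]]; [rewrite sf// mul0r|rewrite sg// mulr0].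
Qed.

(* Uniqueness of Haar measure: with [I' f := I4 (fun y => f (y *m A))], both
   sides equal the double integral of [f x * bump (y - x)]. *)
Lemma I4_mulmx (A : 'M[R]_4) f : A \in unitmx -> Cc f ->
  I4 (fun x => f (x *m A)) = modulus A * I4 f.
Proof.
move=> uA cf; have rI := @radon_I4 R; have cb := @Cc_bump 4.
have cfA := Cc_mulmx0 uA cf; have cbA := Cc_mulmx0 uA cb.
(* The functional obtained by composing with [A] is again translation invariant, because a
   translation by [c] after [A] is one by [c *m invmx A] before it. *)
have tr (g : 'rV[R]_4 -> R) c : Cc g -> I4 (fun y => g (y *m A + c)) = I4 (fun y => g (y *m A)).
  move=> cg; rewrite -[RHS](I4_translate (c *m invmx A)); last exact: Cc_mulmx0.
  by congr I4; apply/funext => y; rewrite mulmxDl mulmxKV.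
have b0 := I4_bump.
suff E : I4 f * I4 (fun y => bump (y *m A)) = I4 (fun y => f (y *m A)) * I4 (@bump 4).
  have b0' : I4 (@bump 4) != 0 by rewrite gt_eqF.
  have cross (x y z t : R) : t != 0 -> x * y = z * t -> z = y / t * x.
    by move=> t0 e; rewrite mulrAC -[y * x]mulrC e mulfK.
  exact: cross b0' E.
transitivity (I4 (fun x => I4 (fun y => f x * bump (y *m A - x)))).
  rewrite mulrC -(radonZ rI)//; congr I4; apply/funext => x.
  rewrite (radonZ rI); last exact: Cc_mulmx.
  by rewrite (tr _ (- x) cb) mulrC.
have [K K0 bK] := mulmx_bound (invmx A).
(* The point [y] is recovered from the two arguments of the tensor product; this is the growth bound
   that [Cc_comp] asks for, in both orders of integration. *)
have yK (y u v : 'rV[R]_4) : y *m A = u + v -> `|y| <= 2 * K * `|(u, v)|.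
  move=> yuv; have := bK (y *m A); rewrite mulmxK// yuv => /le_trans; apply.
  rewrite [2 * K]mulrC -mulrA ler_wpM2l//; have := ler_normD u v.
  have := le_norm_pair1 u v; have := le_norm_pair2 u v; lra.
have cM := @continuous_mulmx 4 4 A.
have cid := @continuous_idfun ('rV[R]_4 * 'rV[R]_4)%type.
have c1 := continuous_fst cid.
have c2 := continuous_compr (continuous_snd cid) cM.
rewrite (@commute_I4 R (fun x y => f x * bump (y *m A - x))); last first.
  apply: (@Cc_comp _ _ _ (fun p : 'rV[R]_4 * 'rV[R]_4 => (p.1, p.2 *m A - p.1)) (2 * K + 1) _ _ _ (Cc_tensor cf cb)).
    by apply: continuous_pair => //; exact: continuous_subr.
  move=> [x y] /=; have := @yK y x (y *m A - x); rewrite addrC subrK => /(_ erefl) h.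
  have := le_norm_pair1 x (y *m A - x).
  rewrite (prod_normE (x, y)) ge_max /=; move: h; set u := `|(x, _)| => h xu.
  have u0 : 0 <= u := normr_ge0 _; have Ku := mulr_ge0 K0 u0.
  by apply/andP; split; [|apply: le_trans h _]; nra.
transitivity (I4 (fun y => I4 (fun x => f (x + y *m A) * bump (- x)))).
  apply: (congr1 I4); apply/funext => y.
  have cfb : Cc (fun x => f x * bump (y *m A - x)).
    apply: (Cc_mulr cf); have [cbump _] := cb.
    apply: (continuous_compr _ cbump).
    exact: (continuous_subr (@cst_continuous _ _ (y *m A)) (@continuous_idfun _)).
  rewrite -(I4_translate (y *m A) cfb).
  by congr I4; apply/funext => x; rewrite opprD addrCA subrr addr0.
rewrite -(@commute_I4 R (fun x y => f (x + y *m A) * bump (- x))); last first.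
  apply: (@Cc_comp _ _ _ (fun p : 'rV[R]_4 * 'rV[R]_4 => (p.1 + p.2 *m A, - p.1)) (2 * K + 1) _ _ _ (Cc_tensor cf cb)).
    by apply: continuous_pair => p; [exact: (continuous_addr c1 c2)|apply: cvgN; exact: c1].
  move=> [x y] /=; have := @yK y (x + y *m A) (- x); rewrite addrAC subrr add0r => /(_ erefl) h.
  have := le_norm_pair2 (x + y *m A) (- x); rewrite normrN.
  rewrite (prod_normE (x, y)) ge_max /=; move: h; set u := `|(_, - x)| => h xu.
  have u0 : 0 <= u := normr_ge0 _; have Ku := mulr_ge0 K0 u0.
  by apply/andP; split; [|apply: le_trans h _]; nra.
rewrite -(radonZ rI)//; congr I4; apply/funext => x.
rewrite bumpN mulrC -(tr f x cf) -(radonZ rI); last exact: Cc_mulmx.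
by congr I4; apply/funext => y; rewrite mulrC addrC.
Qed.

End Haar.

(** * Identification of the scaling factor with the determinant *)

Section Determinant.
Context {R : realType}.
Local Notation I4 := (@I4 R).

Lemma modulus_gt0 (A : 'M[R]_4) : A \in unitmx -> 0 < modulus A.
Proof.
move=> uA; apply: divr_gt0; last exact: I4_bump.
apply: (@I4_gt0 _ _ 0); first exact: (Cc_mulmx0 uA (@Cc_bump _ 4)).
  by move=> x; exact: bump_ge0.
by rewrite /bump mul0mx normr0 subr0 max_r.
Qed.

Lemma modulusM (A B : 'M[R]_4) : A \in unitmx -> B \in unitmx ->
  modulus (A *m B) = modulus A * modulus B.
Proof.
move=> uA uB; have cB := Cc_mulmx0 uB (@Cc_bump R 4).
rewrite {1}/modulus -[X in X / _](_ : I4 (fun x => bump (x *m A *m B)) = _); last first.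
  by congr I4; apply/funext => x; rewrite mulmxA.
by rewrite (I4_mulmx uA cB) mulrA.
Qed.

Lemma modulus1 : modulus (1%:M : 'M[R]_4) = 1.
Proof.
have u1 := unitmx1 R 4; have m0 := modulus_gt0 u1.
by apply: (mulIf (lt0r_neq0 m0)); rewrite -modulusM// mul1r mulmx1.
Qed.

(** A permutation has finite order, so its modulus is a positive real number with some positive
    power equal to 1. *)
Lemma modulus_perm (s : 'S_4) : modulus (perm_mx s : 'M[R]_4) = 1.
Proof.
have ms k : modulus (perm_mx (s ^+ k)%g : 'M[R]_4) = modulus (perm_mx s) ^+ k.
  elim: k => [|k IH]; first by rewrite expg0 perm_mx1 modulus1.
  by rewrite expgS perm_mxM modulusM ?unitmx_perm// IH exprS.
have := ms #[s]%g; rewrite expg_order perm_mx1 modulus1 => /esym/eqP.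
by rewrite pexpr_eq1 ?order_gt0// ?ltW ?modulus_gt0 ?unitmx_perm// => /eqP.
Qed.

Lemma modulus_upper (U : 'M[R]_4) : (forall i j : 'I_4, (j < i)%N -> U i j = 0) ->
  (forall i, U i i != 0) -> modulus U = (\prod_i `|U i i|)^-1.
Proof.
move=> Ulow Udiag; have p0 : \prod_i `|U i i| != 0.
  by apply/prodf_neq0 => i _; rewrite normr_eq0.
rewrite /modulus -(I4_upper 0 Ulow Udiag (@Cc_bump R 4)).
have -> : I4 (fun x => bump (x *m U + 0)) = I4 (fun x => bump (x *m U)).
  by congr I4; apply/funext => x; rewrite addr0.
have b0 : I4 (fun x => bump (x *m U)) != 0.
  have := @I4_bump R; rewrite -(I4_upper 0 Ulow Udiag (@Cc_bump R 4)).
  have -> : I4 (fun x => bump (x *m U + 0)) = I4 (fun x => bump (x *m U)).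
    by congr I4; apply/funext => x; rewrite addr0.
  by move=> b0; apply/eqP => e; rewrite e mulr0 ltxx in b0.
by rewrite invfM mulrCA divff// mulr1.
Qed.

Lemma det_upper (U : 'M[R]_4) : (forall i j : 'I_4, (j < i)%N -> U i j = 0) ->
  \det U = \prod_i U i i.
Proof.
move=> Ulow; rewrite -det_tr det_trig; first by apply: eq_bigr => i _; rewrite mxE.
by apply/is_trig_mxP => i j ij; rewrite mxE Ulow.
Qed.

(** Conjugating by the permutation that reverses the coordinates keeps the modulus and makes the
    matrix upper triangular, still with unit diagonal. *)
Lemma modulus_lower (L : 'M[R]_4) :
  (forall i j : 'I_4, (i <= j)%N -> L i j = (i == j)%:R) -> modulus L = 1.
Proof.
move=> Lup; pose s := perm (@rev_ord_inj 4); pose P : 'M[R]_4 := perm_mx s.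
have uP : P \in unitmx by exact: unitmx_perm.
have PP : P *m P = 1%:M.
  rewrite -perm_mxM -perm_mx1; congr perm_mx; apply/permP => i.
  by rewrite permM !permE rev_ordK.
have PLP i j : (P *m L *m P) i j = L (rev_ord i) (rev_ord j).
  have Ps : P = perm_mx (s^-1)^-1%g by rewrite invgK.
  rewrite {2}Ps -row_permE -col_permE !mxE permE; congr (L _ _).
  by apply: (@perm_inj _ s); rewrite permKV permE rev_ordK.
have uL : L \in unitmx.
  rewrite unitmxE -det_tr det_upper => [|i j ji].
    by rewrite big1 ?unitr1// => i _; rewrite mxE Lup// eqxx.
  have ji' : (j == i) = false by apply/negbTE; rewrite -val_eqE /= neq_ltn ji.
  by rewrite mxE (Lup _ _ (ltnW ji)) ji'.
have : modulus (P *m L *m P) = modulus L.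
  by rewrite !modulusM ?unitmx_mul ?uP// modulus_perm mul1r mulr1.
move=> <-; rewrite modulus_upper.
- by rewrite big1 ?invr1// => i _; rewrite PLP Lup// eqxx normr1.
- move=> i j ji.
  have ij : (rev_ord i == rev_ord j) = false.
    by apply/negbTE; rewrite (inj_eq rev_ord_inj) -val_eqE /= neq_ltn ji orbT.
  have le_ij : (rev_ord i <= rev_ord j)%N by apply: leq_sub2l; exact: ltnW ji.
  by rewrite PLP (Lup _ _ le_ij) ij.
- by move=> i; rewrite PLP Lup// eqxx oner_neq0.
Qed.

Lemma ex_lup n (A : 'M[R]_n.+1) : exists s L U, [/\ perm_mx s *m A = L *m U,
  \det L = 1, forall i j : 'I_n.+1, (i <= j)%N -> L i j = (i == j)%:R &
  forall i j : 'I_n.+1, (j < i)%N -> U i j = 0].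
Proof.
have := cormen_lup_correct A; have := cormen_lup_detL A.
have := cormen_lup_perm A; have := cormen_lup_lower A; have := cormen_lup_upper A.
case: (cormen_lup A) => [[P L] U] /= Ulow Llow /is_perm_mxP[s ->] detL E.
by exists s, L, U.
Qed.

(** In a decomposition of [A] into a permutation, [L] and [U], the first two have modulus 1 and
    determinant of absolute value 1, so both quantities reduce to the diagonal of [U]. *)
Lemma I4_linear (A : 'M[R]_4) f : A \in unitmx -> Cc f ->
  `|\det A| * I4 (fun x => f (x *m A)) = I4 f.
Proof.
move=> uA cf; rewrite I4_mulmx// mulrA -[RHS]mul1r; congr (_ * _).
have [s [L [U [E detL Llow Ulow]]]] := ex_lup A.
have ml : modulus L = 1 by exact: modulus_lower.
have uL : L \in unitmx by rewrite unitmxE detL unitr1.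
have dP : `|\det (perm_mx s : 'M[R]_4)| = 1 by rewrite det_perm normr_sign.
have uP : (perm_mx s : 'M[R]_4) \in unitmx by exact: unitmx_perm.
have dU : `|\det A| = `|\det U|.
  have : `|\det (perm_mx s *m A)| = `|\det (L *m U)| by congr (`|\det _|).
  by rewrite !det_mulmx !normrM dP detL normr1 !mul1r.
have uU : U \in unitmx.
  by move: uA; rewrite !unitmxE !unitfE -normr_eq0 dU normr_eq0.
have Udiag i : U i i != 0.
  move: uU; rewrite unitmxE det_upper// unitfE => /prodf_neq0; exact.
have E1 := modulusM uP uA; have E2 := modulusM uL uU.
rewrite modulus_perm mul1r in E1; rewrite ml mul1r in E2.
rewrite -E1 E E2 (modulus_upper Ulow Udiag) dU (det_upper Ulow) normr_prod.
apply: divff.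
by apply/prodf_neq0 => i _; rewrite normr_eq0.
Qed.

End Determinant.

(** * Change of variables *)

Section StrictDiff.
Context {R : realType}.

Lemma diff_mul n m (f : 'rV[R]_n -> 'rV[R]_m) p v : 'd f p v = v *m 'J f p.
Proof. by rewrite /jacobian mul_rV_lin1. Qed.

Lemma is_derive_line n m (f : 'rV[R]_n -> 'rV[R]_m) (a v : 'rV[R]_n) (t : R) j :
  differentiable f (a + t *: v) ->
  is_derive t 1 (fun t : R => f (a + t *: v) 0 j) ((v *m 'J f (a + t *: v)) 0 j).
Proof.
move=> df; apply: is_derive_cvg.
have /cvg_ex[/= l fl] := @diff_derivable _ _ _ f _ v df.
have lE : l = v *m 'J f (a + t *: v).
  rewrite -deriveEjacobian//; apply/esym; exact: (cvg_lim _ fl).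
rewrite -lE; have := cvg_comp _ _ fl (@coord_cont R m j l).
apply: cvg_trans; apply: near_eq_cvg; near=> h => /=.
rewrite !mxE [h *: 1]mulr1 scalerDl.
by rewrite (_ : h *: v + (a + t *: v) = a + (h *: v + t *: v)) // addrCA.
Unshelve. all: by end_near. Qed.

Lemma ball_convex n (p a b : 'rV[R]_n) d (t : R) : ball p d a -> ball p d b ->
  t \in `[0, 1] -> ball p d (a + t *: (b - a)).
Proof.
rewrite -ball_normE /= in_itv/= => pa pb /andP[t0 t1].
have -> : p - (a + t *: (b - a)) = (1 - t) *: (p - a) + t *: (p - b).
  by apply/rowP => i; rewrite !mxE; ring.
rewrite (le_lt_trans (ler_normD _ _))// !normrZ (ger0_norm t0) ger0_norm ?subr_ge0//.
have [->|tn0] := eqVneq t 0; first by rewrite subr0 mul1r mul0r addr0.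
have tp : 0 < t by rewrite lt_neqAle eq_sym tn0.
have t1' : 0 <= 1 - t by rewrite subr_ge0.
have := ler_wpM2l t1' (ltW pa); have : t * `|p - b| < t * d by rewrite ltr_pM2l.
lra.
Qed.

Lemma jacobian_continuous n m (U : set 'rV[R]_n) (f : 'rV[R]_n -> 'rV[R]_m) p i j :
  U p -> Ck 1 U f -> {for p, continuous (fun x => 'J f x i j)}.
Proof.
move=> Up [_ /(_ (delta_mx 0 i) p Up) cf].
have -> : (fun x => 'J f x i j) = (fun x => ('d f x (delta_mx 0 i)) 0 j).
  by apply/funext => x; rewrite mxE.
exact: (continuous_comp cf (@coord_cont R m j _)).
Qed.

(** Strict differentiability: both points move while the Jacobian stays at [p]. The blow-up in the
    change of variables is centred at points near [p], so the ordinary expansion at [p] would not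
    do. The mean value theorem is applied to each coordinate along the segment. *)
Lemma strict_diff n m (U : set 'rV[R]_n) (f : 'rV[R]_n -> 'rV[R]_m) p (eta : R) :
  open U -> U p -> Ck 1 U f -> 0 < eta ->
  exists2 d, 0 < d & forall a b, ball p d a -> ball p d b ->
    `|f b - f a - (b - a) *m 'J f p| <= eta * `|b - a|.
Proof.
move=> oU Up Cf eta0; have [df _] := Cf.
(* Each of the [n] terms of the matrix product contributes this error times [|b - a|]; dividing by
   [n.+1] rather than [n] covers [n = 0]. *)
have e0 : 0 < eta / n.+1%:R by rewrite divr_gt0.
have : \forall q \near p, U q /\ forall i j, `|'J f p i j - 'J f q i j| <= eta / n.+1%:R.
  have h1 : \forall q \near p, U q by exact: open_nbhs_nbhs.
  have h2 : \forall q \near p, forall i j, `|'J f p i j - 'J f q i j| <= eta / n.+1%:R.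
    apply: (@filter_forall _ _ (fun i q => forall j, `|'J f p i j - 'J f q i j|
      <= eta / n.+1%:R) _ (nbhs_filter p)) => i.
    apply: (@filter_forall _ _ (fun j q => `|'J f p i j - 'J f q i j|
      <= eta / n.+1%:R) _ (nbhs_filter p)) => j.
    by have /cvgrPdist_le/(_ _ e0) := @jacobian_continuous _ _ U f p i j Up Cf.
  by apply: filterS2 h1 h2 => q.
move=> /nbhs_ballP[d /= d0 dP]; exists d => // a b pa pb.
apply: row_norm_le => [|j]; first by rewrite mulr_ge0// ltW.
have ht t : t \in `[0, 1] -> U (a + t *: (b - a)) /\ forall i j,
    `|'J f p i j - 'J f (a + t *: (b - a)) i j| <= eta / n.+1%:R.
  by move=> t01; apply: dP; exact: ball_convex.
pose g (t : R) : R := f (a + t *: (b - a)) 0 j.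
have dg (t : R) : t \in `[0, 1] -> is_derive (0 + t * (1 - 0) : R) 1 g
    (((b - a) *m 'J f (a + (0 + t * (1 - 0)) *: (b - a))) 0 j).
  move=> /ht[Ut _]; rewrite add0r subr0 mulr1; apply: is_derive_line.
  exact: df.
have [t t01] := @MVT_is_derive R g (fun t => ((b - a) *m 'J f (a + t *: (b - a))) 0 j) 0 1 dg.
rewrite /g subr0 !mulr1 add0r scale0r addr0 scale1r (addrC a) subrK => E.
have [_ hi] := ht t t01.
move: hi E; move: ('J f (a + t *: (b - a))) ('J f p) => B A hi E.
rewrite !mxE in E *; rewrite E -sumrB.
apply: (@le_trans _ _ (\sum_(i < n) `|b - a| * (eta / n.+1%:R))).
  apply: le_trans (ler_norm_sum _ _ _) _; apply: ler_sum => i _.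
  rewrite -mulrBr normrM; apply: ler_pM; [exact: normr_ge0..|exact: coord_le_norm|].
  by have := hi i j; rewrite distrC.
rewrite sumr_const card_ord -[leLHS]mulr_natl [leRHS]mulrC.
have E4 (x y z w : R) : x * (y * (z * w)) = y * z * (x * w) by ring.
rewrite E4.
rewrite ler_piMr//; first by rewrite mulr_ge0// ltW.
by rewrite ler_pdivrMr// mul1r ler_nat.
Qed.

End StrictDiff.

(** * Nonlinear changes of variables by blow-up of a kernel *)

Section ChangeVar.
Context {R : realType}.
Local Notation I4 := (@I4 R).
Local Notation bump := (@bump R 4).
Local Notation E4 := ('rV[R]_4).

(** Extension by zero: [g] is controlled only on [U], and [f] vanishes off a closed subset of
    [U]. *)
Lemma continuous_mul_on (T : topologicalType) (K U : set T) (f g : T -> R) :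
  closed K -> K `<=` U -> (forall x, ~ K x -> f x = 0) -> continuous f ->
  (forall x, U x -> {for x, continuous g}) -> continuous (fun x => f x * g x).
Proof.
move=> cK KU f0 cf cg x; have [Kx|nKx] := pselect (K x).
  by apply: cvgM; [exact: cf|exact: cg (KU _ Kx)].
have : \forall y \near x, cst 0 y = f y * g y.
  have oK : open (~` K) by exact: closed_openC.
  have := open_nbhs_nbhs (conj oK nKx).
  by apply: filterS => y nKy; rewrite f0// mul0r.
move=> /near_eq_cvg h.
rewrite /continuous_at /= f0// mul0r.
by apply: cvg_trans h _; exact: cvg_cst.
Qed.

Lemma near_fst (T T' : Type) (F : set_system T) (F' : set_system T') (P : set T) :
  Filter F' -> F P -> filter_prod F F' (fun t => P t.1).
Proof. by move=> FF' FP; exists (P, setT) => [|t []//]; split => //; exact: filterT. Qed.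

Lemma near_snd (T T' : Type) (F : set_system T) (F' : set_system T') (P : set T') :
  Filter F -> F' P -> filter_prod F F' (fun t => P t.2).
Proof. by move=> FF' FP; exists (setT, P) => [|t []//]; split => //; exact: filterT. Qed.

Lemma I4_scale (e : R) (c : E4) f : e != 0 -> Cc f ->
  I4 (fun y => f (e *: y + c)) = (`|e| ^+ 4)^-1 * I4 f.
Proof.
move=> e0 cf; have u1 : (1%:M : 'M[R]_4) \in unitmx := unitmx1 _ _.
have cf' : Cc (fun y => f (y + c)).
  by have := Cc_mulmx c u1 cf; congr Cc; apply/funext => y; rewrite mulmx1.
have ue : (e%:M : 'M[R]_4) \in unitmx by rewrite unitmxE det_scalar unitfE expf_neq0.
have := I4_linear ue cf'; rewrite det_scalar normrX I4_translate// => <-.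
have e4 : `|e| ^+ 4 != 0 by rewrite expf_neq0 ?normr_eq0.
rewrite (mulKf e4).
by congr I4; apply/funext => y; rewrite mul_mx_scalar.
Qed.

Variables (U V K : set E4) (h k : E4 -> E4) (G H : E4 -> R).
Hypotheses (oU : open U) (oV : open V) (Ch : Ck 1 U h)
  (hU : forall x, U x -> V (h x)) (ck : forall y, V y -> {for y, continuous k})
  (hk : forall x, U x -> k (h x) = x) (kh : forall y, V y -> h (k y) = y)
  (uJ : forall x, U x -> 'J h x \in unitmx)
  (cK : compact K) (KU : K `<=` U)
  (G0 : forall x, ~ K x -> G x = 0) (cG : continuous G)
  (CH : Cc H) (H0 : forall y, ~ (h @` K) y -> H y = 0)
  (GH : forall x, U x -> G x = H (h x) * `|\det ('J h x)|).

Let ch x : U x -> {for x, continuous h}.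
Proof. by move=> Ux; apply: differentiable_continuous; case: Ch => dh _; exact: dh. Qed.

Let clK : closed K. Proof. by apply: compact_closed => //; exact: norm_hausdorff. Qed.

Let chK : compact (h @` K).
Proof.
apply: continuous_compact => //; apply: continuous_in_subspaceT => x.
by rewrite inE => /KU; exact: ch.
Qed.

Let clhK : closed (h @` K).
Proof. by apply: compact_closed => //; exact: norm_hausdorff. Qed.

Let bounded_compact (A : set E4) : compact A ->
  exists2 N : R, 0 <= N & forall x, A x -> `|x| <= N.
Proof.
move=> /compact_bounded[M [_ MA]]; exists (`|M| + 1); first by rewrite addr_ge0.
by move=> x Ax; apply: MA => //; rewrite (le_lt_trans (ler_norm _))// ltrDl.
Qed.

Let CG : Cc G.
Proof.
split => //; have [N N0 KN] := bounded_compact cK; exists N => x Nx.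
by apply: G0 => /KN; rewrite leNgt Nx.
Qed.

(* The integral of [ker e] over [x] and [y], divided by [e ^+ 4], is
   [I4 G * I4 bump] when [y] is integrated first.  When [x] is integrated first,
   the inner integral [Phi e] tends to [H * I4 bump] as [e] tends to 0, because
   [h] is linear up to a small error at scale [e]. *)
Let ker (e : R) (x y : E4) := G x * bump (e^-1 *: (h x - y)).

Let Phi (e : R) (y : E4) := (`|e| ^+ 4)^-1 * I4 (fun x => ker e x y).

Let bump0 (x : E4) : 1 <= `|x| -> bump x = 0.
Proof. by move=> x1; rewrite /bump max_l// subr_le0. Qed.

Let ker0 e x y : e != 0 -> `|e| <= `|h x - y| -> ker e x y = 0.
Proof.
move=> e0 hxy; rewrite /ker bump0 ?mulr0// normrZ normfV.
by rewrite mulrC ler_pdivlMr ?normr_gt0// mul1r.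
Qed.

Let CcK e : e != 0 -> Cc (fun p : E4 * E4 => ker e p.1 p.2).
Proof.
move=> e0; have cid := @continuous_idfun (E4 * E4)%type.
have c1 := continuous_fst cid; have c2 := continuous_snd cid.
split.
  apply: (@continuous_mul_on _ (fst @^-1` K) (fst @^-1` U)).
  - by apply: preimage_closed => // p _; exact: c1.
  - by move=> p; exact: KU.
  - by move=> p; exact: G0.
  - exact: continuous_compr c1 cG.
  move=> p Up; have cb := (@Cc_bump R 4).1.
  apply: (continuous_comp _ (cb _)); apply: cvgZl_tmp; apply: cvgB; last exact: c2.
  exact: (continuous_comp (c1 p) (ch Up)).
have [N N0 KN] := bounded_compact cK; have [M M0 KM] := bounded_compact chK.
exists (N + M + `|e|) => -[x y] /=; rewrite prod_normE/= lt_max => Nxy.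
have [Kx|nKx] := pselect (K x); last by rewrite /ker G0// mul0r.
apply: ker0 => //; have hx : `|h x| <= M by apply: KM; exists x.
have := ler_normD (h x) (- (h x - y)); rewrite normrN.
rewrite opprB addrCA subrr addr0 => yh.
have := KN x Kx => xN; have := normr_ge0 e => ee.
by case/orP: Nxy; lra.
Qed.

Let Cc_kerl e y : e != 0 -> Cc (fun x => ker e x y).
Proof.
move=> e0; have := CcK e0 => c.
apply: (@Cc_comp1 _ _ _ (fun x : E4 => (x, y)) _ _ _ c) => [|x]; last exact: le_norm_pair1.
by apply: continuous_pair; [exact: continuous_idfun|exact: cst_continuous].
Qed.

(** For fixed [x] the kernel is an affine image of [bump] in the variable [y], so its integral is
    [|e| ^+ 4 * I4 bump] whatever [h x] is, and the prefactor of [Phi] cancels the power of [e]. *)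
Let Phi_total e : e != 0 -> I4 (Phi e) = I4 G * I4 bump.
Proof.
move=> e0; have rI := @radon_I4 R; have pE := @proper_rV R 4.
have e4 : `|e| ^+ 4 != 0 by rewrite expf_neq0 ?normr_eq0.
have c := CcK e0.
have c' : Cc (fun p : E4 * E4 => ker e p.2 p.1).
  apply: (@Cc_comp1 _ _ _ (fun p : E4 * E4 => (p.2, p.1)) _ _ _ c) => [|[x y]].
    have cid := @continuous_idfun (E4 * E4)%type.
    exact: continuous_pair (continuous_snd cid) (continuous_fst cid).
  by rewrite /= !prod_normE maxC.
have inner x : I4 (fun y => ker e x y) = (`|e| ^+ 4 * I4 bump) * G x.
  rewrite /ker [RHS]mulrC.
  have -> : (fun y => G x * bump (e^-1 *: (h x - y))) =
            (fun y => G x * bump ((- e^-1) *: y + e^-1 *: h x)).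
    by apply/funext => y; rewrite scalerBr scaleNr addrC.
  have ne : - e^-1 != 0 by rewrite oppr_eq0 invr_eq0.
  have cb : Cc (fun y => bump ((- e^-1) *: y + e^-1 *: h x)).
    have ue : ((- e^-1)%:M : 'M[R]_4) \in unitmx by rewrite unitmxE det_scalar unitfE expf_neq0.
    have := Cc_mulmx (e^-1 *: h x) ue (@Cc_bump R 4); congr Cc; apply/funext => y.
    by rewrite mul_mx_scalar.
  rewrite (radonZ rI)// I4_scale//; last exact: Cc_bump.
  by rewrite normrN normfV exprVn invrK.
rewrite /Phi (radonZ rI); last exact: (Cc_partial pE rI c').
rewrite -(@commute_I4 R (fun x y => ker e x y) c).
rewrite (_ : (fun x => _) = (fun x => (`|e| ^+ 4 * I4 bump) * G x)); last first.
  by apply/funext => x; exact: inner.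
by rewrite (radonZ rI _ CG) -mulrA (mulKf e4) mulrC.
Qed.

Let Phi_cvg_out y0 : ~ (h @` K) y0 ->
  \forall y \near y0 & e \near 0^', Phi e y = 0 /\ H y = 0.
Proof.
move=> nK; have oK : open (~` (h @` K)) by exact: closed_openC.
have /nbhs_ballP[r /= r0 rK] := open_nbhs_nbhs (conj oK nK).
have r2 : 0 < r / 2 by rewrite divr_gt0.
near=> y e; split; last first.
  by apply: H0; apply: rK; near: y; exact: nbhsx_ballx.
have e0 : e != 0 by near: e; exact: nbhs_dnbhs_neq.
have er : `|e| < r / 2 by near: e; exact: dnbhs0_lt.
have yr : ball y0 (r / 2) y by near: y; exact: nbhsx_ballx.
rewrite /Phi (_ : (fun x => _) = fun=> 0) ?radon0 ?mulr0//; first exact: radon_I4.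
apply/funext => x; have [Kx|nKx] := pselect (K x); last by rewrite /ker G0// mul0r.
apply: ker0 => //; rewrite leNgt; apply/negP => hxy.
suff : (~` (h @` K)) (h x) by apply; exists x.
apply: rK; move: yr; rewrite -!ball_normE /= => yr.
rewrite (_ : y0 - h x = (y0 - y) - (h x - y)); last by rewrite opprB addrA subrK.
rewrite (le_lt_trans (ler_normB _ _))// [r]splitr ltrD//.
exact: lt_trans hxy er.
Unshelve. all: by end_near. Qed.

(** The substitution [x = e *: z + k y] absorbs the prefactor of [Phi], and the integrand tends to
    [G p0 * bump (z *m D)] with [D] the Jacobian at [p0]. By [I4_linear] and [GH] the limit
    integrates to [H (h p0) * I4 bump]. The limit is taken jointly in [e] and [y], as [radon_cvg]
    requires afterwards. *)
Let Phi_cvg_in p0 : K p0 ->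
  Phi t.1 t.2 @[t --> filter_prod (0^' : set_system R) (nbhs (h p0))] -->
  H (h p0) * I4 bump.
Proof.
move=> Kp0; have Up0 := KU Kp0; pose y0 := h p0; have Vy0 : V y0 by exact: hU.
have ky0 : k y0 = p0 by exact: hk.
have uD := uJ Up0; move: (uD) (@strict_diff R _ _ U h p0) (GH Up0).
move: ('J h p0) => D {}uD sd GHp0.
have [K1 K10 bK1] := mulmx_bound (invmx D).
pose c := K1 + 1; have c0 : 0 < c by rewrite ltr_wpDl.
have zc (z : E4) : `|z| <= c * `|z *m D|.
  have := bK1 (z *m D); rewrite mulmxK// => /le_trans; apply.
  by rewrite ler_wpM2r// lerDl.
(* Since [|z| <= c * |z *m D|], an error of this size costs at most half of [|b - a|], which makes
   [h] injective near [p0] with a Lipschitz inverse of constant [2 * c]. *)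
have eta0 : 0 < (2 * c)^-1 by rewrite invr_gt0 mulr_gt0.
have [d0 d00 sd0] := sd _ oU Up0 Ch eta0.
have inj_h a b : ball p0 d0 a -> ball p0 d0 b -> `|b - a| <= 2 * c * `|h b - h a|.
  move=> pa pb; have := sd0 a b pa pb; have := zc (b - a).
  have := ler_normB (h b - h a) (h b - h a - (b - a) *m D).
  rewrite opprB addrC subrK.
  set u := `|b - a|; set v := `|h b - h a|; set w := `|_ *m D|; set s := `|_ - _ - _| => h1 h2 h3.
  have h4 : c * w <= c * v + c * ((2 * c)^-1 * u).
    by rewrite -mulrDr ler_pM2l// (le_trans h1)// lerD2l.
  have e1 : c * ((2 * c)^-1 * u) = u / 2 by field; rewrite gt_eqF.
  by rewrite e1 in h4; lra.
have V_near : \forall w \near y0, V w by exact: open_nbhs_nbhs.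
have k_cvg : k w @[w --> y0] --> p0 by rewrite -ky0; exact: ck Vy0.
have k_near d : 0 < d -> \forall w \near y0, ball p0 d (k w).
  by move=> d_gt0; exact: (k_cvg _ (nbhsx_ballx p0 d d_gt0)).
have [r r0 rV] : exists2 r, 0 < r & forall w, ball y0 r w -> V w /\ ball p0 d0 (k w).
  have rV' : nbhs y0 [set w | V w /\ ball p0 d0 (k w)] by exact: filterI V_near (k_near _ d00).
  by have /nbhs_ballP[r /= r0 rV] := rV'; exists r.
have r2 : 0 < r / 2 by rewrite divr_gt0.
pose F : set_system (R * E4) := filter_prod (0^' : set_system R) (nbhs y0).
pose Psi (t : R * E4) (z : E4) := ker t.1 (t.1 *: z + k t.2) t.2.
pose Psi0 (z : E4) := G p0 * bump (z *m D).
have rI := @radon_I4 R; have pE := @proper_rV R 4.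
have CPsi0 : Cc (fun z => bump (z *m D)) by exact: (Cc_mulmx0 uD (@Cc_bump R 4)).
have nb0 : \forall e \near (0 : R)^', e != 0 by exact: nbhs_dnbhs_neq.
have nbe e : 0 < e -> \forall e' \near (0 : R)^', `|e'| < e by exact: dnbhs0_lt.
have FF : Filter F by exact: filter_prod_filter.
have F1 : \forall t \near F, t.1 != 0 by exact: (near_fst (nbhs_filter y0) nb0).
have F2 e : 0 < e -> \forall t \near F, `|t.1| < e.
  by move=> /nbe e0; exact: (near_fst (nbhs_filter y0) e0).
have F3 (P : set E4) : nbhs y0 P -> \forall t \near F, P t.2.
  exact: near_snd.
have PhiE : \forall t \near F, Phi t.1 t.2 = I4 (Psi t).
  near=> t; have t0 : t.1 != 0 by near: t.
  by rewrite /Psi (I4_scale _ t0 (Cc_kerl t.2 t0)).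
have lim : I4 (Psi t) @[t --> F] --> I4 Psi0.
  (* A common support radius: where the kernel is nonzero, [|h x - y| < |e|], and the Lipschitz
     bound for the inverse gives [|e *: z| <= 2 * c * |h x - y|], hence [|z| <= 2 * c]. *)
  apply: (@radon_cvg _ _ _ rI _ _ _ _ _ (2 * c) pE).
  - near=> t; have t0 : t.1 != 0 by near: t.
    split.
      apply: (@continuous_compr _ _ _ (fun z : E4 => t.1 *: z + k t.2) _ _ (Cc_kerl t.2 t0).1).
      exact: (continuous_addr (@scaler_continuous R E4 t.1) (@cst_continuous _ _ (k t.2))).
    move=> z zc2; rewrite /Psi; set x := _ + _.
    have [Kx|nKx] := pselect (K x); last by rewrite /ker G0// mul0r.
    apply: ker0 => //; rewrite leNgt; apply/negP => hxy.
    have tr : `|t.1| < r / 2 by near: t; exact: F2.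
    have yr : ball y0 (r / 2) t.2 by near: t; apply: F3; exact: nbhsx_ballx.
    have hr : ball y0 r (h x).
      move: yr; rewrite -!ball_normE /= => yr.
      rewrite (_ : y0 - h x = (y0 - t.2) - (h x - t.2)); last by rewrite opprB addrA subrK.
      rewrite (le_lt_trans (ler_normB _ _))// [r]splitr ltrD//.
      exact: lt_trans hxy tr.
    have [_] := rV _ hr; rewrite (hk (KU Kx)) => px.
    have yr' : ball y0 r t.2 by apply: le_ball yr; lra.
    have [Vt pk] := rV _ yr'.
    have := inj_h _ _ pk px; rewrite (kh Vt) /x addrK normrZ => h1.
    have h2 : 2 * c * `|h x - t.2| < `|t.1| * `|z|.
      rewrite mulrC; apply: ltr_pM => //.
      by rewrite mulr_ge0// ltW.
    by move: (le_lt_trans h1 h2); rewrite ltxx.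
  - by have [] := CcZ (G p0) CPsi0.
  - move=> z zc2; rewrite /Psi0 bump0 ?mulr0//.
    by have := zc z; nra.
  move=> z e e0.
  have e2 : 0 < e / 2 by rewrite divr_gt0.
  pose W := filter_prod (nbhs z) F.
  have W1 (P : set E4) : nbhs z P -> \forall w \near W, P w.1.
    by move=> zP; exact: near_fst.
  have W2 (P : set (R * E4)) : F P -> \forall w \near W, P w.2.
    by move=> zP; exact: near_snd.
  have FW : Filter W by exact: filter_prod_filter.
  have w1_cvg : w.1 @[w --> W] --> z by move=> A zA; exact: W1.
  have w21_cvg : w.2.1 @[w --> W] --> (0 : R).
    move=> A A0; apply: (W2 (fun t => A t.1)); apply: (near_fst (nbhs_filter y0)).
    exact: cvg_within A0.
  have w22_cvg : k w.2.2 @[w --> W] --> p0.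
    by move=> A /k_cvg kA; exact: (W2 (fun t => A (k t.2)) (F3 _ kA)).
  have x_cvg : w.2.1 *: w.1 + k w.2.2 @[w --> W] --> p0.
    rewrite -[X in _ --> X]add0r -(scale0r z).
    exact: (cvgD (cvgZ w21_cvg w1_cvg) w22_cvg).
  (* As [y = h (k y)], the bracket is an increment of [h] along [e *: z]. Strict differentiability
     makes it linear up to a small multiple of [|e| * |z|], and the factor [e^-1] removes the
     scale. *)
  have q_cvg : w.2.1^-1 *: (h (w.2.1 *: w.1 + k w.2.2) - w.2.2) @[w --> W] --> z *m D.
    apply/cvgrPdist_le => e' e'0.
    have eta1 : 0 < e' / 2 / (`|z| + 1) by rewrite !divr_gt0// ltr_wpDl.
    have e'2 : 0 < e' / 2 by rewrite divr_gt0.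
    have [d1 d10 sd1] := sd _ oU Up0 Ch eta1.
    have n1 : \forall w \near W, ball p0 d1 (w.2.1 *: w.1 + k w.2.2).
      exact: (x_cvg _ (nbhsx_ballx p0 d1 d10)).
    have n2 : \forall w \near W, ball p0 d1 (k w.2.2).
      exact: (w22_cvg _ (nbhsx_ballx p0 d1 d10)).
    have n3 : \forall w \near W, `|w.1| <= `|z| + 1.
      apply: (W1 (fun z' => `|z'| <= `|z| + 1)).
      have nz := @norm_continuous R E4 z.
      move/cvgrPdist_le: nz => /(_ 1 ltr01); apply: filterS => z' /=.
      by rewrite ler_norml => /andP[]; lra.
    have n4 : \forall w \near W, `|z *m D - w.1 *m D| <= e' / 2.
      apply: (W1 (fun z' => `|z *m D - z' *m D| <= e' / 2)).
      by have /cvgrPdist_le/(_ _ e'2) := @continuous_mulmx R 4 4 D z.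
    have n5 : \forall w \near W, w.2.1 != 0 by exact: (W2 (fun t => t.1 != 0)).
    have n6 : \forall w \near W, V w.2.2 by exact: (W2 (fun t => V t.2) (F3 _ V_near)).
    near=> w.
    have w0 : w.2.1 != 0 by near: w.
    have Vw : V w.2.2 by near: w.
    have b1 : ball p0 d1 (w.2.1 *: w.1 + k w.2.2) by near: w.
    have b2 : ball p0 d1 (k w.2.2) by near: w.
    have := sd1 _ _ b2 b1; rewrite (kh Vw) addrK => h1.
    have h2 : `|w.2.1^-1 *: (h (w.2.1 *: w.1 + k w.2.2) - w.2.2) - w.1 *m D| <= e' / 2.
      rewrite -[w.1 *m D](scalerK w0) scalemxAl -scalerBr normrZ normfV.
      rewrite ler_pdivrMl ?normr_gt0// (le_trans h1)// normrZ mulrCA ler_wpM2l//.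
      have zw : `|w.1| <= `|z| + 1 by near: w.
      by rewrite mulrAC ler_pdivrMr ?ltr_wpDl// ler_wpM2l// ltW.
    have h3 : `|z *m D - w.1 *m D| <= e' / 2 by near: w.
    rewrite (_ : z *m D - _ = (z *m D - w.1 *m D) -
      (w.2.1^-1 *: (h (w.2.1 *: w.1 + k w.2.2) - w.2.2) - w.1 *m D));
      last by rewrite opprB addrA subrK.
    by rewrite (le_trans (ler_normB _ _))// [leRHS]splitr lerD.
  have Psi_cvg : Psi w.2 w.1 @[w --> W] --> Psi0 z.
    have cb := (@Cc_bump R 4).1.
    have g1 : G (w.2.1 *: w.1 + k w.2.2) @[w --> W] --> G p0.
      by move=> A gA; exact: (x_cvg _ (@cG p0 A gA)).
    have g2 : bump (w.2.1^-1 *: (h (w.2.1 *: w.1 + k w.2.2) - w.2.2)) @[w --> W] -->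
        bump (z *m D).
      by move=> A gA; exact: (q_cvg _ (@cb (z *m D) A gA)).
    exact: (cvgM g1 g2).
  have Psi0_cvg : Psi0 w.1 @[w --> W] --> Psi0 z.
    have [c' _] := CcZ (G p0) CPsi0.
    by move=> A gA; exact: (W1 _ (@c' z A gA)).
  move/cvgrPdist_le: Psi_cvg => /(_ _ e2) h1.
  move/cvgrPdist_le: Psi0_cvg => /(_ _ e2) h2.
  apply: filterS2 h1 h2 => -[z' t] /= h1 h2.
  rewrite (_ : _ - _ = (Psi0 z - Psi0 z') - (Psi0 z - Psi t z')); last by ring.
  by rewrite (le_trans (ler_normB _ _))// [leRHS]splitr lerD.
have -> : H (h p0) * I4 bump = I4 Psi0.
  have e1 : I4 Psi0 = G p0 * I4 (fun z => bump (z *m D)) := radonZ rI (G p0) CPsi0.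
  have e2 := I4_linear uD (@Cc_bump R 4).
  rewrite e1 GHp0 -[RHS]mulrA; congr (_ * _).
  exact: (esym e2).
apply: cvg_trans lim; apply: near_eq_cvg.
by apply: filterS PhiE => t ->.
Unshelve. all: by end_near. Qed.

(** The integral of [Phi e] does not depend on [e], yet it converges to [I4 bump * I4 H]. *)
Theorem I4_change_of_variables : I4 G = I4 H.
Proof.
have rI := @radon_I4 R; have pE := @proper_rV R 4; have b0 := @I4_bump R.
have b0' : I4 bump != 0 by exact: lt0r_neq0.
have [M M0 KM] := bounded_compact chK.
have nb0 : \forall e \near (0 : R)^', e != 0 by exact: nbhs_dnbhs_neq.
have nb1 : \forall e \near (0 : R)^', `|e| < 1 by exact: dnbhs0_lt.
have CHb := CcZ (I4 bump) CH.
have lim : I4 (Phi e) @[e --> (0 : R)^'] --> I4 (fun y => I4 bump * H y).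
  apply: (@radon_cvg _ _ _ rI _ _ _ _ _ (M + 1) pE).
  - near=> e; have e0 : e != 0 by near: e.
    have e1 : `|e| < 1 by near: e.
    split.
      have c' : Cc (fun p : E4 * E4 => ker e p.2 p.1).
        apply: (@Cc_comp1 _ _ _ (fun p : E4 * E4 => (p.2, p.1)) _ _ _ (CcK e0)) => [|[x y]].
          have cid := @continuous_idfun (E4 * E4)%type.
          exact: continuous_pair (continuous_snd cid) (continuous_fst cid).
        by rewrite /= !prod_normE maxC.
      have [c _] := CcZ (`|e| ^+ 4)^-1 (Cc_partial pE rI c'); exact: c.
    move=> y yM; rewrite /Phi (_ : (fun x => _) = fun=> 0); last first.
      apply/funext => x; have [Kx|nKx] := pselect (K x); last by rewrite /ker G0// mul0r.
      apply: (ker0 e0); have hx : `|h x| <= M by apply: KM; exists x.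
      have := ler_normD (h x) (- (h x - y)); rewrite normrN opprB addrCA subrr addr0.
      lra.
    by rewrite (radon0 rI) mulr0.
  - by have [] := CHb.
  - move=> y yM; rewrite H0 ?mulr0// => -[x Kx hxy].
    have : `|y| <= M by apply: KM; exists x.
    lra.
  move=> y0 e e0; have [Ky|nKy] := pselect ((h @` K) y0); last first.
    have := Phi_cvg_out nKy; apply: filterS => -[y e'] /= [-> ->].
    by rewrite mulr0 subrr normr0 ltW.
  have [p0 Kp0 py] := Ky; have := Phi_cvg_in Kp0; rewrite py => lim.
  have e2 : 0 < e / 2 by rewrite divr_gt0.
  have [cH _] := CHb; have cHy := @cH y0.
  move/cvgrPdist_le: cHy => /(_ _ e2) h2.
  move/cvgrPdist_le: lim => /(_ _ e2) [[A B] /= [A0 By0] AB].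
  near=> y e'.
  have l1 : `|H y0 * I4 bump - Phi e' y| <= e / 2.
    by apply: (AB (e', y)); split => /=; [near: e'|near: y].
  have l2 : `|I4 bump * H y0 - I4 bump * H y| <= e / 2 by near: y.
  rewrite (_ : _ - _ = (I4 bump * H y0 - I4 bump * H y) - (H y0 * I4 bump - Phi e' y)); last by ring.
  by rewrite (le_trans (ler_normB _ _))// [leRHS]splitr lerD.
have lim' : I4 (Phi e) @[e --> (0 : R)^'] --> I4 G * I4 bump.
  apply: cvg_near_cst; apply: filterS nb0 => e e0.
  exact: (Phi_total e0).
have E : I4 (fun y => I4 bump * H y) = I4 G * I4 bump by exact: (cvg_unique _ lim lim').
apply: (mulIf b0'); rewrite -E (radonZ rI _ CH); exact: mulrC.
Unshelve. all: by end_near. Qed.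

End ChangeVar.

(** * Divergence theorem *)

Section Divergence.
Context {R : realType}.
Local Notation I4 := (@I4 R).
Local Notation E4 := ('rV[R]_4).

Lemma is_derive_line1 n (f : 'rV[R]_n -> R) (a v : 'rV[R]_n) (t : R) :
  differentiable (f : _ -> R^o) (a + t *: v) ->
  is_derive t 1 (fun t : R => f (a + t *: v)) ('d (f : _ -> R^o) (a + t *: v) v).
Proof.
move=> df; apply: is_derive_cvg.
have /cvg_ex[/= l fl] := @diff_derivable _ _ _ (f : _ -> R^o) _ v df.
have lE : l = 'd (f : _ -> R^o) (a + t *: v) v.
  by rewrite -deriveE//; apply/esym; exact: (cvg_lim _ fl).
rewrite -lE; apply: cvg_trans fl; apply: near_eq_cvg; near=> h => /=.
rewrite [h *: 1]mulr1 scalerDl.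
by rewrite (_ : h *: v + (a + t *: v) = a + (h *: v + t *: v)) // addrCA.
Unshelve. all: by end_near. Qed.

Lemma partialE n (U : set 'rV[R]_n) (f : 'rV[R]_n -> R) i x : U x ->
  Ck 1 U (f : _ -> R^o) -> partial i f x = 'd (f : _ -> R^o) x (delta_mx 0 i).
Proof. by move=> Ux [df _]; rewrite /partial deriveE//; exact: df. Qed.

Lemma partial_add n (U : set 'rV[R]_n) (f g : 'rV[R]_n -> R^o) i (x : 'rV[R]_n) :
  U x -> Ck 1 U f -> Ck 1 U g ->
  partial i (fun y => f y + g y) x = partial i f x + partial i g x.
Proof.
move=> Ux [df _] [dg _]; rewrite /partial.
by apply: deriveD; apply: diff_derivable; [exact: df|exact: dg].
Qed.

Lemma partial_opp n (U : set 'rV[R]_n) (f : 'rV[R]_n -> R^o) i (x : 'rV[R]_n) : U x -> Ck 1 U f ->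
  partial i (fun y => - f y) x = - partial i f x.
Proof.
by move=> Ux [df _]; rewrite /partial; apply: deriveN; apply: diff_derivable; exact: df.
Qed.

Lemma partial_mul n (U : set 'rV[R]_n) (f g : 'rV[R]_n -> R^o) i (x : 'rV[R]_n) :
  U x -> Ck 1 U f -> Ck 1 U g ->
  partial i (fun y => (f y : R) * (g y : R)) x = f x * partial i g x + g x * partial i f x.
Proof.
move=> Ux [df _] [dg _]; rewrite /partial.
by apply: deriveM; apply: diff_derivable; [exact: df|exact: dg].
Qed.

Lemma partial_continuous n (U : set 'rV[R]_n) (f : 'rV[R]_n -> R) i x : open U -> U x ->
  Ck 1 U (f : _ -> R^o) -> {for x, continuous (partial i f)}.
Proof.
move=> oU Ux Cf; have [df cf] := Cf.
have Un : \forall y \near x, U y by exact: open_nbhs_nbhs.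
have e : \forall y \near x, 'd (f : _ -> R^o) y (delta_mx 0 i) = partial i f y.
  near=> y; have Uy : U y by near: y.
  by rewrite (partialE i Uy Cf).
have c : 'd (f : _ -> R^o) y (delta_mx 0 i) @[y --> x] --> partial i f x.
  by rewrite (partialE i Ux Cf); exact: cf (delta_mx 0 i) x Ux.
exact: cvg_trans (near_eq_cvg e) c.
Unshelve. all: by end_near. Qed.

Lemma Cc_partial_deriv n (f : 'rV[R]_n -> R) i :
  Ck 1 setT (f : _ -> R^o) -> (exists N, supp_in N f) -> Cc (partial i f).
Proof.
move=> Cf [N sf]; split.
  by move=> x; have := @partial_continuous n setT f i x openT Logic.I Cf.
exists N => x Nx.
have : \near x, f x = cst 0 x.
  have : \forall y \near x, N < `|y|.
    have nx := @norm_continuous R 'rV[R]_n x.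
    by move/cvgr_gt: nx => /(_ N Nx).
  by apply: filterS => y Ny; rewrite sf.
move=> h; rewrite /partial (@near_eq_derive _ _ R^o f (cst 0) _ _ h).
exact: derive_cst.
Qed.

(** Difference quotients have integral 0 by translation invariance; by the mean value theorem and
    continuity of the derivative they converge to [partial i f] locally uniformly, with a common
    support. *)
Lemma I4_partial (f : E4 -> R) i :
  Ck 1 setT (f : _ -> R^o) -> (exists N, supp_in N f) -> I4 (partial i f) = 0.
Proof.
move=> Cf sf'; have CP := Cc_partial_deriv i Cf sf'; have [df _] := Cf.
have [N0 sf0] := sf'; pose N := `|N0|.
have sf : supp_in N f by apply: supp_inW sf0; exact: ler_norm.
have cf : continuous f.
  by move=> x; apply: (@differentiable_continuous _ _ R^o); exact: df.
have CF : Cc f by split => //; exists N.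
have rI := @radon_I4 R; have pE := @proper_rV R 4.
pose v : E4 := delta_mx 0 i.
have nb0 : \forall e \near (0 : R)^', e != 0 by exact: nbhs_dnbhs_neq.
have nb1 : \forall e \near (0 : R)^', `|e| * `|v| < 1.
  have v1 : 0 < `|v| + 1 by rewrite ltr_wpDl.
  have v2 : 0 < (`|v| + 1)^-1 by rewrite invr_gt0.
  have : \forall e \near (0 : R)^', `|e| < (`|v| + 1)^-1 by exact: dnbhs0_lt.
  apply: filterS => e; rewrite -(ltr_pM2r v1) mulVf ?gt_eqF//.
  by apply: le_lt_trans; rewrite ler_wpM2l// lerDl.
pose F (h : R) (x : E4) := h^-1 * (f (x + h *: v) - f x).
have Cfh h : Cc (fun x => f (x + h *: v)).
  by have := Cc_mulmx (h *: v) (unitmx1 R 4) CF; congr Cc; apply/funext => y; rewrite mulmx1.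
have IF h : I4 (F h) = 0.
  rewrite /F (radonZ rI _ (CcB (Cfh h) CF)) (radonB rI (Cfh h) CF).
  by rewrite (I4_translate _ CF) subrr mulr0.
have dvE x : partial i f x = 'd (f : _ -> R^o) x v by exact: (@partialE _ setT f i x Logic.I Cf).
have lim : I4 (F h) @[h --> (0 : R)^'] --> I4 (partial i f).
  apply: (@radon_cvg _ _ _ rI _ _ _ _ _ (N + 1) pE).
  - near=> h; split; first by have [] := CcZ h^-1 (CcB (Cfh h) CF).
    move=> y Ny; have hv : `|h| * `|v| < 1 by near: h.
    have yN : N < `|y| by apply: lt_trans Ny; rewrite ltrDl.
    rewrite /F (sf y yN) sf ?subrr ?mulr0//.
    have := ler_normB (y + h *: v) (h *: v); rewrite addrK normrZ; lra.
  - by have [] := CP.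
  - move=> y Ny; have [_ [N1 sP]] := CP.
    rewrite dvE.
    have : \near y, f y = cst 0 y.
      have yN : N < `|y| by apply: lt_trans Ny; rewrite ltrDl.
      have : \forall z \near y, N < `|z|.
        have nx := @norm_continuous R E4 y.
        by move/cvgr_gt: nx => /(_ N yN).
      by apply: filterS => z Nz; rewrite sf.
    move=> h; rewrite -dvE /partial (@near_eq_derive _ _ R^o f (cst 0) _ _ h).
    exact: derive_cst.
  move=> z e e0; have e2 : 0 < e / 2 by rewrite divr_gt0.
  have [cP _] := CP; have cPz := @cP z.
  move/cvgrPdist_le: cPz => /(_ _ e2) /nbhs_ballP[d /= d0 dP].
  have d2 : 0 < d / 2 by rewrite divr_gt0.
  have nb2 : \forall e \near (0 : R)^', `|e| * `|v| < d / 2.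
    have v1 : 0 < `|v| + 1 by rewrite ltr_wpDl.
    have v2 : 0 < d / 2 / (`|v| + 1) by rewrite divr_gt0.
    have : \forall e \near (0 : R)^', `|e| < d / 2 / (`|v| + 1) by exact: dnbhs0_lt.
    apply: filterS => e'; rewrite ltr_pdivlMr//.
    by apply: le_lt_trans; rewrite ler_wpM2l// lerDl.
  near=> z' h.
  have h0 : h != 0 by near: h.
  have hv : `|h| * `|v| < d / 2 by near: h.
  have zz : ball z (d / 2) z' by near: z'; exact: nbhsx_ballx.
  have dg (t : R) : is_derive t 1 (fun t : R => f (z' + t *: v)) (partial i f (z' + t *: v)).
    by rewrite dvE; apply: is_derive_line1; exact: df.
  have [t] := MVT_global 0 h dg.
  rewrite add0r subr0 scale0r addr0 in_itv /= => /andP[t0 t1] E.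
  rewrite /F E mulrC mulfK//.
  have b1 : ball z d (z' + (t * h) *: v).
    move: zz; rewrite -!ball_normE /= => zz.
    rewrite opprD addrA (le_lt_trans (ler_normB _ _))// [d]splitr ltrD//.
    rewrite normrZ normrM (ger0_norm t0) -mulrA (le_lt_trans _ hv)//.
    by rewrite ler_piMl// mulr_ge0.
  have b2 : ball z d z' by apply: le_ball zz; lra.
  have := dP _ b1; have := dP _ b2 => /= l1 l2.
  rewrite (_ : _ - _ = (partial i f z - partial i f z') -
    (partial i f z - partial i f (z' + (t * h) *: v))); last by ring.
  by rewrite (le_trans (ler_normB _ _))// [leRHS]splitr lerD.
have lim0 : I4 (F h) @[h --> (0 : R)^'] --> (0 : R).
  by apply: cvg_near_cst; apply: nearW => h; exact: IF.
exact: (cvg_unique _ lim lim0).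
Unshelve. all: by end_near. Qed.

End Divergence.

(** * 2-forms in dimension 4 *)

Section Pfaffian.
Context {R : realType}.
Implicit Types (A B D M J w : 'M[R]_4) (u v : 'rV[R]_4).

(* The component (0, 1, 2, 3) of the wedge product of the 2-forms [A] and [B]. *)
Definition pf2 A B : R := A 0 1 * B 2%:R 3%:R - A 0 2%:R * B 1 3%:R + A 0 3%:R * B 1 2%:R
  + A 1 2%:R * B 0 3%:R - A 1 3%:R * B 0 2%:R + A 2%:R 3%:R * B 0 1.

Lemma det_mx44 D : \det D =
  D 0 0 * (D 1 1 * (D 2%:R 2%:R * D 3%:R 3%:R - D 2%:R 3%:R * D 3%:R 2%:R)
         - D 1 2%:R * (D 2%:R 1 * D 3%:R 3%:R - D 2%:R 3%:R * D 3%:R 1)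
         + D 1 3%:R * (D 2%:R 1 * D 3%:R 2%:R - D 2%:R 2%:R * D 3%:R 1))
  - D 0 1 * (D 1 0 * (D 2%:R 2%:R * D 3%:R 3%:R - D 2%:R 3%:R * D 3%:R 2%:R)
         - D 1 2%:R * (D 2%:R 0 * D 3%:R 3%:R - D 2%:R 3%:R * D 3%:R 0)
         + D 1 3%:R * (D 2%:R 0 * D 3%:R 2%:R - D 2%:R 2%:R * D 3%:R 0))
  + D 0 2%:R * (D 1 0 * (D 2%:R 1 * D 3%:R 3%:R - D 2%:R 3%:R * D 3%:R 1)
         - D 1 1 * (D 2%:R 0 * D 3%:R 3%:R - D 2%:R 3%:R * D 3%:R 0)
         + D 1 3%:R * (D 2%:R 0 * D 3%:R 1 - D 2%:R 1 * D 3%:R 0))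
  - D 0 3%:R * (D 1 0 * (D 2%:R 1 * D 3%:R 2%:R - D 2%:R 2%:R * D 3%:R 1)
         - D 1 1 * (D 2%:R 0 * D 3%:R 2%:R - D 2%:R 2%:R * D 3%:R 0)
         + D 1 2%:R * (D 2%:R 0 * D 3%:R 1 - D 2%:R 1 * D 3%:R 0)).
Proof.
(* Reading the entries through natural indices lets the nested ordinals of the Laplace expansion
   compute to numerals, so that [ring] recognizes equal entries. *)
have [d dE] : exists d : nat -> nat -> R, forall i j, D i j = d i j.
  by exists (fun i j => D (inord i) (inord j)) => i j; rewrite !inord_val.
rewrite !(expand_det_row _ ord0) !big_ord_recl !big_ord0 /cofactor.
rewrite !(expand_det_row _ ord0) !big_ord_recl !big_ord0 /cofactor.
rewrite !(expand_det_row _ ord0) !big_ord_recl !big_ord0 /cofactor.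
rewrite !det_mx11 !mxE !dE /= /bump /=.
ring.
Qed.

(** A 4-form on a space of dimension 4 is multiplied by the determinant under pullback; here it is a
    polynomial identity in the entries of [D] and the six independent entries of each form. *)
Lemma pf2_conj D A B : A^T = - A -> B^T = - B ->
  pf2 (D *m A *m D^T) (D *m B *m D^T) = \det D * pf2 A B.
Proof.
move=> aA aB.
have skew (X : 'M[R]_4) i j : X^T = - X -> X j i = - X i j.
  by move=> /matrixP/(_ i j); rewrite !mxE.
have skew0 (X : 'M[R]_4) i : X^T = - X -> X i i = 0.
  by move=> /(skew X i i) /eqP; rewrite -subr_eq0 opprK -mulr2n mulrn_eq0 /= => /eqP.
have conjE (X : 'M[R]_4) i j : X^T = - X -> (D *m X *m D^T) i j =
    (D i 0 * D j 1 - D i 1 * D j 0) * X 0 1 + (D i 0 * D j 2%:R - D i 2%:R * D j 0) * X 0 2%:R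
  + (D i 0 * D j 3%:R - D i 3%:R * D j 0) * X 0 3%:R
  + (D i 1 * D j 2%:R - D i 2%:R * D j 1) * X 1 2%:R
  + (D i 1 * D j 3%:R - D i 3%:R * D j 1) * X 1 3%:R
  + (D i 2%:R * D j 3%:R - D i 3%:R * D j 2%:R) * X 2%:R 3%:R.
  move=> aX; rewrite mxE big4 !mxE !big4.
  rewrite !(skew0 _ _ aX) (skew X 0 1 aX) (skew X 0 2%:R aX) (skew X 0 3%:R aX).
  rewrite (skew X 1 2%:R aX) (skew X 1 3%:R aX) (skew X 2%:R 3%:R aX).
  ring.
rewrite /pf2 !(conjE _ _ _ aA) !(conjE _ _ _ aB) det_mx44.
ring.
Qed.

End Pfaffian.

(** * The Hodge index theorem at a point *)

Section HodgeIndex.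
Context {R : realType}.
Implicit Types (A B D M J w : 'M[R]_4) (u v : 'rV[R]_4).

Let ev M u v : R := (u *m M *m v^T) 0 0.

(** The content of [compatible] at one point, for the matrices of the form and of the complex
    structure. *)
Definition tame J w := (forall u v, ev w u (v *m J) = ev w v (u *m J)) /\
  (forall u, u != 0 -> 0 < ev w u (u *m J)).

Let evDr M u v v' : ev M u (v + v') = ev M u v + ev M u v'.
Proof. by rewrite /ev linearD /= mulmxDr mxE. Qed.

Let evZr M u a v : ev M u (a *: v) = a * ev M u v.
Proof. by rewrite /ev linearZ /= -scalemxAr mxE. Qed.

Let evNr M u v : ev M u (- v) = - ev M u v.
Proof. by rewrite -scaleN1r evZr mulN1r. Qed.

Let ev_mxD A B u v : ev (A + B) u v = ev A u v + ev B u v.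
Proof. by rewrite /ev mulmxDr mulmxDl mxE. Qed.

Let ev_mxB A B u v : ev (A - B) u v = ev A u v - ev B u v.
Proof. by rewrite /ev mulmxBr mulmxBl !mxE. Qed.

Let ev_skew M u v : M^T = - M -> ev M u v = - ev M v u.
Proof.
move=> aM; have : (u *m M *m v^T)^T 0 0 = - ev M v u.
  by rewrite !trmx_mul trmxK aM mulNmx mulmxN mulmxA mxE.
by rewrite mxE.
Qed.

Let evE D M i j : (D *m M *m D^T) i j = ev M (row i D) (row j D).
Proof.
rewrite /ev -row_mul !mxE; apply: eq_bigr => k _.
by rewrite !mxE.
Qed.

(* In a [W]-orthogonal basis [u, u *m J, v, v *m J], the condition [pf2 B W = 0]
   makes the values of [B] on the planes of [u] and of [v] have opposite signs. *)
Lemma hodge_index J w1 w2 : J *m J = - 1%:M -> w1^T = - w1 -> w2^T = - w2 ->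
  tame J w1 -> tame J w2 -> pf2 w1 w1 = pf2 w2 w2 ->
  let B := w2 - w1 in let W := w1 + w2 in
  [/\ pf2 W W != 0, pf2 B B * pf2 W W <= 0 & pf2 B B = 0 -> B = 0].
Proof.
move=> JJ a1 a2 [s1 p1] [s2 p2] eq_pf B W.
have aB : B^T = - B by rewrite /B linearB /= a1 a2 opprB opprK addrC.
have aW : W^T = - W by rewrite /W linearD /= a1 a2 opprD.
have sB u v : ev B u (v *m J) = ev B v (u *m J) by rewrite /B !ev_mxB s1 s2.
have sW u v : ev W u (v *m J) = ev W v (u *m J) by rewrite /W !ev_mxD s1 s2.
have pW u : u != 0 -> 0 < ev W u (u *m J).
  by move=> u0; rewrite /W ev_mxD addr_gt0 ?p1 ?p2.
have uJJ u : u *m J *m J = - u by rewrite -mulmxA JJ mulmxN mulmx1.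
have orth : pf2 B W = 0.
  move: eq_pf; rewrite /pf2 /B /W !mxE => e.
  by apply/eqP; rewrite -subr_eq0 subr0; apply/eqP; move: e; lra.
pose u : 'rV[R]_4 := delta_mx 0 0.
have u0 : u != 0.
  apply/eqP => /matrixP/(_ 0 0); rewrite !mxE !eqxx /= => /eqP.
  by rewrite oner_eq0.
have p0 := pW u u0; set p := ev W u (u *m J) in p0.
have pn0 : p != 0 by rewrite gt_eqF.
have [v0 v0P] : exists v0 : 'rV[R]_4, ~~ (v0 <= col_mx u (u *m J))%MS.
  have : ~~ ((1%:M : 'M[R]_4) <= col_mx u (u *m J))%MS.
    apply/negP => /mxrankS; rewrite mxrank1 leqNgt; apply/negP.
    by rewrite negbK (leq_ltn_trans (rank_leq_row _)).
  by move/row_subPn => [i hi]; exists (row i 1%:M).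
pose al := ev W u (v0 *m J) / p; pose be := ev W u v0 / p.
pose v := v0 - al *: u - be *: (u *m J).
have evWuu : ev W u u = 0.
  have := ev_skew u u aW; move=> /eqP; rewrite -subr_eq0 opprK -mulr2n mulrn_eq0 /=.
  by move/eqP.
have v_n0 : v != 0.
  apply: contraNneq v0P => ve; have -> : v0 = al *: u + be *: (u *m J).
    by apply/eqP; rewrite -subr_eq0 opprD addrA -/v ve.
  by rewrite addmx_sub// scalemx_sub// -addsmxE ?addsmxSl ?addsmxSr.
have Wuv : ev W u v = 0.
  rewrite /v !evDr !evNr !evZr evWuu mulr0 subr0 /be -/p divfK// subrr//.
have WuvJ : ev W u (v *m J) = 0.
  rewrite /v !mulmxBl !evDr !evNr -!scalemxAl !evZr uJJ evNr evWuu oppr0 mulr0 subr0.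
  by rewrite /al -/p divfK// subrr.
have q0 := pW v v_n0; set q := ev W v (v *m J) in q0.
have inv M : (forall u v, ev M u (v *m J) = ev M v (u *m J)) -> M^T = - M ->
    forall x y, ev M (x *m J) (y *m J) = ev M x y /\ ev M (x *m J) y = - ev M x (y *m J).
  move=> sM aM x y; split.
    by rewrite sM uJJ evNr -ev_skew.
  by rewrite (ev_skew _ _ aM) sM.
pose P : 'M[R]_4 := \matrix_(i < 4) nth 0 [:: u; u *m J; v; v *m J] i.
have r0 : row 0 P = u by rewrite rowK.
have r1 : row 1 P = u *m J by rewrite rowK.
have r2 : row 2%:R P = v by rewrite rowK.
have r3 : row 3%:R P = v *m J by rewrite rowK.
(* In this basis [W] is block diagonal with blocks given by [p] and [q]. By J-invariance [B] has
   only four independent entries: [a] and [d] on the two planes, [x] and [y] between them. *)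
have eW : pf2 (P *m W *m P^T) (P *m W *m P^T) = 2 * (p * q).
  have [i1 i2] := inv W sW aW u v.
  rewrite /pf2 !evE r0 r1 r2 r3 i1 i2 Wuv WuvJ -/p -/q; ring.
set a := ev B u (u *m J); set d := ev B v (v *m J).
set x := ev B u v; set y := ev B u (v *m J).
have eBW : pf2 (P *m B *m P^T) (P *m W *m P^T) = a * q + d * p.
  have [i1 i2] := inv W sW aW u v.
  rewrite /pf2 !evE r0 r1 r2 r3 i1 i2 Wuv WuvJ -/p -/q -/a -/d; ring.
have eB : pf2 (P *m B *m P^T) (P *m B *m P^T) = 2 * (a * d - x ^+ 2 - y ^+ 2).
  have [i1 i2] := inv B sB aB u v.
  rewrite /pf2 !evE r0 r1 r2 r3 i1 i2 -/a -/d -/x -/y; ring.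
rewrite (pf2_conj P aW aW) in eW; rewrite (pf2_conj P aB aW) orth mulr0 in eBW.
have pq0 : 0 < p * q by rewrite mulr_gt0.
have dP0 : \det P != 0.
  by apply/eqP => dP; rewrite dP mul0r in eW; move: pq0; lra.
(* Orthogonality of [B] and [W] reads [a * q + d * p = 0] with [p] and [q] positive, so [a] and [d]
   have opposite signs and [B] ^ [B] becomes minus a sum of squares with positive weights. *)
have ad : a * d = - (a ^+ 2 * (q / p)).
  have -> : d = - (a * q / p).
    apply: (mulIf pn0); rewrite mulNr divfK//; lra.
  by field.
have qp0 : 0 < q / p by rewrite divr_gt0.
have eB' : pf2 (P *m B *m P^T) (P *m B *m P^T) = - (2 * (a ^+ 2 * (q / p) + x ^+ 2 + y ^+ 2)).
  by rewrite eB ad; ring.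
have s0 : 0 <= a ^+ 2 * (q / p) + x ^+ 2 + y ^+ 2.
  by rewrite !addr_ge0 ?sqr_ge0// mulr_ge0 ?sqr_ge0// ltW.
have eB2 := eB'; rewrite (pf2_conj P aB aB) in eB2.
split.
- by apply/eqP => W0; rewrite W0 mulr0 in eW; move: pq0; lra.
(* One factor of the determinant goes to each of the two wedge squares; its square is positive
   whatever the orientation of the basis. *)
- have : \det P ^+ 2 * (pf2 B B * pf2 W W) <= 0.
    have -> : \det P ^+ 2 * (pf2 B B * pf2 W W) = (\det P * pf2 B B) * (\det P * pf2 W W) by ring.
    rewrite eB2 eW mulNr oppr_le0; apply: mulr_ge0; first by rewrite mulr_ge0.
    by rewrite mulr_ge0// ltW.
  by rewrite pmulr_rle0// exprn_even_gt0.
move=> B0; rewrite B0 mulr0 in eB2.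
have h : a ^+ 2 * (q / p) + x ^+ 2 + y ^+ 2 = 0 by lra.
have t_ge0 : 0 <= a ^+ 2 * (q / p) by apply: mulr_ge0; [exact: sqr_ge0|exact: ltW].
have x_ge0 := sqr_ge0 x; have y_ge0 := sqr_ge0 y.
have t0 : a ^+ 2 * (q / p) = 0 by lra.
have x0' : x ^+ 2 = 0 by lra.
have y0' : y ^+ 2 = 0 by lra.
have a0 : a = 0.
  by move/eqP: t0; rewrite mulf_eq0 sqrf_eq0 (gt_eqF qp0) orbF => /eqP.
have x0 : x = 0 by apply/eqP; rewrite -sqrf_eq0 x0'.
have y0 : y = 0 by apply/eqP; rewrite -sqrf_eq0 y0'.
have d0 : d = 0.
  by move: eBW; rewrite a0 mul0r add0r => /esym/eqP; rewrite mulf_eq0 (negbTE pn0) orbF => /eqP.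
have PBP : P *m B *m P^T = 0.
  have [i1 i2] := inv B sB aB u v.
  have sk i j : (P *m B *m P^T) j i = - (P *m B *m P^T) i j by rewrite !evE -ev_skew.
  have e01 : (P *m B *m P^T) 0 1 = 0 by rewrite evE r0 r1.
  have e02 : (P *m B *m P^T) 0 2%:R = 0 by rewrite evE r0 r2.
  have e03 : (P *m B *m P^T) 0 3%:R = 0 by rewrite evE r0 r3.
  have e12 : (P *m B *m P^T) 1 2%:R = 0 by rewrite evE r1 r2 i2 -/y y0 oppr0.
  have e13 : (P *m B *m P^T) 1 3%:R = 0 by rewrite evE r1 r3 i1.
  have e23 : (P *m B *m P^T) 2%:R 3%:R = 0 by rewrite evE r2 r3.
  have eii i : (P *m B *m P^T) i i = 0.
    by have := sk i i; move=> /eqP; rewrite -subr_eq0 opprK -mulr2n mulrn_eq0 /= => /eqP.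
  apply/matrixP => i j; rewrite [RHS]mxE.
  by case: (ord4P i) => ->; case: (ord4P j) => ->;
    rewrite ?eii// sk ?e01 ?e02 ?e03 ?e12 ?e13 ?e23 ?oppr0//
      sk ?e01 ?e02 ?e03 ?e12 ?e13 ?e23 ?opprK ?oppr0.
have uP : P \in unitmx by rewrite unitmxE unitfE.
have uPT : P^T \in unitmx by rewrite unitmx_tr.
by rewrite -(mulKmx uP B) -(mulmxK uPT (P *m B)) PBP mul0mx mulmx0.
Qed.

End HodgeIndex.

(** * C^1 functions *)

Section C1Calculus.
Context {R : realType}.
Implicit Types V W : normedModType R.

(** Differentiability and the differential depend only on the germ, by uniqueness of the first-order
    expansion. *)
Lemma is_diff_near V W (f g df : V -> W) x :
  (\forall y \near x, f y = g y) -> is_diff x f df -> is_diff x g df.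
Proof.
move=> fg [dif <-].
have fx : f x = g x by exact: nbhs_singleton fg.
have [cdf Ef] := (diff_locallyP x f).1 dif.
have Eg : g \o shift x = cst (g x) + 'd f x +o_ (0 : V) id.
  apply/eqaddoP => e e0; have /eqaddoP/(_ e e0) h1 := Ef.
  have h2 : \forall y \near (0 : V), f (y + x) = g (y + x).
    have sx : (y + x) @[y --> (0 : V)] --> x.
      rewrite -[X in _ --> X]add0r.
      exact: (continuous_addr (@continuous_idfun _) (@cst_continuous _ _ x)).
    exact: (sx _ fg).
  by apply: filterS2 h1 h2 => y; rewrite !fctE /= -fx => + <-.
have dE := diff_unique cdf Eg.
by apply: DiffDef; [apply/diff_locallyP; rewrite dE|].
Qed.

Lemma Ck1_intro V W (U : set V) (f : V -> W) (df : V -> V -> W) : open U ->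
  (forall x, U x -> is_diff x f (df x)) ->
  (forall v x, U x -> {for x, continuous (fun y => df y v)}) -> Ck 1 U f.
Proof.
move=> oU dif cdf; split => [x Ux|v x Ux]; first by have [] := dif x Ux.
have Un : \forall y \near x, U y by exact: open_nbhs_nbhs.
have e : \forall y \near x, df y v = 'd f y v.
  near=> y; have Uy : U y by near: y.
  by have [_ ->] := dif y Uy.
have c : df y v @[y --> x] --> 'd f x v.
  by have [_ ->] := dif x Ux; exact: cdf.
exact: cvg_trans (near_eq_cvg e) c.
Unshelve. all: by end_near. Qed.

Lemma Ck1_is_diff V W (U : set V) (f : V -> W) x : Ck 1 U f -> U x -> is_diff x f ('d f x).
Proof. by move=> [df _] Ux; apply: differentiableP; exact: df. Qed.

Lemma Ck1_diff_continuous V W (U : set V) (f : V -> W) v x : Ck 1 U f -> U x ->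
  {for x, continuous (fun y => 'd f y v)}.
Proof. by move=> [_ cf]; exact: cf. Qed.

Arguments Ck1_diff_continuous {V W U f} v {x}.

Lemma Ck1_continuous V W (U : set V) (f : V -> W) x : Ck 1 U f -> U x ->
  {for x, continuous f}.
Proof. by move=> [df _] Ux; apply: differentiable_continuous; exact: df. Qed.

(** C^1 regularity is local; this serves for functions defined piecewise, by a formula on one open
    set and by 0 on another. *)
Lemma Ck1_local V W (U : set V) (f : V -> W) :
  (forall x, U x -> exists U' g, [/\ open U', U' x, Ck 1 U' g & forall y, U' y -> f y = g y]) ->
  Ck 1 U f.
Proof.
move=> loc.
have dif x : U x -> exists U' g, [/\ open U', U' x, Ck 1 U' g &
    forall y, U' y -> is_diff y f ('d g y)].
  move=> /loc[U' [g [oU' U'x Cg fg]]]; exists U', g; split => // y U'y.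
  have gf : \forall z \near y, g z = f z.
    have Un : \forall z \near y, U' z by exact: open_nbhs_nbhs.
    by apply: filterS Un => z U'z; rewrite fg.
  exact: is_diff_near gf (Ck1_is_diff Cg U'y).
split => [x|v x] /dif[U' [g [oU' U'x Cg fg]]]; first by have [] := fg x U'x.
have Un : \forall y \near x, U' y by exact: open_nbhs_nbhs.
have e : \forall y \near x, 'd g y v = 'd f y v.
  near=> y; have Uy : U' y by near: y.
  by have [_ ->] := fg y Uy.
have c : 'd g y v @[y --> x] --> 'd f x v.
  have h := Ck1_diff_continuous v Cg U'x.
  by have [_ ->] := fg x U'x; exact: h.
exact: cvg_trans (near_eq_cvg e) c.
Unshelve. all: by end_near. Qed.

Lemma Ck1_cst V W (U : set V) (a : W) : open U -> Ck 1 U (cst a).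
Proof.
move=> oU; apply: (@Ck1_intro _ _ U (cst a) (fun _ => 0) oU).
by move=> v x _; exact: (@cst_continuous V W 0 x).
Qed.

Lemma Ck1_add V (U : set V) (f g : V -> R^o) : open U ->
  Ck 1 U f -> Ck 1 U g -> Ck 1 U (fun x => f x + g x).
Proof.
move=> oU Cf Cg.
apply: (@Ck1_intro V R^o U (fun x => f x + g x) (fun x v => 'd f x v + 'd g x v) oU).
  move=> x Ux; exact: (is_diffD (Ck1_is_diff Cf Ux) (Ck1_is_diff Cg Ux)).
move=> v x Ux.
exact: (cvgD (Ck1_diff_continuous v Cf Ux) (Ck1_diff_continuous v Cg Ux)).
Qed.

Lemma Ck1_mul V (U : set V) (f g : V -> R^o) : open U ->
  Ck 1 U f -> Ck 1 U g -> Ck 1 U ((fun x => (f x : R) * (g x : R)) : V -> R^o).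
Proof.
move=> oU Cf Cg.
apply: (@Ck1_intro V R^o U _ (fun x v => f x *: 'd g x v + g x *: 'd f x v) oU).
  move=> x Ux; exact: (is_diffM (Ck1_is_diff Cf Ux) (Ck1_is_diff Cg Ux)).
move=> v x Ux.
exact: (cvgD (cvgM (Ck1_continuous Cf Ux) (Ck1_diff_continuous v Cg Ux))
  (cvgM (Ck1_continuous Cg Ux) (Ck1_diff_continuous v Cf Ux))).
Qed.

Lemma Ck1_sum V (J : Type) (r : seq J) (U : set V) (f : J -> V -> R^o) : open U ->
  (forall j, Ck 1 U (f j)) -> Ck 1 U (fun x => \sum_(j <- r) f j x).
Proof.
move=> oU Cf; elim: r => [|j r IH].
  have := @Ck1_cst V R^o U 0 oU; congr (Ck 1 U _); apply/funext => x.
  by rewrite big_nil.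
have := Ck1_add oU (Cf j) IH; congr (Ck 1 U _); apply/funext => x.
by rewrite big_cons.
Qed.

Lemma Ck1_inv V (U : set V) (f : V -> R^o) : open U -> (forall x, U x -> (f x : R) != 0) ->
  Ck 1 U f -> Ck 1 U ((fun x => (f x : R)^-1) : V -> R^o).
Proof.
move=> oU f0 Cf.
have H := @Ck1_intro V R^o U (fun x => (f x : R)^-1) (fun x v => - (f x : R) ^- 2 *: 'd f x v) oU.
apply: H => [x Ux|v x Ux].
  have [df _] := Cf; apply: DiffDef; first exact: (differentiableV (df x Ux) (f0 x Ux)).
  by rewrite (diffV (df x Ux) (f0 x Ux)).
have c2 : {for x, continuous (fun y => (f y : R) ^+ 2)}.
  exact: (cvgM (Ck1_continuous Cf Ux) (Ck1_continuous Cf Ux)).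
have n2 : (f x : R) ^+ 2 != 0 by rewrite expf_neq0// f0.
exact: (cvgM (cvgN (cvgV n2 c2)) (Ck1_diff_continuous v Cf Ux)).
Qed.

End C1Calculus.

Arguments Ck1_diff_continuous {R V W U f} v {x}.

(** * Composition, and cutoff functions of class C^1 *)

Section C1Comp.
Context {R : realType}.
Implicit Types V : normedModType R.

Lemma is_diff_entry n m (M : 'M[R]_(n, m)) i j :
  is_diff M (fun N : 'M[R]_(n, m) => N i j : R^o) (fun N => N i j).
Proof.
have lin : linear (fun N : 'M[R]_(n, m) => N i j : R^o) by move=> a A B; rewrite !mxE.
pose fM := GRing.isLinear.Build _ _ _ _ _ lin.
pose fL : {linear 'M[R]_(n, m) -> R^o} := HB.pack (fun N : 'M[R]_(n, m) => N i j : R^o) fM.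
have cf : continuous fL by exact: (@coord_continuous R n m i j).
apply: DiffDef; first exact: (@linear_differentiable _ _ _ fL M cf).
exact: (@diff_lin _ _ _ fL M cf).
Qed.

Lemma Ck1_entry V n m (U : set V) (F : V -> 'M[R]_(n, m)) i j : open U ->
  Ck 1 U F -> Ck 1 U (fun x => F x i j : R^o).
Proof.
move=> oU CF.
have H := @Ck1_intro R V R^o U (fun x => F x i j) (fun x v => ('d F x v) i j) oU.
apply: H => [x Ux|v x Ux].
  exact: (is_diff_comp (Ck1_is_diff CF Ux) (is_diff_entry (F x) i j)).
have h : ('d F y v) i j @[y --> x] --> ('d F x v) i j.
  exact: (cvg_comp _ _ (Ck1_diff_continuous v CF Ux) (@coord_continuous R n m i j ('d F x v))).
exact: h.
Qed.

Lemma diff_row_sum n (g : 'rV[R]_n -> R^o) x v :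
  'd g x v = \sum_k v 0 k * ('d g x (delta_mx 0 k) : R).
Proof.
rewrite {1}(row_sum_delta v) linear_sum; apply: eq_bigr => k _.
by rewrite linearZ.
Qed.

(** [Ck] gives continuity of the differential of [g] only on fixed vectors, while here the vector
    ['d h y v] moves with [y]. Expanding it in the standard basis reduces to fixed vectors. *)
Lemma Ck1_comp V n (U : set V) (U' : set 'rV[R]_n) (h : V -> 'rV[R]_n) (g : 'rV[R]_n -> R^o) :
  open U -> (forall x, U x -> U' (h x)) -> Ck 1 U h -> Ck 1 U' g -> Ck 1 U (g \o h : V -> R^o).
Proof.
move=> oU UU' Ch Cg.
have H := @Ck1_intro R V R^o U (g \o h) (fun x v => 'd g (h x) ('d h x v)) oU.
apply: H => [x Ux|v x Ux].
  exact: (is_diff_comp (Ck1_is_diff Ch Ux) (Ck1_is_diff Cg (UU' _ Ux))).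
rewrite (_ : (fun y => 'd g (h y) ('d h y v)) =
  (fun y => \sum_k ('d h y v) 0 k * ('d g (h y) (delta_mx 0 k) : R))); last first.
  by apply/funext => y; rewrite diff_row_sum.
apply: (@cvg_sumr R _ (nbhs x) _ _ _ (fun k y => ('d h y v) 0 k * ('d g (h y) (delta_mx 0 k) : R))
  (fun k => ('d h x v) 0 k * ('d g (h x) (delta_mx 0 k) : R))) => k.
have c1 := continuous_comp (Ck1_diff_continuous v Ch Ux) (@coord_cont R n k _).
have c2 := continuous_comp (Ck1_continuous Ch Ux) (Ck1_diff_continuous (delta_mx 0 k) Cg (UU' _ Ux)).
exact: (cvgM c1 c2).
Qed.

(** The square of the positive part: of class C^1 with derivative [2 * Num.max 0 s], and positive
    exactly for positive [s]. *)
Definition theta (s : R) : R := Num.max 0 s ^+ 2.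

Lemma theta_ge0 s : 0 <= theta s. Proof. exact: sqr_ge0. Qed.

Lemma theta_gt0 s : (0 < theta s) = (0 < s).
Proof.
rewrite lt_neqAle theta_ge0 andbT eq_sym sqrf_eq0.
have [s0|s0] := ltP 0 s; last by rewrite eqxx.
by rewrite gt_eqF.
Qed.

Lemma is_diff_theta (s : R) :
  is_diff (s : R^o) (theta : R^o -> R^o) (fun v => 2 * Num.max 0 s * v).
Proof.
(* A quadratic remainder valid for all signs of [s] and [h + s]; divided by [h] it tends to 0. *)
have bound (h : R) : `|theta (h + s) - theta s - 2 * Num.max 0 s * h| <= h ^+ 2.
  rewrite /theta ler_norml; apply/andP.
  by case: (lerP 0 (h + s)) => h1; case: (lerP 0 s) => h2; split; nra.
have dth : is_derive (s : R^o) (1 : R^o) (theta : R^o -> R^o) (2 * Num.max 0 s).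
  apply: is_derive_cvg; apply/cvgrPdist_le => e e0.
  have nb : \forall h \near (0 : R)^', `|h| <= e by exact: dnbhs0_le.
  have nb0 : \forall h \near (0 : R)^', h != 0 by exact: nbhs_dnbhs_neq.
  near=> h; have h0 : h != 0 by near: h.
  have he : `|h| <= e by near: h.
  apply: le_trans he; rewrite distrC [h *: 1]mulr1 -(ler_pM2l (_ : 0 < `|h|)) ?normr_gt0//.
  rewrite -!normrM -expr2 (ger0_norm (sqr_ge0 h)).
  apply: le_trans (bound h); rewrite mulrBr [h * (h^-1 *: _)]mulrA divff// mul1r.
  by rewrite [h * _]mulrC.
have [dv vE] := dth.
apply: DiffDef; first by apply/derivable1_diffP.
apply/funext => v.
have df : differentiable (theta : R^o -> R^o) s by apply/derivable1_diffP.
rewrite (diff1E df) derive1E vE.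
exact: mulrC.
Unshelve. all: by end_near. Qed.

Lemma Ck1_theta V (U : set V) (f : V -> R^o) : open U -> Ck 1 U f ->
  Ck 1 U (fun x => theta (f x) : R^o).
Proof.
move=> oU Cf.
have H := @Ck1_intro R V R^o U (fun x => theta (f x)) (fun x v => 2 * Num.max 0 (f x : R) * ('d f x v : R)) oU.
apply: H => [x Ux|v x Ux].
  exact: (is_diff_comp (Ck1_is_diff Cf Ux) (is_diff_theta (f x))).
have h : continuous (fun s : R => 2 * Num.max 0 s).
  apply: continuous_mulr; first exact: cst_continuous.
  apply: (@max_fun_continuous _ _ R (fun=> 0) (fun s : R => s)).
    exact: cst_continuous.
  exact: continuous_idfun.
exact: (cvgM (continuous_comp (Ck1_continuous Cf Ux) (h (f x))) (Ck1_diff_continuous v Cf Ux)).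
Qed.

(** Balls of row vectors are cubes, as the norm is the sup norm. That norm is not differentiable, so
    the bump on a cube is a product over the coordinates. *)
Definition box_bump n (x0 : 'rV[R]_n) (r : R) (x : 'rV[R]_n) : R :=
  \prod_i theta (r ^+ 2 - (x 0 i - x0 0 i) ^+ 2).

Lemma box_bump_ge0 n (x0 : 'rV[R]_n) r x : 0 <= box_bump x0 r x.
Proof. by apply: prodr_ge0 => i _; exact: theta_ge0. Qed.

Lemma box_bump_gt0 n (x0 : 'rV[R]_n) r x : ball x0 r x -> 0 < box_bump x0 r x.
Proof.
rewrite -ball_normE /= => x0x; have r0 : 0 < r by rewrite (le_lt_trans _ x0x).
apply: prodr_gt0 => i _; rewrite theta_gt0 subr_gt0 -real_normK ?num_real//.
rewrite ltr_pXn2r ?nnegrE ?(ltW r0)// distrC.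
by apply: le_lt_trans x0x; have := coord_le_norm (x0 - x) i; rewrite !mxE.
Qed.

Lemma box_bump_eq0 n (x0 : 'rV[R]_n) r x : 0 < r -> r <= `|x - x0| -> box_bump x0 r x = 0.
Proof.
move=> r0 rx; have [i ri] : exists i, r <= `|x 0 i - x0 0 i|.
  apply: contrapT => /forallNP ne; move: rx; apply/negP; rewrite -ltNge.
  rewrite /Num.norm /= mx_normrE; apply/bigmax_ltP; split => // -[k i] _ /=.
  by rewrite ord1 !mxE ltNge; apply/negP; exact: ne.
apply/eqP; rewrite prodf_seq_eq0; apply/hasP; exists i; first by rewrite mem_index_enum.
rewrite /= eq_le theta_ge0 andbT leNgt theta_gt0 subr_gt0 -leNgt.
by rewrite -[leRHS]real_normK ?num_real// ler_pXn2r ?nnegrE// ltW.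
Qed.

Lemma Ck1_box_bump n (x0 : 'rV[R]_n) r : Ck 1 setT (box_bump x0 r : _ -> R^o).
Proof.
have oT : open [set: 'rV[R]_n] by exact: openT.
have Cid : Ck 1 setT (fun x : 'rV[R]_n => x).
  have H := @Ck1_intro R _ _ setT (fun x : 'rV[R]_n => x) (fun _ v => v) oT.
  apply: H => v x _.
  exact: (@cst_continuous _ _ v x).
have C1 i : Ck 1 setT (fun x : 'rV[R]_n => theta (r ^+ 2 + -1 * ((x 0 i - x0 0 i) * (x 0 i - x0 0 i))) : R^o).
  have Cd : Ck 1 setT (fun x : 'rV[R]_n => x 0 i - x0 0 i : R^o).
    exact: (Ck1_add oT (Ck1_entry 0 i oT Cid) (@Ck1_cst R _ R^o setT (- x0 0 i) oT)).
  apply: (Ck1_theta oT); apply: (Ck1_add oT (@Ck1_cst R _ R^o setT (r ^+ 2) oT)).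
  exact: (Ck1_mul oT (@Ck1_cst R _ R^o setT (-1) oT) (Ck1_mul oT Cd Cd)).
have E : (box_bump x0 r : _ -> R^o) =
    (fun x : 'rV[R]_n => \prod_i theta (r ^+ 2 + -1 * ((x 0 i - x0 0 i) * (x 0 i - x0 0 i)))).
  by apply/funext => x; apply: eq_bigr => i _; rewrite mulN1r expr2.
rewrite E; elim: (index_enum _) => [|i l IH].
  have := @Ck1_cst R _ R^o setT 1 oT; congr (Ck 1 _ _); apply/funext => x.
  by rewrite big_nil.
have := Ck1_mul oT (C1 i) IH; congr (Ck 1 _ _); apply/funext => x.
by rewrite big_cons.
Qed.

End C1Comp.

(** * Charts *)

Opaque jacobian.

Section Charts.
Context {R : realType} {n : nat} {M : manifold R n}.
Implicit Types (c : chart M) (x y : 'rV[R]_n).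

Lemma open_chart_img c : open (chart_img c).
Proof. exact: chart_img_open. Qed.

Lemma chart_img_inv c x : chart_img c x ->
  chart_dom c (chart_inv c x) /\ chart_map c (chart_inv c x) = x.
Proof. by move=> [p cp <-]; rewrite chart_mapK. Qed.

Lemma chart_img_map c (p : M) : chart_dom c p -> chart_img c (chart_map c p).
Proof. by move=> cp; exists p. Qed.

Lemma chart_inv_preimage_open c (A : set M) : open A ->
  open [set x | chart_img c x /\ A (chart_inv c x)].
Proof.
move=> oA; rewrite openE => x [cx Ax].
have n1 : \forall y \near x, chart_img c y.
  by apply: open_nbhs_nbhs; split => //; exact: chart_img_open.
have n2 : \forall y \near x, A (chart_inv c y).
  by apply: (chart_inv_continuous cx); exact: open_nbhs_nbhs.
exact: filterI n1 n2.
Qed.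

Lemma overlapE c c' x : overlap c c' x <-> chart_img c x /\ chart_dom c' (chart_inv c x).
Proof.
split=> [[p [cp c'p] <-]|[[p cp <-]]]; first by rewrite chart_mapK//; split => //; exists p.
by rewrite chart_mapK// => c'p; exists p.
Qed.

Lemma overlap_open c c' : open (overlap c c').
Proof.
rewrite (_ : overlap c c' = [set x | chart_img c x /\ chart_dom c' (chart_inv c x)]).
  by apply: chart_inv_preimage_open; exact: chart_dom_open.
by apply/seteqP; split => x /overlapE.
Qed.

Lemma overlap_transition c c' x : overlap c c' x ->
  [/\ overlap c' c (transition c c' x), transition c' c (transition c c' x) = x &
   chart_inv c' (transition c c' x) = chart_inv c x].
Proof.
move=> [p [cp c'p] <-]; rewrite /transition /= chart_mapK// !chart_mapK//; split => //.
by exists p.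
Qed.

Lemma transition_Ck1 c c' : Ck 1 (overlap c c') (transition c c').
Proof. exact: (@chart_transition_smooth _ _ M c c' 1). Qed.

(** Chain rule for the two inverse transitions, whose composite is the identity near [x]; the order
    of the factors is that of maps acting on rows. *)
Lemma jacobian_transition c c' x : overlap c c' x ->
  'J (transition c c') x *m 'J (transition c' c) (transition c c' x) = 1%:M.
Proof.
move=> ox; have [ox' _ _] := overlap_transition ox.
have d1 := Ck1_is_diff (transition_Ck1 c c') ox.
have d2 := Ck1_is_diff (transition_Ck1 c' c) ox'.
have d12 := is_diff_comp d1 d2.
have near_id : \forall y \near x, (transition c' c \o transition c c') y = id y.
  have : \forall y \near x, overlap c c' y.
    by apply: open_nbhs_nbhs; split => //; exact: overlap_open.
  by apply: filterS => y /overlap_transition[].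
have [_ e1] := is_diff_near near_id d12.
have [_ e2] := is_diff_id x.
have e (v : 'rV[R]_n) : 'd (transition c' c) (transition c c' x) ('d (transition c c') x v) = v.
  by have := congr1 (fun f => f v) (etrans (esym e2) e1).
have {}e (v : 'rV[R]_n) :
    v *m ('J (transition c c') x *m 'J (transition c' c) (transition c c' x)) = v.
  rewrite mulmxA -[RHS]e (diff_mul (transition c' c)); congr (_ *m _).
  by rewrite diff_mul.
by apply/row_matrixP => i; rewrite rowE e rowE mulmx1.
Qed.

Lemma jacobian_transition_unit c c' x : overlap c c' x -> 'J (transition c c') x \in unitmx.
Proof. move=> ox; exact: (mulmx1_unit (jacobian_transition ox)).1. Qed.

Definition C1_fun (f : M -> R) := forall c, Ck 1 (chart_img c) (f \o chart_inv c : _ -> R^o).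

Definition grad (f : M -> R) c x : 'cV[R]_n := \col_k partial k (f \o chart_inv c) x.

(** The chain rule, in the form that makes df obey the transformation law of [form1]. The two
    coordinate expressions of [f] agree only near [x]. *)
Lemma grad_transform f c c' x : C1_fun f -> overlap c c' x ->
  grad f c x = 'J (transition c c') x *m grad f c' (transition c c' x).
Proof.
move=> Cf ox; have [ox' _ _] := overlap_transition ox.
have cx : chart_img c x by have [] := (overlapE c c' x).1 ox.
have cx' : chart_img c' (transition c c' x) by have [] := (overlapE _ _ _).1 ox'.
have d1 := Ck1_is_diff (transition_Ck1 c c') ox.
have d2 := Ck1_is_diff (Cf c') cx'.
have d12 := is_diff_comp d1 d2.
have nearE : \forall y \near x, (((f \o chart_inv c') : _ -> R^o) \o transition c c') y =
    (f \o chart_inv c : _ -> R^o) y.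
  have : \forall y \near x, overlap c c' y.
    by apply: open_nbhs_nbhs; split => //; exact: overlap_open.
  by apply: filterS => y /overlap_transition[_ _ /= ->].
have [_ e1] := is_diff_near nearE d12.
apply/matrixP => k j; rewrite ord1 !mxE (partialE _ cx (Cf c)) e1 /=.
rewrite diff_row_sum; apply: eq_bigr => l _; rewrite !mxE.
by rewrite (partialE _ cx' (Cf c')).
Qed.

Lemma C1_fun_mul f g : C1_fun f -> C1_fun g -> C1_fun (fun p => f p * g p).
Proof. by move=> Cf Cg c; have h := Ck1_mul (@open_chart_img c) (Cf c) (Cg c); exact: h. Qed.

Lemma C1_fun_inv f : (forall p, f p != 0) -> C1_fun f -> C1_fun (fun p => (f p)^-1).
Proof.
move=> f0 Cf c; have h := Ck1_inv (@open_chart_img c) (fun x _ => f0 (chart_inv c x)) (Cf c).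
exact: h.
Qed.

Lemma C1_fun_sum (J : Type) (r : seq J) (f : J -> M -> R) :
  (forall j, C1_fun (f j)) -> C1_fun (fun p => \sum_(j <- r) f j p).
Proof. by move=> Cf c; have h := Ck1_sum r (@open_chart_img c) (fun j => Cf j c); exact: h. Qed.

Lemma C1_fun_continuous f c x : C1_fun f -> chart_img c x ->
  {for x, continuous (f \o chart_inv c)}.
Proof. by move=> Cf cx; exact: (Ck1_continuous (Cf c) cx). Qed.

Definition box c (x0 : 'rV[R]_n) (r : R) : set M := chart_inv c @` [set x | `|x - x0| <= r].

Lemma compact_cube (x0 : 'rV[R]_n) (r : R) : compact [set x : 'rV[R]_n | `|x - x0| <= r].
Proof.
apply: bounded_closed_compact.
  exists (r + `|x0|); split; first exact: num_real.
  move=> N rN x /= xr; have := ler_normD (x - x0) x0; rewrite subrK => /le_trans; apply.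
  by rewrite ltW// (le_lt_trans _ rN)// lerD2r.
have cc : continuous (fun x : 'rV[R]_n => `|x - x0|).
  apply: (continuous_compr _ (@norm_continuous R 'rV[R]_n)).
  exact: (continuous_subr (@continuous_idfun _) (@cst_continuous _ _ x0)).
by apply: (preimage_closed _ (@closed_le R r)) => x _; exact: cc.
Qed.

Section Bump.
Variables (c : chart M) (x0 : 'rV[R]_n) (r : R).
Hypotheses (r0 : 0 < r) (cube : [set x | `|x - x0| <= r] `<=` chart_img c).

Lemma compact_box : compact (box c x0 r).
Proof.
apply: continuous_compact; last exact: compact_cube.
apply: continuous_in_subspaceT => x; rewrite inE => /cube cx.
exact: chart_inv_continuous.
Qed.

Lemma closed_box : closed (box c x0 r).
Proof. by apply: compact_closed compact_box; exact: manifold_hausdorff. Qed.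

(** Extended by 0, because [chart_map c] carries no information outside the domain of [c]. *)
Definition chart_bump (q : M) : R :=
  if `[< chart_dom c q >] then box_bump x0 r (chart_map c q) else 0.

Lemma chart_bump_ge0 q : 0 <= chart_bump q.
Proof. by rewrite /chart_bump; case: asboolP => // _; exact: box_bump_ge0. Qed.

Lemma chart_bump_out q : ~ box c x0 r q -> chart_bump q = 0.
Proof.
rewrite /chart_bump; case: asboolP => // cq nb; apply: box_bump_eq0 => //.
rewrite leNgt; apply/negP => h; apply: nb; exists (chart_map c q); first exact: ltW.
exact: chart_mapK.
Qed.

(** In another chart the bump is a composite with a transition map on the overlap and 0 off the box.
    Both sets are open and cover the chart: the box is compact, hence closed since [M] is
    Hausdorff. *)
Lemma C1_chart_bump : C1_fun chart_bump.
Proof.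
move=> c'; apply: Ck1_local => y c'y.
have [cq|ncq] := pselect (chart_dom c (chart_inv c' y)).
  have oy : overlap c' c y by apply/overlapE.
  exists (overlap c' c), (box_bump x0 r \o transition c' c); split => //.
  - exact: overlap_open.
  - exact: (Ck1_comp (@overlap_open c' c) (fun _ _ => Logic.I) (transition_Ck1 c' c)
      (Ck1_box_bump x0 r)).
  - by move=> z /overlapE[_ cz]; rewrite /= /chart_bump asboolT.
exists [set z | chart_img c' z /\ (~` box c x0 r) (chart_inv c' z)], (cst 0); split => //.
- by apply: chart_inv_preimage_open; exact: closed_openC closed_box.
- split => // -[x xr xy]; apply: ncq; rewrite -xy.
  by have [] := chart_img_inv (cube xr).
- apply: (@Ck1_cst R _ R^o _ 0).
  by apply: chart_inv_preimage_open; exact: closed_openC closed_box.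
- by move=> z [_ /= nz]; rewrite chart_bump_out.
Qed.

End Bump.

Lemma grad_out f (K : set M) c x : closed K -> (forall p, ~ K p -> f p = 0) ->
  chart_img c x -> ~ K (chart_inv c x) -> grad f c x = 0.
Proof.
move=> cK f0 cx nK; apply/matrixP => k j; rewrite !mxE.
have : \forall y \near x, (f \o chart_inv c) y = cst 0 y.
  have oU : open [set z | chart_img c z /\ (~` K) (chart_inv c z)].
    by apply: chart_inv_preimage_open; exact: closed_openC.
  have : \forall z \near x, chart_img c z /\ (~` K) (chart_inv c z).
    by apply: open_nbhs_nbhs; split.
  by apply: filterS => z [_ nz]; rewrite /= f0.
move=> h; rewrite /partial (@near_eq_derive _ _ R^o (f \o chart_inv c) (cst 0) _ _ h).
exact: derive_cst.
Qed.

End Charts.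

(** * Stokes formula in a chart *)

Section Stokes.
Context {R : realType} {M : manifold R 4}.
Local Notation I4 := (@I4 R).
Implicit Types (c : chart M) (x y : 'rV[R]_4).

Lemma chart_image_compact c (K : set M) : compact K -> K `<=` chart_dom c ->
  compact (chart_map c @` K).
Proof.
move=> cK Kc; apply: continuous_compact => //; apply: continuous_in_subspaceT => p.
by rewrite inE => /Kc; exact: chart_map_continuous.
Qed.

Lemma chart_imageP c (K : set M) x : K `<=` chart_dom c ->
  (chart_map c @` K) x <-> chart_img c x /\ K (chart_inv c x).
Proof.
move=> Kc; split=> [[p Kp <-]|[cx Kx]].
  by rewrite chart_mapK//; [split => //; exact: chart_img_map (Kc _ Kp)|exact: Kc].
by exists (chart_inv c x) => //; have [] := chart_img_inv cx.
Qed.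

(** Components are continuous only on the image of the chart. Vanishing off a compact subset of that
    image makes them continuous on all of R^4. *)
Lemma Cc_chart c (F : 'rV[R]_4 -> R) (K : set M) : compact K -> K `<=` chart_dom c ->
  (forall x, chart_img c x -> {for x, continuous F}) ->
  (forall x, ~ (chart_img c x /\ K (chart_inv c x)) -> F x = 0) -> Cc F.
Proof.
move=> cK Kc cF F0; have cS := chart_image_compact cK Kc.
have clS : closed (chart_map c @` K) by apply: compact_closed cS; exact: norm_hausdorff.
split.
  move=> x; have [cx|ncx] := pselect (chart_img c x); first exact: cF.
  have oS : open (~` (chart_map c @` K)) by exact: closed_openC.
  have nS : (~` (chart_map c @` K)) x by move=> /(chart_imageP _ Kc)[].
  have : \forall y \near x, cst 0 y = F y.
    have := open_nbhs_nbhs (conj oS nS).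
    by apply: filterS => y nSy; rewrite F0// => /(chart_imageP _ Kc).
  move=> /near_eq_cvg h; rewrite /continuous_at (F0 x); last by case.
  by apply: cvg_trans h _; exact: cvg_cst.
have /compact_bounded[N [_ NS]] := cS.
exists (`|N| + 1) => x Nx; apply: F0 => /(chart_imageP _ Kc) Sx.
move: Nx; apply/negP; rewrite -leNgt; apply: (NS _ _ x Sx).
by rewrite (le_lt_trans (ler_norm _))// ltrDl.
Qed.

(** The matrix of the wedge product of two 1-forms. *)
Definition wdg (g a : 'cV[R]_4) : 'M[R]_4 := g *m a^T - a *m g^T.

Lemma wdgE g a i j : wdg g a i j = g i 0 * a j 0 - a i 0 * g j 0.
Proof. by rewrite !mxE !big_ord1 !mxE. Qed.

Lemma wdg_skew g a : (wdg g a)^T = - wdg g a.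
Proof. by apply/matrixP => i j; rewrite mxE [RHS]mxE !wdgE; ring. Qed.

Lemma wdg_mul D g a : wdg (D *m g) (D *m a) = D *m wdg g a *m D^T.
Proof. by rewrite /wdg mulmxBr mulmxBl !trmx_mul !mulmxA. Qed.

Lemma continuous_at_add (T : topologicalType) (f g : T -> R) (x : T) :
  {for x, continuous f} -> {for x, continuous g} -> {for x, continuous (fun t => f t + g t)}.
Proof. by move=> cf cg; apply: cvgD; [exact: cf|exact: cg]. Qed.

Lemma continuous_at_sub (T : topologicalType) (f g : T -> R) (x : T) :
  {for x, continuous f} -> {for x, continuous g} -> {for x, continuous (fun t => f t - g t)}.
Proof. by move=> cf cg; apply: cvgB; [exact: cf|exact: cg]. Qed.

Lemma continuous_at_mul (T : topologicalType) (f g : T -> R) (x : T) :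
  {for x, continuous f} -> {for x, continuous g} -> {for x, continuous (fun t => f t * g t)}.
Proof. by move=> cf cg; apply: cvgM; [exact: cf|exact: cg]. Qed.

Lemma pf2_continuous (T : topologicalType) (A B : T -> 'M[R]_4) (x : T) :
  (forall i j, {for x, continuous (fun t => A t i j)}) ->
  (forall i j, {for x, continuous (fun t => B t i j)}) ->
  {for x, continuous (fun t => pf2 (A t) (B t))}.
Proof.
move=> cA cB; have m i j k l := continuous_at_mul (cA i j) (cB k l).
exact: (continuous_at_add (continuous_at_sub (continuous_at_add (continuous_at_add
  (continuous_at_sub (m 0 1 2%:R 3%:R) (m 0 2%:R 1 3%:R)) (m 0 3%:R 1 2%:R))
  (m 1 2%:R 0 3%:R)) (m 1 3%:R 0 2%:R)) (m 2%:R 3%:R 0 1)).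
Qed.

(** [B] stands for the difference of the two forms. It enters through its components and their
    properties, so that no [form2] has to be built for it. *)
Variables (a : form1 M) (B : chart M -> 'rV[R]_4 -> 'M[R]_4).
Hypotheses (B_C1 : forall c i j, Ck 1 (chart_img c) (fun x => B c x i j : R^o))
  (B_skew : forall c x, (B c x)^T = - B c x)
  (B_transform : forall c c' x, overlap c c' x -> B c x =
     'J (transition c c') x *m B c' (transition c c' x) *m ('J (transition c c') x)^T)
  (B_out : forall c x, ~ chart_img c x -> B c x = 0)
  (B_exact : forall c x, chart_img c x -> B c x = d1 a c x)
  (B_closed : forall c x i j k, chart_img c x ->
     partial i (fun y => B c y j k) x + partial j (fun y => B c y k i) x
     + partial k (fun y => B c y i j) x = 0).

Lemma form1_C1 c i : Ck 1 (chart_img c) (fun x => a c x i 0 : R^o).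
Proof. exact: (Ck1_entry i 0 (@open_chart_img _ _ _ c) (form1_smooth a c 1)). Qed.

Lemma pf2_0r A : pf2 A (0 : 'M[R]_4) = 0.
Proof. by rewrite /pf2 !mxE; ring. Qed.

(* The 4-form df /\ a /\ B. *)
Definition Theta (f : M -> R) c x : R := pf2 (wdg (grad f c x) (a c x)) (B c x).

Lemma Theta_out f c x : ~ chart_img c x -> Theta f c x = 0.
Proof. by move=> ncx; rewrite /Theta B_out// pf2_0r. Qed.

Lemma Theta_transform f c c' x : C1_fun f -> overlap c c' x ->
  Theta f c x = \det ('J (transition c c') x) * Theta f c' (transition c c' x).
Proof.
move=> Cf ox; rewrite /Theta (grad_transform Cf ox) (form1_transform a ox).
by rewrite (B_transform ox) wdg_mul pf2_conj//; exact: wdg_skew.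
Qed.

Lemma form_continuous c i j x : chart_img c x -> {for x, continuous (fun y => B c y i j)}.
Proof. by move=> cx; exact: (Ck1_continuous (B_C1 c i j) cx). Qed.

Lemma grad_continuous f c k x : C1_fun f -> chart_img c x ->
  {for x, continuous (fun y => grad f c y k 0)}.
Proof.
move=> Cf cx; rewrite (_ : (fun y => _) = partial k (f \o chart_inv c)); last first.
  by apply/funext => y; rewrite mxE.
exact: (@partial_continuous R 4 _ (f \o chart_inv c) k x (@open_chart_img _ _ _ c) cx (Cf c)).
Qed.

Lemma Theta_continuous f c x : C1_fun f -> chart_img c x -> {for x, continuous (Theta f c)}.
Proof.
move=> Cf cx; apply: pf2_continuous => i j; last exact: form_continuous.
rewrite (_ : (fun y => _) = (fun y => grad f c y i 0 * a c y j 0 - a c y i 0 * grad f c y j 0)); last first.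
  by apply/funext => y; rewrite wdgE.
have ca k := Ck1_continuous (form1_C1 c k) cx; have cg k := @grad_continuous f c k x Cf cx.
exact: (continuous_at_sub (continuous_at_mul (cg i) (ca j)) (continuous_at_mul (ca i) (cg j))).
Qed.

(* The divergence of this vector field is the 4-form d(u /\ A). *)
Definition dual_vec (u : 'cV[R]_4) (A : 'M[R]_4) (k : 'I_4) : R :=
  nth 0 [:: u 1 0 * A 2%:R 3%:R - u 2%:R 0 * A 1 3%:R + u 3%:R 0 * A 1 2%:R;
    - (u 0 0 * A 2%:R 3%:R) + u 2%:R 0 * A 0 3%:R - u 3%:R 0 * A 0 2%:R;
    u 0 0 * A 1 3%:R - u 1 0 * A 0 3%:R + u 3%:R 0 * A 0 1;
    - (u 0 0 * A 1 2%:R) + u 1 0 * A 0 2%:R - u 2%:R 0 * A 0 1] k.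

(* The common shape of the components of [dual_vec]. *)
Let trip c (s1 s2 s3 : bool) (t1 t2 t3 : 'I_4 * 'I_4 * 'I_4) x : R :=
  (-1) ^+ s1 * (a c x t1.1.1 0 * B c x t1.1.2 t1.2) +
  (-1) ^+ s2 * (a c x t2.1.1 0 * B c x t2.1.2 t2.2) +
  (-1) ^+ s3 * (a c x t3.1.1 0 * B c x t3.1.2 t3.2).

Let dual_vec_trip c : [/\
  (fun x => dual_vec (a c x) (B c x) 0) =
    trip c false true false (1, 2%:R, 3%:R) (2%:R, 1, 3%:R) (3%:R, 1, 2%:R),
  (fun x => dual_vec (a c x) (B c x) 1) =
    trip c true false true (0, 2%:R, 3%:R) (2%:R, 0, 3%:R) (3%:R, 0, 2%:R),
  (fun x => dual_vec (a c x) (B c x) 2%:R) =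
    trip c false true false (0, 1, 3%:R) (1, 0, 3%:R) (3%:R, 0, 1) &
  (fun x => dual_vec (a c x) (B c x) 3%:R) =
    trip c true false true (0, 1, 2%:R) (1, 0, 2%:R) (2%:R, 0, 1)].
Proof.
by split; apply/funext => x; rewrite /dual_vec /trip /= !expr0 !expr1 !mul1r !mulN1r.
Qed.

Let term_C1 c (s : bool) (t : 'I_4 * 'I_4 * 'I_4) :
  Ck 1 (chart_img c) (fun x => (-1) ^+ s * (a c x t.1.1 0 * B c x t.1.2 t.2) : R^o).
Proof.
have oc := @open_chart_img _ _ _ c.
exact: (Ck1_mul oc (@Ck1_cst R _ R^o _ ((-1) ^+ nat_of_bool s) oc)
  (Ck1_mul oc (form1_C1 c t.1.1) (B_C1 c t.1.2 t.2))).
Qed.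

Let trip_C1 c s1 s2 s3 t1 t2 t3 :
  Ck 1 (chart_img c) (trip c s1 s2 s3 t1 t2 t3 : _ -> R^o).
Proof.
have oc := @open_chart_img _ _ _ c.
exact: (Ck1_add oc (Ck1_add oc (term_C1 c s1 t1) (term_C1 c s2 t2)) (term_C1 c s3 t3)).
Qed.

Lemma dual_vec_C1 c k : Ck 1 (chart_img c) (fun x => dual_vec (a c x) (B c x) k : R^o).
Proof.
have [e0 e1 e2 e3] := dual_vec_trip c.
by case: (ord4P k) => ->; rewrite ?e0 ?e1 ?e2 ?e3; exact: trip_C1.
Qed.

Let partial_term c k (s : bool) (t : 'I_4 * 'I_4 * 'I_4) x : chart_img c x ->
  partial k (fun y => (-1) ^+ s * (a c y t.1.1 0 * B c y t.1.2 t.2)) x =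
  (-1) ^+ s * (a c x t.1.1 0 * partial k (fun y => B c y t.1.2 t.2) x
    + B c x t.1.2 t.2 * partial k (fun y => a c y t.1.1 0) x).
Proof.
move=> cx; have oc := @open_chart_img _ _ _ c.
have C1 := Ck1_mul oc (form1_C1 c t.1.1) (B_C1 c t.1.2 t.2).
have Cs := @Ck1_cst R _ R^o _ ((-1) ^+ nat_of_bool s) oc.
have e1 := partial_mul k cx Cs C1.
have e2 := partial_mul k cx (form1_C1 c t.1.1) (B_C1 c t.1.2 t.2).
have e3 : partial k (cst ((-1) ^+ nat_of_bool s) : _ -> R) x = 0.
  exact: (@derive_cst _ _ R^o).
by rewrite [LHS]e1 e2 e3 mulr0 addr0.
Qed.

Let partial_trip c k s1 s2 s3 t1 t2 t3 x : chart_img c x ->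
  partial k (trip c s1 s2 s3 t1 t2 t3) x =
  (-1) ^+ s1 * (a c x t1.1.1 0 * partial k (fun y => B c y t1.1.2 t1.2) x
    + B c x t1.1.2 t1.2 * partial k (fun y => a c y t1.1.1 0) x) +
  (-1) ^+ s2 * (a c x t2.1.1 0 * partial k (fun y => B c y t2.1.2 t2.2) x
    + B c x t2.1.2 t2.2 * partial k (fun y => a c y t2.1.1 0) x) +
  (-1) ^+ s3 * (a c x t3.1.1 0 * partial k (fun y => B c y t3.1.2 t3.2) x
    + B c x t3.1.2 t3.2 * partial k (fun y => a c y t3.1.1 0) x).
Proof.
move=> cx; have oc := @open_chart_img _ _ _ c.
have e1 := partial_add k cx (Ck1_add oc (term_C1 c s1 t1) (term_C1 c s2 t2)) (term_C1 c s3 t3).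
have e2 := partial_add k cx (term_C1 c s1 t1) (term_C1 c s2 t2).
by rewrite [LHS]e1 e2 !partial_term.
Qed.

(** d(a ^ B) = da ^ B - a ^ dB: the terms with a derivative of [B] cancel by closedness, those with
    a derivative of [a] assemble into [B] by exactness. *)
Lemma div_dual_vec c x : chart_img c x ->
  \sum_k partial k (fun y => dual_vec (a c y) (B c y) k) x = pf2 (B c x) (B c x).
Proof.
move=> cx; have [e0 e1 e2 e3] := dual_vec_trip c.
rewrite big4 e0 e1 e2 e3.
do 4!rewrite (partial_trip _ _ _ _ _ _ _ cx).
rewrite !expr0 !expr1.
rewrite /=.
(* [B_closed] is stated with cyclic indices, the divergence with increasing ones; skewness of the
   derivatives relates the two. *)
have sk i j k : partial k (fun y => B c y j i) x = - partial k (fun y => B c y i j) x.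
  rewrite -(partial_opp k cx (B_C1 c i j)); congr partial; apply/funext => y.
  by have /matrixP/(_ i j) := B_skew c y; rewrite !mxE.
have ex i j : B c x i j = partial i (fun y => a c y j 0) x - partial j (fun y => a c y i 0) x.
  by rewrite (B_exact cx) mxE.
have c123 := B_closed 1 2%:R 3%:R cx; have c023 := B_closed 0 2%:R 3%:R cx.
have c013 := B_closed 0 1 3%:R cx; have c012 := B_closed 0 1 2%:R cx.
rewrite (sk 1 3%:R) in c123; rewrite (sk 0 3%:R) in c023.
rewrite (sk 0 3%:R) in c013; rewrite (sk 0 2%:R) in c012.
have x01 := ex 0 1; have x02 := ex 0 2%:R; have x03 := ex 0 3%:R.
have x12 := ex 1 2%:R; have x13 := ex 1 3%:R; have x23 := ex 2%:R 3%:R.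
rewrite /pf2.
(* The derivatives become plain variables: twelve of [a], then twelve of [B]. Exactness and
   closedness are then linear relations that eliminate six and four of them, and a polynomial
   identity remains. *)
move: (partial 1 (fun y => a c y 0 0) x) (partial 2%:R (fun y => a c y 0 0) x)
  (partial 3%:R (fun y => a c y 0 0) x) (partial 0 (fun y => a c y 1 0) x)
  (partial 2%:R (fun y => a c y 1 0) x) (partial 3%:R (fun y => a c y 1 0) x)
  (partial 0 (fun y => a c y 2%:R 0) x) (partial 1 (fun y => a c y 2%:R 0) x)
  (partial 3%:R (fun y => a c y 2%:R 0) x) (partial 0 (fun y => a c y 3%:R 0) x)
  (partial 1 (fun y => a c y 3%:R 0) x) (partial 2%:R (fun y => a c y 3%:R 0) x)
  x01 x02 x03 x12 x13 x23 => d10 d20 d30 d01 d21 d31 d02 d12 d32 d03 d13 d23 x01 x02 x03 x12 x13 x23.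
move: c123 c023 c013 c012.
move: (partial 1 (fun y => B c y 2%:R 3%:R) x) (partial 2%:R (fun y => B c y 1 3%:R) x)
  (partial 3%:R (fun y => B c y 1 2%:R) x) (partial 0 (fun y => B c y 2%:R 3%:R) x)
  (partial 2%:R (fun y => B c y 0 3%:R) x) (partial 3%:R (fun y => B c y 0 2%:R) x)
  (partial 0 (fun y => B c y 1 3%:R) x) (partial 1 (fun y => B c y 0 3%:R) x)
  (partial 3%:R (fun y => B c y 0 1) x) (partial 0 (fun y => B c y 1 2%:R) x)
  (partial 1 (fun y => B c y 0 2%:R) x) (partial 2%:R (fun y => B c y 0 1) x)
  => b123 b213 b312 b023 b203 b302 b013 b103 b301 b012 b102 b201 c123 c023 c013 c012.
have -> : b123 = b213 - b312 by lra.
have -> : b023 = b203 - b302 by lra.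
have -> : b013 = b103 - b301 by lra.
have -> : b012 = b102 - b201 by lra.
have -> : d01 = B c x 0 1 + d10 by lra.
have -> : d02 = B c x 0 2%:R + d20 by lra.
have -> : d03 = B c x 0 3%:R + d30 by lra.
have -> : d12 = B c x 1 2%:R + d21 by lra.
have -> : d13 = B c x 1 3%:R + d31 by lra.
have -> : d23 = B c x 2%:R 3%:R + d32 by lra.
ring.
Qed.

Section InBox.
Variables (f : M -> R) (c : chart M) (x0 : 'rV[R]_4) (r : R).
Hypotheses (Cf : C1_fun f) (cube : [set x | `|x - x0| <= r] `<=` chart_img c)
  (f0 : forall p, ~ box c x0 r p -> f p = 0).

Let box_dom : box c x0 r `<=` chart_dom c.
Proof. by move=> p [x xr <-]; have [] := chart_img_inv (cube xr). Qed.

Let in_box x : chart_img c x -> box c x0 r (chart_inv c x) -> `|x - x0| <= r.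
Proof.
move=> cx [y yr yx]; have [_ ey] := chart_img_inv (cube yr).
by have [_ ex] := chart_img_inv cx; rewrite -ex -yx ey.
Qed.

Let clbox : closed (box c x0 r). Proof. exact: closed_box. Qed.

Lemma Cc_pf2_box : Cc (fun x => f (chart_inv c x) * pf2 (B c x) (B c x)).
Proof.
apply: (@Cc_chart c _ _ (compact_box cube) box_dom) => [x cx|x nx].
  apply: continuous_at_mul; first exact: C1_fun_continuous.
  by apply: pf2_continuous => i j; exact: form_continuous.
have [cx|ncx] := pselect (chart_img c x); last by rewrite B_out// pf2_0r mulr0.
by rewrite f0 ?mul0r// => bx; apply: nx.
Qed.

Lemma Cc_Theta_box : Cc (Theta f c).
Proof.
apply: (@Cc_chart c _ _ (compact_box cube) box_dom) => [x cx|x nx].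
  exact: Theta_continuous.
have [cx|ncx] := pselect (chart_img c x); last exact: Theta_out.
rewrite /Theta (grad_out clbox f0 cx); last by move=> bx; apply: nx.
by rewrite /pf2 !wdgE !mxE; ring.
Qed.

Let F k (x : 'rV[R]_4) : R := f (chart_inv c x) * dual_vec (a c x) (B c x) k.

Let F_out k x : ~ (`|x - x0| <= r) -> F k x = 0.
Proof.
move=> nx; rewrite /F; have [cx|ncx] := pselect (chart_img c x).
  by rewrite f0 ?mul0r// => /(in_box cx).
rewrite B_out// (_ : dual_vec _ _ _ = 0) ?mulr0//.
by case: (ord4P k) => ->; rewrite /dual_vec /= !mxE; ring.
Qed.

Let open_out : open (~` [set x : 'rV[R]_4 | `|x - x0| <= r]).
Proof.
apply: closed_openC; apply: compact_closed; last exact: compact_cube.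
exact: norm_hausdorff.
Qed.

Let F_C1 k : Ck 1 setT (F k : _ -> R^o).
Proof.
apply: Ck1_local => x _; have [xr|nxr] := pselect (`|x - x0| <= r).
  exists (chart_img c), (F k); split => //; [exact: open_chart_img|exact: cube|].
  exact: (Ck1_mul (@open_chart_img _ _ _ c) (Cf c) (dual_vec_C1 c k)).
exists (~` [set x : 'rV[R]_4 | `|x - x0| <= r]), (cst 0); split => //.
  exact: (@Ck1_cst R _ R^o _ 0 open_out).
by move=> y; exact: F_out.
Qed.

Let F_supp k : exists N, supp_in N (F k).
Proof.
exists (r + `|x0|) => x Nx; apply: F_out => xr.
have := ler_normD (x - x0) x0; rewrite subrK; lra.
Qed.

(** The integrand is the divergence of [F], the vector field of d(f a ^ B). The function [f]
    confines [F] to the cube, so that [F] extended by 0 is C^1 on R^4 and [I4_partial] applies to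
    each term. *)
Lemma stokes_box :
  I4 (fun x => f (chart_inv c x) * pf2 (B c x) (B c x)) + I4 (Theta f c) = 0.
Proof.
have rI := @radon_I4 R.
rewrite -(radonD rI Cc_pf2_box Cc_Theta_box).
transitivity (I4 (fun x => \sum_k partial k (F k) x)).
  congr I4; apply/funext => x; have [xr|nxr] := pselect (`|x - x0| <= r).
    have cx := cube xr.
    have e k : partial k (F k) x =
        f (chart_inv c x) * partial k (fun y => dual_vec (a c y) (B c y) k) x
        + dual_vec (a c x) (B c x) k * grad f c x k 0.
      by rewrite mxE; exact: (partial_mul k cx (Cf c) (dual_vec_C1 c k)).
    rewrite (eq_bigr _ (fun k _ => e k)) big_split /= -mulr_sumr div_dual_vec//.
    congr (_ + _); rewrite big4 /Theta /pf2 !wdgE /dual_vec /=; ring.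
  have -> : \sum_k partial k (F k) x = 0.
    apply: big1 => k _.
    have : \forall y \near x, F k y = cst 0 y.
      have := open_nbhs_nbhs (conj open_out nxr).
      by apply: filterS => y; exact: F_out.
    move=> h; rewrite /partial (@near_eq_derive _ _ R^o (F k) (cst 0) _ _ h).
    exact: derive_cst.
  have [cx|ncx] := pselect (chart_img c x); last first.
    by rewrite B_out// pf2_0r mulr0 Theta_out// addr0.
  have nb : ~ box c x0 r (chart_inv c x) by move=> /(in_box cx).
  rewrite f0// mul0r add0r /Theta (grad_out clbox f0 cx nb).
  by rewrite /pf2 !wdgE !mxE; ring.
have h := radon_sum rI (index_enum 'I_4) (fun k => Cc_partial_deriv k (F_C1 k) (F_supp k)).
rewrite [LHS]h; apply: big1 => k _; exact: (I4_partial k (F_C1 k) (F_supp k)).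
Qed.

End InBox.

End Stokes.

(** * Comparison of integrals in two charts *)

Section ChartChange.
Context {R : realType} {M : manifold R 4}.
Local Notation I4 := (@I4 R).
Implicit Types (c : chart M) (x y : 'rV[R]_4).

(* [theta] is a 4-form supported in [K]; [s] and [s'] are the orientations of
   the two charts on [K]. *)
Lemma I4_chart_change c c' (theta : chart M -> 'rV[R]_4 -> R) (K : set M) (s s' : R) :
  compact K -> K `<=` chart_dom c -> K `<=` chart_dom c' ->
  (forall c x, chart_img c x -> {for x, continuous (theta c)}) ->
  (forall c x, ~ (chart_img c x /\ K (chart_inv c x)) -> theta c x = 0) ->
  (forall x, overlap c c' x -> theta c x =
     \det ('J (transition c c') x) * theta c' (transition c c' x)) ->
  s * s = 1 ->
  (forall x, overlap c c' x -> K (chart_inv c x) ->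
     \det ('J (transition c c') x) = s * s' * `|\det ('J (transition c c') x)|) ->
  s * I4 (theta c) = s' * I4 (theta c').
Proof.
move=> cK Kc Kc' cth th0 tr ss sg.
have CG := Cc_chart cK Kc (cth c) (th0 c).
have CH' := Cc_chart cK Kc' (cth c') (th0 c').
have CH := CcZ (s * s') CH'; have rI := @radon_I4 R.
have KU : chart_map c @` K `<=` overlap c c'.
  by move=> _ [p Kp <-]; exists p => //; split; [exact: Kc|exact: Kc'].
(* The factor [s * s'] is the sign of the Jacobian determinant on the support, so it trades the
   determinant of the tensor law for its absolute value. *)
have E : I4 (theta c) = I4 (fun x => s * s' * theta c' x).
  apply: (@I4_change_of_variables R (overlap c c') (overlap c' c) (chart_map c @` K)
    (transition c c') (transition c' c)) => //.
  - exact: overlap_open.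
  - exact: overlap_open.
  - exact: transition_Ck1.
  - by move=> x /overlap_transition[].
  - by move=> y oy; exact: (Ck1_continuous (transition_Ck1 c' c) oy).
  - by move=> x /overlap_transition[].
  - by move=> y /overlap_transition[].
  - by move=> x ox; exact: jacobian_transition_unit.
  - exact: chart_image_compact.
  - by move=> x nx; apply: th0 => /(chart_imageP _ Kc).
  - by have [] := CG.
  - move=> y ny; rewrite th0 ?mulr0// => -[cy Ky]; apply: ny.
    exists (chart_map c (chart_inv c' y)); first by exists (chart_inv c' y).
    rewrite /transition /= chart_mapK; last exact: Kc.
    by have [] := chart_img_inv cy.
  - move=> x ox; rewrite (tr x ox).
    have [Kx|nKx] := pselect (K (chart_inv c x)).
      by rewrite {1}(sg x ox Kx) mulrAC.
    have [_ _ ex] := overlap_transition ox.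
    by rewrite (th0 c' (transition c c' x)) ?mulr0 ?mul0r// ex => -[].
rewrite E (radonZ rI _ CH') !mulrA ss mul1r; reflexivity.
Qed.

End ChartChange.

(** * Uniqueness *)

Lemma pf2_wdg_add (R : realType) (u v a : 'cV[R]_4) A :
  pf2 (wdg (u + v) a) A = pf2 (wdg u a) A + pf2 (wdg v a) A.
Proof.
have wE i j : wdg (u + v) a i j = wdg u a i j + wdg v a i j by rewrite !wdgE !mxE; ring.
by rewrite /pf2 !wE; ring.
Qed.

Lemma pf2_wdg0 (R : realType) (a : 'cV[R]_4) A : pf2 (wdg 0 a) A = 0.
Proof.
have wE i j : wdg 0 a i j = 0 by rewrite !wdgE !mxE; ring.
by rewrite /pf2 !wE; ring.
Qed.

Section Uniqueness.
Context {R : realType} {M : manifold R 4}.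
Local Notation I4 := (@I4 R).
Hypothesis M_compact : compact [set: M].
Variables (J : almost_complex M) (w1 w2 : form2 M) (a : form1 M).
Hypotheses (ak1 : almost_kahler J w1) (ak2 : almost_kahler J w2)
  (w_exact : forall c x, chart_img c x -> w2 c x - w1 c x = d1 a c x)
  (w_wedge : wedge w1 w1 = wedge w2 w2).
Implicit Types (c : chart M) (x y : 'rV[R]_4) (p q : M).

Let B c x : 'M[R]_4 := w2 c x - w1 c x.
Let W c x : 'M[R]_4 := w1 c x + w2 c x.

Let w_C1 (w : form2 M) c i j : Ck 1 (chart_img c) (fun x => w c x i j : R^o).
Proof. exact: (Ck1_entry i j (@open_chart_img _ _ _ c) (form2_smooth w c 1)). Qed.

Let Nw_C1 (w : form2 M) c i j : Ck 1 (chart_img c) (fun x => - w c x i j : R^o).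
Proof.
have oc := @open_chart_img _ _ _ c.
have := Ck1_mul oc (@Ck1_cst R _ R^o _ (-1) oc) (w_C1 w c i j).
by congr (Ck 1 _ _); apply/funext => x; rewrite mulN1r.
Qed.

Let B_E c i j : (fun x => B c x i j) = (fun x => w2 c x i j + - w1 c x i j).
Proof. by apply/funext => x; rewrite !mxE. Qed.

Let B_C1 c i j : Ck 1 (chart_img c) (fun x => B c x i j : R^o).
Proof. rewrite B_E; exact: (Ck1_add (@open_chart_img _ _ _ c) (w_C1 w2 c i j) (Nw_C1 w1 c i j)). Qed.

Let B_skew c x : (B c x)^T = - B c x.
Proof. by rewrite /B linearB /= !form2_alt opprB opprK addrC. Qed.

Let W_skew c x : (W c x)^T = - W c x.
Proof. by rewrite /W linearD /= !form2_alt opprD. Qed.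

Let B_transform c c' x : overlap c c' x -> B c x =
  'J (transition c c') x *m B c' (transition c c' x) *m ('J (transition c c') x)^T.
Proof.
by move=> ox; rewrite /B mulmxBr mulmxBl (form2_transform w1 ox) (form2_transform w2 ox).
Qed.

Let W_transform c c' x : overlap c c' x -> W c x =
  'J (transition c c') x *m W c' (transition c c' x) *m ('J (transition c c') x)^T.
Proof.
by move=> ox; rewrite /W mulmxDr mulmxDl (form2_transform w1 ox) (form2_transform w2 ox).
Qed.

Let B_out c x : ~ chart_img c x -> B c x = 0.
Proof. by move=> nx; rewrite /B !form2_out// subrr. Qed.

Let B_closed c x i j k : chart_img c x ->
  partial i (fun y => B c y j k) x + partial j (fun y => B c y k i) x
  + partial k (fun y => B c y i j) x = 0.
Proof.
move=> cx; have pB l m n : partial l (fun y => B c y m n) x =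
    partial l (fun y => w2 c y m n) x - partial l (fun y => w1 c y m n) x.
  rewrite B_E.
  have e1 := partial_add l cx (w_C1 w2 c m n) (Nw_C1 w1 c m n).
  have e2 := partial_opp l cx (w_C1 w1 c m n).
  by rewrite [LHS]e1 e2.
have [[cl1 _] _] := ak1; have [[cl2 _] _] := ak2.
have h1 := cl1 c x cx i j k; have h2 := cl2 c x cx i j k.
rewrite /d2 in h1 h2; rewrite !pB; lra.
Qed.

Let hodge c x : chart_img c x -> [/\ pf2 (W c x) (W c x) != 0,
  pf2 (B c x) (B c x) * pf2 (W c x) (W c x) <= 0 &
  pf2 (B c x) (B c x) = 0 -> B c x = 0].
Proof.
move=> cx; have [_ /(_ c x cx)[s1 p1]] := ak1; have [_ /(_ c x cx)[s2 p2]] := ak2.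
apply: (@hodge_index R (J c x)) => //.
- exact: ac_square.
- exact: form2_alt.
- exact: form2_alt.
(* The component with indices 0, 1, 2, 3 of [wedge] is [pf2] by definition. *)
exact: (congr1 (fun f : form4_comp => f c x 0 1 2%:R 3%:R) w_wedge).
Qed.

(** [hodge] makes [W] ^ [W] nonzero at [p], so by continuity its sign is constant on a small box.
    This sign is a local orientation, encoded as a number of square 1. *)
Let box_ex p : exists t : chart M * R * R, [/\ chart_dom t.1.1 p, 0 < t.1.2, t.2 * t.2 = 1 &
  forall x, `|x - chart_map t.1.1 p| <= t.1.2 ->
    chart_img t.1.1 x /\ 0 < t.2 * pf2 (W t.1.1 x) (W t.1.1 x)].
Proof.
have [c cp] := chart_cover p; pose x0 := chart_map c p.
have cx0 : chart_img c x0 by exact: chart_img_map.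
have [q0 _ _] := hodge cx0; pose s := Num.sg (pf2 (W c x0) (W c x0)).
have sq : 0 < s * pf2 (W c x0) (W c x0) by rewrite /s -normrEsg normr_gt0.
have cW : {for x0, continuous (fun y => s * pf2 (W c y) (W c y))}.
  apply: continuous_at_mul; first exact: (@cst_continuous _ _ s x0).
  have cw i j : {for x0, continuous (fun y => W c y i j)}.
    rewrite (_ : (fun y => _) = (fun y => w1 c y i j + w2 c y i j)); last first.
      by apply/funext => y; rewrite mxE.
    exact: (continuous_at_add (Ck1_continuous (w_C1 w1 c i j) cx0)
      (Ck1_continuous (w_C1 w2 c i j) cx0)).
  exact: pf2_continuous.
have n1 : \forall y \near x0, 0 < s * pf2 (W c y) (W c y).
  by move/cvgr_gt: cW => /(_ 0 sq).
have n2 : \forall y \near x0, chart_img c y.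
  by apply: open_nbhs_nbhs; split => //; exact: open_chart_img.
have n12 : nbhs x0 [set y | chart_img c y /\ 0 < s * pf2 (W c y) (W c y)] by exact: filterI n2 n1.
have /nbhs_ballP[e /= e0 eP] := n12.
(* Half the radius, since the box is closed and the ball is open. *)
exists (c, e / 2, s); split => //=; first by rewrite divr_gt0.
  by rewrite -expr2 sqr_sg q0.
move=> x xe; apply: eP; rewrite -ball_normE /= distrC (le_lt_trans xe)//.
by rewrite ltr_pdivrMr// ltr_pMr// ltr1n.
Qed.

(* A chart at [p], the radius of a box in it, and the sign of [W ^ W] there. *)
Let bx : M -> chart M * R * R := projT1 (boolp.choice box_ex).
Let bxP p := projT2 (boolp.choice box_ex) p.

Let C p : chart M := (bx p).1.1.
Let r p : R := (bx p).1.2.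
Let s p : R := (bx p).2.
Let x0 p := chart_map (C p) p.
Let rho p : M -> R := chart_bump (C p) (x0 p) (r p).
Let K p : set M := box (C p) (x0 p) (r p).
Let O p : set M := [set q | chart_dom (C p) q /\ ball (x0 p) (r p) (chart_map (C p) q)].

Let C_dom p : chart_dom (C p) p. Proof. by have [] := bxP p. Qed.
Let r_gt0 p : 0 < r p. Proof. by have [] := bxP p. Qed.
Let ss p : s p * s p = 1. Proof. by have [] := bxP p. Qed.
Let cube p : [set x | `|x - x0 p| <= r p] `<=` chart_img (C p).
Proof. by move=> x xr; have [_ _ _ /(_ x xr)[]] := bxP p. Qed.
Let s_pos p x : `|x - x0 p| <= r p -> 0 < s p * pf2 (W (C p) x) (W (C p) x).
Proof. by move=> xr; have [_ _ _ /(_ x xr)[]] := bxP p. Qed.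

Let K_dom p : K p `<=` chart_dom (C p).
Proof. by move=> q [x xr <-]; have [] := chart_img_inv (cube xr). Qed.

Let K_cube p x : chart_img (C p) x -> K p (chart_inv (C p) x) -> `|x - x0 p| <= r p.
Proof.
move=> cx [y yr yx]; have [_ ey] := chart_img_inv (cube yr).
by have [_ ex] := chart_img_inv cx; rewrite -ex -yx ey.
Qed.

Let O_open p : open (O p).
Proof.
rewrite openE => q [cq bq].
have n1 : \forall q' \near q, chart_dom (C p) q'.
  by apply: open_nbhs_nbhs; split => //; exact: chart_dom_open.
have n2 : \forall q' \near q, ball (x0 p) (r p) (chart_map (C p) q').
  apply: (chart_map_continuous cq); apply: open_nbhs_nbhs; split => //.
  exact: ball_open.
exact: filterI n1 n2.
Qed.

Let rho_gt0 p q : O p q -> 0 < rho p q.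
Proof. by move=> [cq bq]; rewrite /rho /chart_bump asboolT//; exact: box_bump_gt0. Qed.

Let rho_C1 p : C1_fun (rho p).
Proof. exact: C1_chart_bump (r_gt0 p) (@cube p). Qed.

Let cover_ex : exists D : seq M, forall q, exists2 p, p \in D & O p q.
Proof.
(* The filter of finite lists directed by inclusion: in its near-covering form, compactness gives
   one list that serves all points. *)
pose F : set_system (seq M) := fun A => exists D0 : seq M, forall D : seq M, {subset D0 <= D} -> A D.
have FF : Filter F.
  split; first by exists [::].
  - move=> A A' [D1 h1] [D2 h2]; exists (D1 ++ D2) => D sD; split.
      by apply: h1 => p pD; apply: sD; rewrite mem_cat pD.
    by apply: h2 => p pD; apply: sD; rewrite mem_cat pD orbT.
  - by move=> A A' AA' [D0 h]; exists D0 => D sD; exact/AA'/h.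
have nc := (compact_near_coveringP _).1 M_compact.
have := nc _ F (fun D q => exists2 p, p \in D & O p q) FF.
case=> [q _|D0 /(_ D0 (fun _ => id)) DO]; last by exists D0 => q; exact: DO.
exists (O q, [set D : seq M | q \in D]); first split => /=.
- apply: open_nbhs_nbhs; split; first exact: O_open.
  by split; [exact: C_dom|exact: ballxx].
- by exists [:: q] => D; apply; rewrite mem_head.
by move=> [q' D] [/= Oq' qD]; exists q.
Qed.

Lemma kahler_difference_eq0 c x : chart_img c x -> B c x = 0.
Proof.
have [D DO] := cover_ex.
pose sigma q := \sum_(p <- D) rho p q.
have rho0 p q : 0 <= rho p q by exact: chart_bump_ge0.
have sigma_gt0 q : 0 < sigma q.
  rewrite lt_neqAle eq_sym sumr_ge0// andbT psumr_eq0//; apply/negP => /allP h.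
  have [p pD Opq] := DO q; have := h p pD; rewrite /= gt_eqF//.
  exact: rho_gt0.
have sigma_n0 q : sigma q != 0 by rewrite gt_eqF.
(* Normalization is possible because the sets [O p] with [p] in [D] cover [M], which makes [sigma]
   positive everywhere. *)
pose P p q := rho p q * (sigma q)^-1.
have P_C1 p : C1_fun (P p).
  apply: C1_fun_mul (rho_C1 p) (C1_fun_inv sigma_n0 _).
  by apply: C1_fun_sum => j; exact: rho_C1.
have P_ge0 p q : 0 <= P p q by apply: mulr_ge0; [exact: rho0|rewrite invr_ge0; exact: ltW].
have P_sum q : \sum_(p <- D) P p q = 1.
  by rewrite /P -mulr_suml; exact: (divff (sigma_n0 q)).
have P_out p q : ~ K p q -> P p q = 0.
  by move=> nK; rewrite /P /rho (chart_bump_out (r_gt0 p) nK) mul0r.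
pose Th := Theta a B.
(* The 4-form P_j dP_i ^ a ^ B. Its support lies in the intersection of the boxes [K i] and [K j],
   so it can be integrated in the chart of either. *)
pose th i j c x := P j (chart_inv c x) * Th (P i) c x.
have K_closed p : closed (K p) by exact: closed_box (@cube p).
have K_compact p : compact (K p) by exact: compact_box (@cube p).
have Kij_compact i j : compact (K i `&` K j).
  by apply: (subclosed_compact _ (K_compact i)); [exact: closedI|move=> q []].
have th_cont i j c' y : chart_img c' y -> {for y, continuous (th i j c')}.
  move=> cy; apply: continuous_at_mul; first exact: (C1_fun_continuous (P_C1 j) cy).
  exact: (Theta_continuous B_C1 (P_C1 i) cy).
have th_out i j c' y : ~ (chart_img c' y /\ (K i `&` K j) (chart_inv c' y)) -> th i j c' y = 0.
  move=> ny; rewrite /th; have [cy|ncy] := pselect (chart_img c' y); last first.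
    by rewrite /Th (Theta_out _ B_out)// mulr0.
  have [Kj|nKj] := pselect (K j (chart_inv c' y)); last by rewrite P_out// mul0r.
  have nKi : ~ K i (chart_inv c' y) by move=> Ki; apply: ny.
  rewrite /Th /Theta (grad_out (K_closed i) (P_out i) cy nKi).
  by rewrite pf2_wdg0 mulr0.
have th_Cc i j p : p = i \/ p = j -> Cc (th i j (C p)).
  move=> pij; have dom : K i `&` K j `<=` chart_dom (C p).
    by move=> q [Kiq Kjq]; case: pij => ->; [exact: (K_dom Kiq)|exact: (K_dom Kjq)].
  exact: (Cc_chart (Kij_compact i j) dom (@th_cont i j (C p)) (@th_out i j (C p))).
have change i j : s i * I4 (th i j (C i)) = s j * I4 (th i j (C j)).
  apply: (I4_chart_change (Kij_compact i j)) => //.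
  - by move=> q [Kiq _]; exact: K_dom.
  - by move=> q [_ Kjq]; exact: K_dom.
  - exact: th_cont.
  - exact: th_out.
  - move=> y oy; have [_ _ ey] := overlap_transition oy.
    by rewrite /th ey /Th (Theta_transform a B_skew B_transform (P_C1 i) oy) mulrCA.
  move=> y oy [Ki Kj]; have [oy' _ ey] := overlap_transition oy.
  have cy : chart_img (C i) y by have [] := (overlapE _ _ _).1 oy.
  have cy' : chart_img (C j) (transition (C i) (C j) y) by have [] := (overlapE _ _ _).1 oy'.
  have si := s_pos (K_cube cy Ki).
  have Kj' : K j (chart_inv (C j) (transition (C i) (C j) y)) by rewrite ey.
  have sj := s_pos (K_cube cy' Kj').
  have WE := W_transform oy; rewrite WE pf2_conj// in si.
  move: si sj; set dt := \det _; set qq := pf2 _ _ => si sj.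
  (* [W] ^ [W] is multiplied by [dt] between the two charts and has the signs [s i] and [s j] there,
     so [s i * s j] is the sign of the Jacobian determinant. *)
  have ud : 0 < s i * s j * dt.
    have q2 : 0 < qq ^+ 2.
      by rewrite exprn_even_gt0//=; apply/eqP => q0; rewrite q0 mulr0 ltxx in sj.
    rewrite -(pmulr_lgt0 _ q2).
    have -> : s i * s j * dt * qq ^+ 2 = (s i * (dt * qq)) * (s j * qq) by ring.
    exact: mulr_gt0.
  have uu : s i * s j * (s i * s j) = 1 by rewrite mulrACA !ss mulr1.
  have u1 : `|s i * s j| = 1.
    by apply/eqP; rewrite -(@eqrXn2 _ 2)// -normrX expr2 uu normr1 expr1n.
  rewrite -[`|dt|]mul1r -u1 -normrM (gtr0_norm ud) mulrA uu mul1r.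
  reflexivity.
have rI := @radon_I4 R.
(* Insertion of the sum of the [P j], which is 1. *)
have Th_sum i : I4 (Th (P i) (C i)) = \sum_(j <- D) I4 (th i j (C i)).
  rewrite -(radon_sum rI D (fun j => th_Cc i j i (or_introl erefl))).
  congr I4; apply/funext => y; rewrite -mulr_suml P_sum mul1r; reflexivity.
have Th_add f g c' y : C1_fun f -> C1_fun g -> chart_img c' y ->
    Th (fun q => f q + g q) c' y = Th f c' y + Th g c' y.
  move=> Cf Cg cy; have gE : grad (fun q => f q + g q) c' y = grad f c' y + grad g c' y.
    apply/colP => k; rewrite 3!mxE [in RHS]mxE.
    exact: (partial_add k cy (Cf c') (Cg c')).
  by rewrite /Th /Theta gE pf2_wdg_add.
have Th_cst v c' y : Th (fun=> v) c' y = 0.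
  have gE : grad (fun=> v) c' y = 0.
    by apply/colP => k; rewrite !mxE; exact: (@derive_cst _ _ R^o).
  by rewrite /Th /Theta gE pf2_wdg0.
have Th_bigsum (l : seq M) c' y : chart_img c' y ->
    \sum_(i <- l) Th (P i) c' y = Th (fun q => \sum_(i <- l) P i q) c' y.
  move=> cy; elim: l => [|i l IH].
    have -> : (fun q => \sum_(k <- [::]) P k q) = fun=> 0.
      by apply/funext => q; rewrite big_nil.
    by rewrite big_nil Th_cst.
  have -> : (fun q => \sum_(k <- i :: l) P k q) = fun q => P i q + \sum_(k <- l) P k q.
    by apply/funext => q; rewrite big_cons.
  rewrite big_cons IH; exact: esym (Th_add _ _ _ _ (P_C1 i) (C1_fun_sum l P_C1) cy).
(* With all terms in the chart of [j], the sum over [i] differentiates the constant function 1. *)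
have th_sum0 j : \sum_(i <- D) I4 (th i j (C j)) = 0.
  rewrite -(radon_sum rI D (fun i => th_Cc i j j (or_intror erefl))).
  rewrite -[RHS](radon0 rI); congr I4; apply/funext => y; rewrite -mulr_sumr.
  have [cy|ncy] := pselect (chart_img (C j) y).
    have P1 : (fun q => \sum_(k <- D) P k q) = fun=> 1 by apply/funext => q.
    by rewrite (Th_bigsum D (C j) y cy) P1 Th_cst mulr0.
  rewrite big1 ?mulr0// => i _; exact: (Theta_out _ B_out).
(* The sign makes [E i] nonnegative: [s i] is the sign of [W] ^ [W], and [B] ^ [B] is zero or of the
   opposite sign. *)
pose E i x := - s i * (P i (chart_inv (C i) x) * pf2 (B (C i) x) (B (C i) x)).
have PB_Cc i := Cc_pf2_box B_C1 B_out (P_C1 i) (@cube i) (P_out i).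
have E_Cc i : Cc (E i) by exact: CcZ (PB_Cc i).
have E_ge0 i y : 0 <= E i y.
  rewrite /E mulNr oppr_ge0.
  have [cy|ncy] := pselect (chart_img (C i) y); last first.
    by rewrite B_out// pf2_0r !mulr0.
  have [Ky|nKy] := pselect (K i (chart_inv (C i) y)); last first.
    by rewrite P_out// mul0r mulr0.
  have si := s_pos (K_cube cy Ky); have [_ BW _] := hodge cy.
  rewrite mulrCA; apply: mulr_ge0_le0 => //.
  move: si BW; set qq := pf2 (W _ _) _; set bb := pf2 (B _ _) _ => si BW.
  have q2 : 0 < qq ^+ 2.
    by rewrite exprn_even_gt0//=; apply/eqP => q0; rewrite q0 mulr0 ltxx in si.
  rewrite -(pmulr_lle0 _ q2).
  have -> : s i * bb * qq ^+ 2 = (bb * qq) * (s i * qq) by ring.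
  by rewrite mulr_le0_ge0// ltW.
have I_ge0 i : 0 <= I4 (E i) by have [_ pos _ _] := rI; exact: pos.
have sum0 : \sum_(i <- D) I4 (E i) = 0.
  (* Stokes in the box supplies a second minus sign, which cancels the one in [E]; then [change]
     moves each term to the chart of [j]. *)
  have e i : I4 (E i) = \sum_(j <- D) s j * I4 (th i j (C j)).
    rewrite (radonZ rI _ (PB_Cc i)).
    have := stokes_box B_C1 B_skew B_out w_exact B_closed (P_C1 i) (@cube i) (P_out i).
    move/eqP; rewrite addr_eq0 => /eqP ->.
    rewrite mulrNN -/Th Th_sum mulr_sumr; apply: eq_bigr => j _; exact: change.
  rewrite (eq_bigr _ (fun i _ => e i)) exchange_big big1// => j _.
  by rewrite -mulr_sumr th_sum0 mulr0.
move=> cx; pose q := chart_inv c x.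
have [cq mq] := chart_img_inv cx.
(* A box on which [P i] is positive at the given point: strict positivity of [I4] makes [B] ^ [B]
   vanish there, [hodge] gives [B = 0] in that chart, and the tensor law carries this back to
   [c]. *)
have [i iD Oiq] := DO q.
have Ii : I4 (E i) = 0.
  by move/eqP: sum0; rewrite psumr_eq0// => /allP/(_ i iD)/eqP.
have Ei y : E i y = 0 by have [_ _ str _] := rI; exact: (str _ (E_Cc i) (E_ge0 i) Ii).
have ox : overlap c (C i) x by apply/overlapE; split => //; case: Oiq.
have [oy _ ey] := overlap_transition ox.
have cy : chart_img (C i) (transition c (C i) x) by have [] := (overlapE _ _ _).1 oy.
have := Ei (transition c (C i) x); rewrite /E ey -/q.
have Pi : P i q != 0.
  by rewrite gt_eqF// mulr_gt0 ?invr_gt0//; exact: rho_gt0.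
have si : s i != 0 by apply/eqP => s0; have := ss i; rewrite s0 mul0r => /eqP; rewrite eq_sym oner_eq0.
move/eqP; rewrite mulf_eq0 oppr_eq0 (negbTE si) /= mulf_eq0 (negbTE Pi) /= => /eqP b0.
have [_ _ /(_ b0) Bi0] := hodge cy.
by rewrite (B_transform ox) Bi0 mulmx0 mul0mx.
Qed.

End Uniqueness.

(** Outside the chart images both forms are 0 by convention, and the remaining fields of the record
    are propositions. *)
Lemma form2_eq (R : realType) n (M : manifold R n) (w w' : form2 M) :
  (forall c x, chart_img c x -> w c x = w' c x) -> w = w'.
Proof.
move=> ww'; have : form2_comp w = form2_comp w'.
  apply/funext => c; apply/funext => x.
  by have [/ww'//|nx] := pselect (chart_img c x); rewrite !form2_out.
case: w w' {ww'} => [f s1 a1 t1 o1] [g s2 a2 t2 o2] /= fg; subst g.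
by congr Form2; exact: Prop_irrelevance.
Qed.

(** The primitive is the zero 1-form. Cohomology classes are sets of forms, so a primitive of
    [w2 - w1] is extracted from equal classes by the membership of [w2] in its own. *)
Lemma deRham_class_refl (R : realType) n (M : manifold R n) (w : form2 M) :
  closed_form w -> deRham_class w w.
Proof.
move=> cw; split => //.
have sm c : smooth_on (@chart_img _ _ M c) (fun=> 0 : 'cV[R]_n).
  have C0 k : forall U : set 'rV[R]_n, Ck k U (fun=> 0 : 'cV[R]_n).
    elim: k => [|k IH] U; first by move=> x _; exact: cst_continuous.
    split => [x _|v]; first exact: differentiable_cst.
    rewrite (_ : (fun x => _) = fun=> 0)//.
    by apply/funext => x; rewrite (@diff_cst R _ _ 0 x).
  by move=> k; exact: C0.
have tr (c c' : chart M) x : overlap c c' x ->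
    (0 : 'cV[R]_n) = 'J (transition c c') x *m (0 : 'cV[R]_n) by rewrite mulmx0.
exists (@Form1 R n M (fun _ _ => 0) sm tr (fun _ _ _ => erefl)) => c x cx.
have p0 i (j : 'I_n) : partial i (fun=> (0 : 'cV[R]_n) j 0) x = 0.
  by exact: (@derive_cst _ _ R^o).
rewrite subrr; apply/matrixP => i j; rewrite [LHS]mxE [RHS]mxE.
by rewrite [in RHS]/= !p0 subrr.
Qed.

Theorem mainTheorem3 (R : realType) (M : manifold R 4)
    (M_compact : compact [set: M]) (J : almost_complex M) :
  (forall w1 w2 : form2 M,
     almost_kahler J w1 -> almost_kahler J w2 ->
     deRham_class w1 = deRham_class w2 ->
     wedge w1 w1 = wedge w2 w2 ->
     w1 = w2)
  /\
  (forall (w : form2 M) (F : M -> R),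
     almost_kahler J w -> smooth_function F ->
     forall w' w'' : form2 M,
       almost_kahler J w' -> almost_kahler J w'' ->
       deRham_class w' = deRham_class w'' ->
       wedge w' w' = scale4 (fun p => expR (F p)) (wedge w w) ->
       wedge w'' w'' = scale4 (fun p => expR (F p)) (wedge w w) ->
       w' = w'').
Proof.
have uniq (w1 w2 : form2 M) : almost_kahler J w1 -> almost_kahler J w2 ->
    deRham_class w1 = deRham_class w2 -> wedge w1 w1 = wedge w2 w2 -> w1 = w2.
  move=> ak1 ak2 cl we; have [[cl2 _] _] := ak2.
  (* The equality of classes puts [w2] in the class of [w1], which yields [a] with [w2 - w1 = da] in
     every chart. *)
  have := deRham_class_refl cl2; rewrite -cl => -[_ [a aE]].
  apply: form2_eq => c x cx; apply/esym/eqP; rewrite -subr_eq0; apply/eqP.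
  exact: (kahler_difference_eq0 M_compact ak1 ak2 aE we cx).
split=> [//|w F _ _ w' w'' ak' ak'' cl e1 e2].
by apply: uniq => //; rewrite e1 e2.
Qed.
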